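(* Each of the following Banach spaces is isomorphic to a quotient of some isomorphically polyhedral Banach space with an unconditional basis: (i) every reflexive Banach space with an unconditional basis and non-trivial type; (ii) the space $(\sum c_0)_{\ell_p}$ for every $p\in(1,\infty)$; (iii) Tsirelson's original space $T^*$.
   Context: Banach spaces are over the real field. A Banach space is polyhedral if the closed unit ball of each of its finite-dimensional subspaces has finitely many extreme points; it is isomorphically polyhedral if it is polyhedral under an equivalent norm. Non-trivial type means type $r$ for some $r>1$. The space $(\sum c_0)_{\ell_p}$ is the $\ell_p$-sum of countably infinitely many copies of $c_0$. Tsirelson's original space $T^*$ is the dual of the space $T$ (in the Figiel--Johnson description), where $T$ is the completion of $c_{00}$ under the unique norm satisfying $$\|x\|=\max\Big\{\|x\|_\infty,\ \tfrac12\sup\sum_{i=1}^k\|E_i x\|\Big\},\quad x\in c_{00},$$ the supremum being over all $k\in\mathbb{N}$ and all finite subsets $E_1,\dots,E_k$ of $\mathbb{N}$ with $k\le\min E_1$ and $\max E_i<\min E_{i+1}$ for $i<k$; $E x$ denotes the restriction of $x$ to $E$. *)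

(* Defs.v *)
From HB Require Import structures.
From mathcomp Require Import all_boot all_order all_algebra generic_quotient.
From mathcomp Require Import all_classical all_reals all_analysis.
From mathcomp Require Import ring lra.

Set Implicit Arguments.
Unset Strict Implicit.
Unset Printing Implicit Defensive.

Import Order.TTheory GRing.Theory Num.Theory.
Import numFieldNormedType.Exports.

Local Open Scope classical_set_scope.
Local Open Scope ring_scope.
Local Open Scope quotient_scope.

(* Every Cauchy filter of a normed space converges as soon as every Cauchy
   sequence does. *)
Lemma seq_complete (R : realType) (V : normedModType R) :
  (forall u : nat -> V,
    (forall e, 0 < e -> exists N, forall m n, (N <= m)%N -> (N <= n)%N ->
       `|u m - u n| <= e) ->
    exists l, forall e, 0 < e -> exists N, forall n, (N <= n)%N ->
       `|u n - l| <= e) ->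
  forall F : set_system V, ProperFilter F -> cauchy F -> cvg F.
Proof.
move=> H F FF cF.
have cex := (cauchyP F).1 cF.
have /choice[x Fx] : forall n : nat, exists x : V, F (ball x (n.+1%:R^-1 : R)).
  by move=> n; apply: cex; rewrite invr_gt0.
have small (e : R) : 0 < e -> exists N, forall n, (N <= n)%N -> n.+1%:R^-1 <= e.
  move=> e0; exists (Num.bound e^-1) => n Nn.
  rewrite -[leRHS]invrK lef_pV2 ?posrE ?invr_gt0//.
  have : e^-1 <= (Num.bound e^-1)%:R by rewrite ltW// archi_boundP// invr_ge0 ltW.
  by move=> /le_trans; apply; rewrite ler_nat (leq_trans Nn).
have xd m n : `|x m - x n| <= m.+1%:R^-1 + n.+1%:R^-1.
  have : F (ball (x m) (m.+1%:R^-1 : R) `&` ball (x n) (n.+1%:R^-1 : R)).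
    by apply: filterI.
  move=> /filter_ex[y []]; rewrite -!ball_normE/= => h1 h2.
  rewrite -(subrKA y) (le_trans (ler_normD _ _))// lerD// ?ltW//.
  by rewrite distrC.
have [|l xl] := H x.
  move=> e e0; have [N HN] := small (e / 2) ltac:(by rewrite divr_gt0).
  by exists N => m n Nm Nn; rewrite (le_trans (xd m n))// (splitr e) lerD// HN.
apply/cvg_ex; exists l; apply/cvgrPdist_le => /= e e0.
have e2 : 0 < e / 2 by rewrite divr_gt0.
have [N1 HN1] := small _ e2; have [N2 HN2] := xl _ e2.
pose n := maxn N1 N2.
apply: filterS (Fx n) => y; rewrite -ball_normE/= => /ltW h.
rewrite -(subrKA (x n)) (splitr e) (le_trans (ler_normD _ _))// lerD//.
  by rewrite distrC HN2// leq_maxr.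
by rewrite (le_trans h)// HN1// leq_maxl.
Qed.

Section Dual.
Variables (R : realType) (X : normedModType R).

Definition is_functional : {pred X -> R} :=
  fun f => `[< linear f /\ continuous f >].

Record dual_space :=
  Dual { dual_fun :> X -> R; dualP : dual_fun \in is_functional }.
HB.instance Definition _ := [isSub for dual_fun].
HB.instance Definition _ := [Choice of dual_space by <:].

Lemma functional_submod : submod_closed is_functional.
Proof.
split=> [|a f g].
  apply/asboolP; split; last exact: cst_continuous.
  by move=> a x y; rewrite -[RHS]/(a * 0 + 0) mulr0 addr0.
move=> /asboolP[lf cf] /asboolP[lg cg]; apply/asboolP; split.
  move=> b x y; rewrite -[LHS]/(a * f (b *: x + y) + g (b *: x + y)) lf lg.
  rewrite -[RHS]/(b * (a * f x + g x) + (a * f y + g y)) /GRing.scale/=.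
  by rewrite !mulrDr !mulrA [b * a]mulrC addrACA.
move=> x; apply: cvgD; last exact: cg.
by apply: cvgZr; exact: cf.
Qed.
HB.instance Definition _ :=
  GRing.isSubmodClosed.Build R (X -> R) is_functional functional_submod.
HB.instance Definition _ := [SubChoice_isSubLmodule of dual_space by <:].


Lemma dual_linear (f : dual_space) : linear f.
Proof. by have /asboolP[] := dualP f. Qed.
HB.instance Definition _ (f : dual_space) :=
  GRing.isLinear.Build R X R *%R f (dual_linear f).

Lemma dual_continuous (f : dual_space) : continuous f.
Proof. by have /asboolP[] := dualP f. Qed.

Definition opnorm (f : dual_space) : R :=
  sup [set `|f x| | x in [set x | `|x| <= 1]].

Let opnorm_has_sup (f : dual_space) :
  has_sup [set `|f x| | x in [set x | `|x| <= 1]].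
Proof.
split; first by exists `|f 0|, 0 => //=; rewrite normr0.
have /linear_boundedP[M [_ Mf]] :=
  @continuous_linear_bounded R X R 0 f (@dual_continuous f 0).
exists (`|M| + 1) => _ [x /= x1 <-].
have M1 : M < `|M| + 1 by rewrite ltr_pwDr// ler_norm.
by rewrite (le_trans (Mf _ M1 x))// ler_piMr// addr_ge0.
Qed.

Lemma opnorm_ub (f : dual_space) (x : X) : `|f x| <= opnorm f * `|x|.
Proof.
have [->|x0] := eqVneq x 0; first by rewrite linear0 !normr0 mulr0.
rewrite -ler_pdivrMr ?normr_gt0//.
apply: (sup_upper_bound (opnorm_has_sup f)); exists (`|x|^-1 *: x) => /=.
  by rewrite normrZ normfV normr_id mulVf// normr_eq0.
by rewrite linearZ/= normrM normfV normr_id mulrC.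
Qed.

Lemma opnorm_le (f : dual_space) (M : R) :
  (forall x, `|x| <= 1 -> `|f x| <= M) -> opnorm f <= M.
Proof.
move=> fM; apply: ge_sup; first by case: (opnorm_has_sup f).
by move=> _ [x x1 <-]; exact: fM.
Qed.

Lemma opnorm_ge0 (f : dual_space) : 0 <= opnorm f.
Proof.
apply: (sup_upper_bound (opnorm_has_sup f)); exists 0 => /=.
  by rewrite normr0.
by rewrite linear0 normr0.
Qed.

Let opnormD (f g : dual_space) : opnorm (f + g) <= opnorm f + opnorm g.
Proof.
apply: opnorm_le => x x1; rewrite (le_trans (ler_normD _ _))// lerD//.
  by rewrite (le_trans (opnorm_ub _ _))// ler_piMr// opnorm_ge0.
by rewrite (le_trans (opnorm_ub _ _))// ler_piMr// opnorm_ge0.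
Qed.

Let opnormZ_le (a : R) (f : dual_space) : opnorm (a *: f) <= `|a| * opnorm f.
Proof.
apply: opnorm_le => x x1; rewrite -[leLHS]/`|a * f x| normrM ler_wpM2l//.
by rewrite (le_trans (opnorm_ub _ _))// ler_piMr// opnorm_ge0.
Qed.

Let opnormZ (a : R) (f : dual_space) : opnorm (a *: f) = `|a| * opnorm f.
Proof.
apply/le_anti; rewrite opnormZ_le/=.
have [->|a0] := eqVneq a 0; first by rewrite normr0 mul0r opnorm_ge0.
rewrite mulrC -ler_pdivlMr ?normr_gt0// mulrC -normfV.
by rewrite -[in leLHS](scalerK a0 f) opnormZ_le.
Qed.

Let opnorm0_eq0 (f : dual_space) : opnorm f = 0 -> f = 0.
Proof.
move=> f0; apply/val_inj/funext => x.
by have := opnorm_ub f x; rewrite f0 mul0r normr_le0 => /eqP.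
Qed.

HB.instance Definition _ :=
  @Lmodule_isNormed.Build R dual_space opnorm opnormD opnormZ opnorm0_eq0.

Let dual_complete (F : set_system dual_space) :
  ProperFilter F -> cauchy F -> cvg F.
Proof.
apply: seq_complete => u cu.
have uE m n x : `|u m x - u n x| <= `|u m - u n| * `|x|.
  exact: (opnorm_ub (u m - u n) x).
have ux x : cvgn (fun n => u n x).
  apply/cauchy_cvgP/cauchyP => e e0.
  have x1 : 0 < `|x| + 1 by rewrite ltr_wpDl.
  have [N HN] := cu _ (divr_gt0 e0 x1); exists (u N x).
  exists N => // n /= Nn; rewrite -ball_normE/=.
  rewrite (le_lt_trans (uE _ _ _))//.
  rewrite (@le_lt_trans _ _ (e / (`|x| + 1) * `|x|))//.
    by rewrite ler_wpM2r// HN.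
  by rewrite mulrAC ltr_pdivrMr// ltr_pM2l// ltrDl.
pose g x : R := limn (fun n => u n x).
have gl : linear g.
  move=> a x y; rewrite /g; apply/cvg_lim => //.
  under eq_fun do rewrite linearP/=.
  by apply: cvgD; [apply: cvgZr; exact: ux|exact: ux].
have ug e N : (forall m n, (N <= m)%N -> (N <= n)%N -> `|u m - u n| <= e) ->
    forall n x, (N <= n)%N -> `|u n x - g x| <= e * `|x|.
  move=> HN n x Nn.
  have : (fun m => `|u n x - u m x|) @ \oo --> `|u n x - g x|.
    apply: cvg_norm; apply: cvgB; [exact: cvg_cst|exact: ux].
  move=> /cvg_lim <-//; apply: limr_le.
    by apply: is_cvg_norm; apply: is_cvgB; [exact: is_cvg_cst|exact: ux].
  by exists N => // m /= Nm; rewrite (le_trans (uE _ _ _))// ler_wpM2r// HN.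
pose gL : {linear X -> R} :=
  HB.pack g (GRing.isLinear.Build R X R *%R g gl).
have gc : continuous g.
  have [N HN] := cu 1 ltr01.
  suff : bounded_near gL (nbhs 0) by move=> /bounded_linear_continuous.
  apply/linear_boundedP.
  exists (`|u N| + 1); split => [|M HM x]; first by rewrite num_real.
  apply: (@le_trans _ _ ((`|u N| + 1) * `|x|)); last by rewrite ler_wpM2r// ltW.
  rewrite -[gL x](subKr (u N x)) (le_trans (ler_normB _ _))// mulrDl lerD//.
    exact: opnorm_ub.
  exact: (ug 1 N).
have gP : g \in is_functional by apply/asboolP.
exists (Dual gP) => e e0; have [N HN] := cu e e0; exists N => n Nn.
apply: opnorm_le => x x1.
rewrite (le_trans (ug e N HN n x Nn))// ler_piMr// ltW//.
Qed.

HB.instance Definition _ := Uniform_isComplete.Build dual_space dual_complete.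

End Dual.

Record subspace (R : realType) (V : lmodType R) := Subspace {
  subspace_set :> V -> Prop;
  subspace0 : subspace_set 0;
  subspaceP : forall a x y, subspace_set x -> subspace_set y ->
                subspace_set (a *: x + y) }.

Section LinearQuotient.
Variables (R : realType) (V : lmodType R) (M : subspace V).

Lemma subspaceD x y : M x -> M y -> M (x + y).
Proof. by move=> Mx My; rewrite -[x]scale1r; exact: subspaceP. Qed.

Lemma subspaceZ a x : M x -> M (a *: x).
Proof.
by move=> Mx; rewrite -[_ *: _]addr0; apply: subspaceP => //; exact: subspace0.
Qed.

Lemma subspaceB x y : M x -> M y -> M (x - y).
Proof. by move=> Mx My; rewrite -scaleN1r addrC; exact: subspaceP. Qed.

Definition coset_eq (x y : V) : bool := `[< M (x - y) >].

Let coset_eq_refl : ssrbool.reflexive coset_eq.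
Proof. by move=> x; apply/asboolP; rewrite subrr; exact: subspace0. Qed.
Let coset_eq_sym : ssrbool.symmetric coset_eq.
Proof.
move=> x y; apply/asboolP/asboolP => h.
  by rewrite -opprB -scaleN1r; exact: subspaceZ.
by rewrite -opprB -scaleN1r; exact: subspaceZ.
Qed.
Let coset_eq_trans : ssrbool.transitive coset_eq.
Proof.
move=> y x z /asboolP xy /asboolP yz; apply/asboolP.
by rewrite -(subrKA y); exact: subspaceD.
Qed.

Canonical coset_equiv :=
  EquivRel coset_eq coset_eq_refl coset_eq_sym coset_eq_trans.

Definition lin_quot : Type := {eq_quot coset_equiv}.
HB.instance Definition _ := Choice.on lin_quot.
HB.instance Definition _ := EqQuotient.on lin_quot.

Definition lin_proj (x : V) : lin_quot := \pi_lin_quot x.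

Lemma lin_projK q : lin_proj (repr q) = q.
Proof. exact: reprK. Qed.

Lemma lin_projP (x y : V) : lin_proj x = lin_proj y <-> M (x - y).
Proof.
split=> [/eqP|h].
  by rewrite /lin_proj eqmodE => /asboolP.
by apply/eqP; rewrite /lin_proj eqmodE; apply/asboolP.
Qed.

Let qzero : lin_quot := lin_proj 0.
Let qopp (x : lin_quot) : lin_quot := lin_proj (- repr x).
Let qadd (x y : lin_quot) : lin_quot := lin_proj (repr x + repr y).
Let qscale (a : R) (x : lin_quot) : lin_quot := lin_proj (a *: repr x).

Let repr_pi (x : V) : M (repr (lin_proj x) - x).
Proof. by apply/lin_projP; rewrite lin_projK. Qed.

Let pi_opp x : lin_proj (- x) = qopp (lin_proj x).
Proof.
apply/lin_projP; rewrite opprK addrC; exact: repr_pi.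
Qed.
Let pi_add x y : lin_proj (x + y) = qadd (lin_proj x) (lin_proj y).
Proof.
apply/esym/lin_projP; rewrite opprD addrACA.
by apply: subspaceD; exact: repr_pi.
Qed.
Let pi_scale a x : lin_proj (a *: x) = qscale a (lin_proj x).
Proof.
by apply/esym/lin_projP; rewrite -scalerBr; apply: subspaceZ; exact: repr_pi.
Qed.

Let qaddA : associative qadd.
Proof.
move=> x y z; rewrite -[x]lin_projK -[y]lin_projK -[z]lin_projK.
by rewrite -!pi_add addrA.
Qed.
Let qaddC : commutative qadd.
Proof. by move=> x y; rewrite -[x]lin_projK -[y]lin_projK -!pi_add addrC. Qed.
Let qadd0 : left_id qzero qadd.
Proof. by move=> x; rewrite -[x]lin_projK -pi_add add0r. Qed.
Let qaddN : left_inverse qzero qopp qadd.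
Proof. by move=> x; rewrite -[x]lin_projK -pi_opp -pi_add addNr. Qed.

HB.instance Definition _ := GRing.isZmodule.Build lin_quot qaddA qaddC qadd0 qaddN.

Let qscaleA a b x : qscale a (qscale b x) = qscale (a * b) x.
Proof. by rewrite -[x]lin_projK -!pi_scale scalerA. Qed.
Let qscale1 : left_id 1 qscale.
Proof. by move=> x; rewrite -[x]lin_projK -pi_scale scale1r. Qed.
Let qscaleDr : right_distributive qscale +%R.
Proof.
move=> a x y; rewrite -[x]lin_projK -[y]lin_projK.
by rewrite -[_ + _ in LHS]pi_add -!pi_scale scalerDr pi_add.
Qed.
Let qscaleDl x : {morph qscale^~ x : a b / a + b}.
Proof. by move=> a b; rewrite -[x]lin_projK -!pi_scale scalerDl pi_add. Qed.

HB.instance Definition _ := GRing.Zmodule_isLmodule.Build R lin_quot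
  qscaleA qscale1 qscaleDr qscaleDl.

Lemma lin_proj_linear : linear lin_proj.
Proof. by move=> a x y; rewrite pi_add pi_scale. Qed.
HB.instance Definition _ := GRing.isLinear.Build R V lin_quot *:%R
  lin_proj lin_proj_linear.

End LinearQuotient.

Section QuotientSpace.
Variables (R : realType) (V : normedModType R) (M : subspace V).

Definition quotient_space (clM : closed (subspace_set M)) : Type := lin_quot M.

Variable clM : closed (subspace_set M).
Local Notation Q := (quotient_space clM).
HB.instance Definition _ := GRing.Lmodule.on Q.
HB.instance Definition _ := EqQuotient.on Q.

Definition quotient_norm (q : lin_quot M) : R :=
  inf [set `|x| | x in [set x | lin_proj M x = q]].

Let qn_has_inf q : has_inf [set `|x| | x in [set x | lin_proj M x = q]].
Proof.
split; first by exists `|repr q|, (repr q) => //=; rewrite lin_projK.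
by exists 0 => _ [x _ <-].
Qed.

Lemma quotient_norm_pi x : quotient_norm (lin_proj M x) <= `|x|.
Proof. by apply: inf_lbound; [case: (qn_has_inf (lin_proj M x))|exists x]. Qed.

Lemma quotient_norm_lt q e : quotient_norm q < e ->
  exists2 x, lin_proj M x = q & `|x| < e.
Proof.
move=> qe; have /inf_adherent/(_ (qn_has_inf q)) : 0 < e - quotient_norm q.
  by rewrite subr_gt0.
by move=> [_ [x xq <-]]; rewrite subrKC => h; exists x.
Qed.

Lemma quotient_norm_ge0 q : 0 <= quotient_norm q.
Proof. by apply: lb_le_inf; [case: (qn_has_inf q)|move=> _ [x _ <-]]. Qed.

Let qnD q r : quotient_norm (q + r) <= quotient_norm q + quotient_norm r.
Proof.
apply/ler_addgt0Pr => e e0; have e2 : 0 < e / 2 by rewrite divr_gt0.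
have [x xq xe] := @quotient_norm_lt q (quotient_norm q + e / 2) ltac:(by rewrite ltrDl).
have [y yr ye] := @quotient_norm_lt r (quotient_norm r + e / 2) ltac:(by rewrite ltrDl).
rewrite -xq -yr -raddfD (le_trans (quotient_norm_pi _))//.
rewrite (le_trans (ler_normD _ _))// (splitr e) addrACA.
by rewrite lerD// ltW// ?xq ?yr.
Qed.

Let qnZ_le a q : quotient_norm (a *: q) <= `|a| * quotient_norm q.
Proof.
apply/ler_addgt0Pr => e e0.
have a1 : 0 < `|a| + 1 by rewrite ltr_wpDl.
have ea : 0 < e / (`|a| + 1) by rewrite divr_gt0.
have [x xq xe] := @quotient_norm_lt q (quotient_norm q + e / (`|a| + 1))
  ltac:(by rewrite ltrDl).
rewrite -{1}xq -linearZ (le_trans (quotient_norm_pi _))// normrZ.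
rewrite (@le_trans _ _ (`|a| * (quotient_norm q + e / (`|a| + 1))))//.
  by rewrite ler_wpM2l// ltW.
rewrite mulrDr lerD2l mulrCA ger_pMr// ler_pdivrMr// mul1r lerDl//.
Qed.

Let qnZ a q : quotient_norm (a *: q) = `|a| * quotient_norm q.
Proof.
apply/le_anti; rewrite qnZ_le/=.
have [->|a0] := eqVneq a 0; first by rewrite normr0 mul0r quotient_norm_ge0.
rewrite mulrC -ler_pdivlMr ?normr_gt0// mulrC -normfV.
by rewrite -[in leLHS](scalerK a0 q) qnZ_le.
Qed.

Let qn0_eq0 q : quotient_norm q = 0 -> q = 0.
Proof.
move=> q0; rewrite -[q]lin_projK -[RHS](raddf0 (@lin_proj R V M)).
apply/lin_projP; rewrite subr0; apply: clM => B.
move=> /nbhs_ballP[e /= e0 eB].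
have [|x xq xe] := @quotient_norm_lt q e; first by rewrite q0.
exists (repr q - x); split; first by apply/lin_projP; rewrite lin_projK xq.
by apply: eB; rewrite -ball_normE/= opprB subrKC.
Qed.

HB.instance Definition _ := @Lmodule_isNormed.Build R Q quotient_norm qnD qnZ qn0_eq0.

End QuotientSpace.

Section Completion.
Variables (R : realType) (V : normedModType R).

Definition is_cauchy : {pred nat -> V} := fun u => `[< cauchy (u @ \oo) >].

Record cauchy_seq := CauchySeq { cseq :> nat -> V; cseqP : cseq \in is_cauchy }.
HB.instance Definition _ := [isSub for cseq].
HB.instance Definition _ := [Choice of cauchy_seq by <:].

Lemma cauchy_normP (u : nat -> V) : cauchy (u @ \oo) <->
  (forall e, 0 < e -> exists N, forall m n, (N <= m)%N -> (N <= n)%N ->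
     `|u m - u n| <= e).
Proof.
rewrite cauchyP; split=> [cu e e0|cu e e0].
  have [x [N _ Nx]] := cu (e / 2) ltac:(by rewrite divr_gt0).
  exists N => m n Nm Nn; rewrite -(subrKA x) (splitr e).
  rewrite (le_trans (ler_normD _ _))// lerD// ltW//.
    by have := Nx _ Nm; rewrite /= -ball_normE/= distrC.
  by have := Nx _ Nn; rewrite /= -ball_normE/=.
have [N HN] := cu (e / 2) ltac:(by rewrite divr_gt0).
exists (u N), N => // n /= Nn; rewrite -ball_normE/=.
by rewrite (le_lt_trans (HN _ _ _ _))// gtr_pMr// invf_lt1// ltr1n.
Qed.

Lemma is_cauchy_submod : submod_closed is_cauchy.
Proof.
split=> [|a u v].
  apply/asboolP/cauchy_normP => e e0; exists 0%N => m n _ _.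
  by rewrite -[X in X - _]/(0 : V) -[X in _ - X]/(0 : V) subrr normr0 ltW.
move=> /asboolP/cauchy_normP cu /asboolP/cauchy_normP cv.
apply/asboolP/cauchy_normP => e e0.
have a1 : 0 < `|a| + 1 by rewrite ltr_wpDl.
have [N HN] := cu (e / 2 / (`|a| + 1)) ltac:(by rewrite !divr_gt0).
have [K HK] := cv (e / 2) ltac:(by rewrite !divr_gt0).
exists (maxn N K) => m n; rewrite !geq_max => /andP[Nm Km] /andP[Nn Kn].
rewrite -[X in X - _]/(a *: u m + v m) -[X in _ - X]/(a *: u n + v n).
rewrite opprD addrACA -scalerBr (splitr e) (le_trans (ler_normD _ _))// lerD//.
  rewrite normrZ (le_trans (ler_wpM2l _ (HN _ _ Nm Nn)))//.
  rewrite mulrCA ger_pMr ?divr_gt0// ler_pdivrMr// mul1r lerDl//.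
exact: HK.
Qed.
HB.instance Definition _ :=
  GRing.isSubmodClosed.Build R (nat -> V) is_cauchy is_cauchy_submod.
HB.instance Definition _ := [SubChoice_isSubLmodule of cauchy_seq by <:].

Lemma null_seqP (a : R) (u v : cauchy_seq) :
  u @ \oo --> (0 : V) -> v @ \oo --> (0 : V) ->
  (a *: u + v : cauchy_seq) @ \oo --> (0 : V).
Proof.
move=> u0 v0; have : (fun n => a *: u n + v n) @ \oo --> a *: (0 : V) + 0.
  by apply: cvgD => //; exact: cvgZr.
by rewrite scaler0 addr0.
Qed.

Definition null_seqs : subspace cauchy_seq :=
  @Subspace R cauchy_seq [set u | u @ \oo --> (0 : V)] (cvg_cst 0) null_seqP.

Definition completion : Type := lin_quot null_seqs.
HB.instance Definition _ := GRing.Lmodule.on completion.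
HB.instance Definition _ := EqQuotient.on completion.

Definition completion_norm (x : lin_quot null_seqs) : R :=
  limn (fun n => `|repr x n|).

Let cseq_norm_cvg (u : cauchy_seq) : cvgn (fun n => `|u n|).
Proof.
apply/cauchy_cvgP/cauchyP => e e0.
have /asboolP/cauchy_normP/(_ (e / 2) ltac:(by rewrite divr_gt0))[N HN] := cseqP u.
exists `|u N|, N => // n /= Nn; rewrite -ball_normE/=.
rewrite (le_lt_trans (ler_dist_dist _ _))// (le_lt_trans (HN _ _ _ _))//.
by rewrite gtr_pMr// invf_lt1// ltr1n.
Qed.

Lemma completion_normE (u : cauchy_seq) :
  completion_norm (lin_proj null_seqs u) = limn (fun n => `|u n|).
Proof.
rewrite /completion_norm; set v := repr _.
have vu : (v - u : cauchy_seq) @ \oo --> (0 : V).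
  by apply: (lin_projP null_seqs v u).1; rewrite /v lin_projK.
apply/cvg_lim => //; apply/cvgrPdist_le => e e0.
have e2 : 0 < e / 2 by rewrite divr_gt0.
have /cvgrPdist_le/(_ _ e2) := @cseq_norm_cvg u.
move/cvgrPdist_le : vu => /(_ _ e2).
apply: filterS2 => n /=; rewrite sub0r normrN => h1 h2.
rewrite -(subrKA `|u n|) addrC (splitr e) (le_trans (ler_normD _ _))// addrC.
rewrite lerD// distrC (le_trans (ler_dist_dist _ _))//.
Qed.

Let cnD x y : completion_norm (x + y) <= completion_norm x + completion_norm y.
Proof.
rewrite -[x]lin_projK -[y]lin_projK -raddfD !completion_normE.
rewrite -limD; [|exact: cseq_norm_cvg..].
apply: ler_lim; [exact: cseq_norm_cvg|apply: is_cvgD; exact: cseq_norm_cvg|].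
by apply: nearW => n; exact: ler_normD.
Qed.

Let cnZ a x : completion_norm (a *: x) = `|a| * completion_norm x.
Proof.
rewrite -[x]lin_projK -linearZ !completion_normE.
apply/cvg_lim => //; rewrite (_ : (fun n => _) = (fun n => `|a| * `|repr x n|)).
  by apply: cvgZr; exact: cseq_norm_cvg.
by apply/funext => n; exact: normrZ.
Qed.

Let cn0_eq0 x : completion_norm x = 0 -> x = 0.
Proof.
rewrite -[x]lin_projK completion_normE => x0.
rewrite -[RHS](raddf0 (@lin_proj R cauchy_seq null_seqs)).
apply/lin_projP; rewrite subr0; apply/norm_cvg0P.
by rewrite -x0; exact: cseq_norm_cvg.
Qed.

HB.instance Definition _ := @Lmodule_isNormed.Build R completion
  completion_norm cnD cnZ cn0_eq0.

Lemma const_cauchy (v : V) : (fun=> v) \in is_cauchy.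
Proof.
apply/asboolP/cauchy_normP => e e0; exists 0%N => m n _ _.
by rewrite subrr normr0 ltW.
Qed.

Definition to_completion (v : V) : completion :=
  lin_proj null_seqs (CauchySeq (const_cauchy v)).

Lemma to_completion_linear : linear to_completion.
Proof.
move=> a x y; rewrite /to_completion -linearP; congr (lin_proj _ _).
exact: val_inj.
Qed.
HB.instance Definition _ := GRing.isLinear.Build R V completion *:%R
  to_completion to_completion_linear.

Lemma to_completion_isometry v : `|to_completion v| = `|v|.
Proof.
by rewrite -[LHS]/(completion_norm _) completion_normE; exact: (cvg_lim _ (cvg_cst `|v|)).
Qed.

Lemma to_completion_approx (x : completion) (e : R) : 0 < e ->
  exists v, `|x - to_completion v| <= e.
Proof.
move=> e0; set u := repr x.
have /asboolP/cauchy_normP/(_ e e0)[N HN] := cseqP u; exists (u N).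
rewrite -[x]lin_projK -/u /to_completion -raddfB -[leLHS]/(completion_norm _).
rewrite completion_normE; apply: limr_le; first exact: cseq_norm_cvg.
by exists N => // n /= Nn; exact: HN.
Qed.

Lemma to_completion_dense : dense (range to_completion).
Proof.
move=> O [x Ox] oO; have /nbhs_ballP[e /= e0 eO] : nbhs x O by apply: open_nbhs_nbhs.
have [v xv] := @to_completion_approx x (e / 2) ltac:(by rewrite divr_gt0).
exists (to_completion v); split; last by exists v.
apply: eO; rewrite -ball_normE/= (le_lt_trans xv)//.
by rewrite gtr_pMr// invf_lt1// ltr1n.
Qed.

Let completion_complete (F : set_system completion) :
  ProperFilter F -> cauchy F -> cvg F.
Proof.
apply: seq_complete => u cu.
have small (e : R) : 0 < e -> exists N, forall n, (N <= n)%N -> n.+1%:R^-1 <= e.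
  move=> e0; have /cvgrPdist_le/(_ _ e0)[N _ HN] := @cvg_harmonic R.
  exists N => n Nn; have := HN n Nn; rewrite /= sub0r normrN.
  by rewrite ger0_norm.
have /choice[v uv] : forall n, exists v : V, `|u n - to_completion v| <= n.+1%:R^-1.
  by move=> n; apply: to_completion_approx.
have vP : v \in is_cauchy.
  apply/asboolP/cauchy_normP => e e0.
  have e3 : 0 < e / 3 by rewrite divr_gt0.
  have [N HN] := cu _ e3; have [K HK] := small _ e3.
  exists (maxn N K) => m n; rewrite !geq_max => /andP[Nm Km] /andP[Nn Kn].
  rewrite -to_completion_isometry raddfB -(subrKA (u m)).
  rewrite -[X in _ + X](subrKA (u n)).
  have -> : e = e / 3 + (e / 3 + e / 3) by field.
  rewrite (le_trans (ler_normD _ _))// lerD//.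
    by rewrite distrC (le_trans (uv _))// HK.
  rewrite (le_trans (ler_normD _ _))// lerD//; first exact: HN.
  by rewrite (le_trans (uv _))// HK.
exists (lin_proj null_seqs (CauchySeq vP)) => e e0.
have e2 : 0 < e / 2 by rewrite divr_gt0.
have /asboolP/cauchy_normP/(_ _ e2)[N HN] := vP; have [K HK] := small _ e2.
exists (maxn N K) => n; rewrite !geq_max => /andP[Nn Kn].
rewrite -(subrKA (to_completion (v n))) (splitr e) (le_trans (ler_normD _ _))//.
rewrite lerD//; first by rewrite (le_trans (uv _))// HK.
rewrite /to_completion -raddfB -[leLHS]/(completion_norm _).
rewrite completion_normE; apply: limr_le; first exact: cseq_norm_cvg.
by exists N => // m /= Nm; exact: HN.
Qed.
HB.instance Definition _ := Uniform_isComplete.Build completion completion_complete.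

End Completion.

Definition supnorm (R : realType) (x : nat -> R) : R :=
  sup (range (fun i => `|x i|)).

Section Supnorm.
Variables (R : realType).
Implicit Types x y : nat -> R.

Definition bounded_seq x := exists M, forall i, `|x i| <= M.

Lemma supnorm_ub x i : bounded_seq x -> `|x i| <= supnorm x.
Proof.
move=> [M xM]; apply: sup_upper_bound; last by exists i.
by split; [exists `|x 0|, 0%N|exists M => _ [j _ <-]].
Qed.

Lemma supnorm_le x M : (forall i, `|x i| <= M) -> supnorm x <= M.
Proof. by move=> xM; apply: ge_sup; [exists `|x 0|, 0%N|move=> _ [i _ <-]]. Qed.

Lemma supnormD x y : bounded_seq x -> bounded_seq y ->
  supnorm (x \+ y) <= supnorm x + supnorm y.
Proof.
move=> bx by_; apply: supnorm_le => i.
by rewrite (le_trans (ler_normD _ _))// lerD// supnorm_ub.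
Qed.

Lemma supnormZ a x : bounded_seq x ->
  supnorm (fun i => a * x i) = `|a| * supnorm x.
Proof.
move=> bx; apply/le_anti/andP; split.
  by apply: supnorm_le => i; rewrite normrM ler_wpM2l// supnorm_ub.
have [->|a0] := eqVneq a 0.
  by rewrite normr0 mul0r (le_trans _ (@supnorm_ub _ 0 _))//; exists 0 => i;
     rewrite mul0r normr0.
rewrite -ler_pdivlMl ?normr_gt0//; apply: supnorm_le => i.
rewrite ler_pdivlMl ?normr_gt0// -normrM.
apply: (@supnorm_ub (fun i => a * x i)).
by case: bx => M xM; exists (`|a| * M) => j; rewrite normrM ler_wpM2l.
Qed.

Lemma supnorm0_eq0 x : bounded_seq x -> supnorm x = 0 -> forall i, x i = 0.
Proof.
by move=> bx x0 i; apply/eqP; rewrite -normr_le0 -x0 supnorm_ub.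
Qed.

End Supnorm.

Section C0.
Variable R : realType.

Definition tends_to_0 : {pred nat -> R} := fun x => `[< x @ \oo --> 0 >].

Record c0 := C0 { c0_seq :> nat -> R; c0P : c0_seq \in tends_to_0 }.
HB.instance Definition _ := [isSub for c0_seq].
HB.instance Definition _ := [Choice of c0 by <:].

Lemma tends_to_0_submod : submod_closed tends_to_0.
Proof.
split=> [|a x y]; first by apply/asboolP; exact: cvg_cst.
move=> /asboolP x0 /asboolP y0; apply/asboolP.
have : (fun i => a * x i + y i) @ \oo --> a * 0 + 0.
  by apply: cvgD => //; exact: cvgZr.
by rewrite mulr0 addr0.
Qed.
HB.instance Definition _ :=
  GRing.isSubmodClosed.Build R (nat -> R) tends_to_0 tends_to_0_submod.
HB.instance Definition _ := [SubChoice_isSubLmodule of c0 by <:].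

Lemma c0_cvg (x : c0) : x i @[i --> \oo] --> 0.
Proof. by have /asboolP := c0P x. Qed.

Lemma c0_bounded (x : c0) : bounded_seq x.
Proof.
have /cvg_seq_bounded : cvgn x by apply: cvgP; exact: c0_cvg.
move=> /pinfty_ex_gt0[M _ /= xM]; exists M => i; exact: xM.
Qed.

Let c0_normD (x y : c0) : supnorm (x + y) <= supnorm x + supnorm y.
Proof. by apply: supnormD; exact: c0_bounded. Qed.

Let c0_normZ a (x : c0) : supnorm (a *: x) = `|a| * supnorm x.
Proof. exact: (supnormZ a (@c0_bounded x)). Qed.

Let c0_norm0_eq0 (x : c0) : supnorm x = 0 -> x = 0.
Proof.
by move=> /(supnorm0_eq0 (@c0_bounded x)) x0; apply/val_inj/funext => i; exact: x0.
Qed.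

HB.instance Definition _ := @Lmodule_isNormed.Build R c0
  (fun x => supnorm x) c0_normD c0_normZ c0_norm0_eq0.

Let c0_complete (F : set_system c0) : ProperFilter F -> cauchy F -> cvg F.
Proof.
apply: seq_complete => u cu.
have uE m n i : `|u m i - u n i| <= `|u m - u n|.
  exact: (@supnorm_ub _ (u m - u n) i (c0_bounded _)).
have ui i : cvgn (fun n => u n i).
  apply/cauchy_cvgP/cauchyP => e e0.
  have [N HN] := cu _ (divr_gt0 e0 (@ltr0Sn R 1)); exists (u N i).
  exists N => // n /= Nn; rewrite -ball_normE/=.
  rewrite (le_lt_trans (uE _ _ _))// (le_lt_trans (HN _ _ _ _))//.
  by rewrite ltr_pdivrMr// ltr_pMr// ltr1n.
pose g i : R := limn (fun n => u n i).
have ug e N : (forall m n, (N <= m)%N -> (N <= n)%N -> `|u m - u n| <= e) ->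
    forall n i, (N <= n)%N -> `|u n i - g i| <= e.
  move=> HN n i Nn.
  have : (fun m => `|u n i - u m i|) @ \oo --> `|u n i - g i|.
    apply: cvg_norm; apply: cvgB; [exact: cvg_cst|exact: ui].
  move=> /cvg_lim <-//; apply: limr_le.
    by apply: is_cvg_norm; apply: is_cvgB; [exact: is_cvg_cst|exact: ui].
  by exists N => // m /= Nm; rewrite (le_trans (uE _ _ _))// HN.
have gP : g \in tends_to_0.
  apply/asboolP/cvgrPdist_le => /= e e0.
  have e2 : 0 < e / 2 by rewrite divr_gt0.
  have [N HN] := cu _ e2.
  have /cvgrPdist_le/(_ _ e2) := c0_cvg (u N).
  apply: filterS => i /=; rewrite !sub0r !normrN => h.
  rewrite -[g i](subKr (u N i)) (le_trans (ler_normB _ _))// (splitr e) lerD//.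
  exact: ug HN _ _ _.
exists (C0 gP) => e e0; have [N HN] := cu e e0; exists N => n Nn.
by apply: supnorm_le => i; exact: ug HN _ _ _.
Qed.
HB.instance Definition _ := Uniform_isComplete.Build c0 c0_complete.

End C0.

Lemma cvg_powR (R : realType) (p : R) (a : nat -> R) (l : R) : 0 < p ->
  (forall n, 0 <= a n) -> a @ \oo --> l -> (a n `^ p) @[n --> \oo] --> l `^ p.
Proof.
move=> p0 a0 al.
have l0 : 0 <= l.
  by rewrite -(cvg_lim _ al)//; apply: limr_ge; [exact: cvgP al|exact: nearW].
move: l0; rewrite le_eqVlt => /predU1P[l0|l0].
  rewrite -l0 powR0 ?gt_eqF//; apply/cvgrPdist_le => /= e e0.
  have ep : 0 < e `^ p^-1 by rewrite powR_gt0.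
  move: al; rewrite -l0 => /cvgrPdist_le/(_ _ ep); apply: filterS => n.
  rewrite !sub0r !normrN !ger0_norm ?powR_ge0// => h.
  have := @ge0_ler_powR R p (ltW p0) _ _ _ _ h.
  by rewrite !nnegrE a0 powR_ge0 -powRrM mulVf ?gt_eqF// powRr1 ?(ltW e0)//; apply.
have -> : l `^ p = expR (p * ln l) by rewrite /powR gt_eqF.
have : expR (p * ln (a n)) @[n --> \oo] --> expR (p * ln l).
  apply: (@cvg_comp _ _ _ (fun n => p * ln (a n)) expR); last exact: continuous_expR.
  by apply: cvgZr; apply: (@cvg_comp _ _ _ a (@ln R)); [exact: al|exact: continuous_ln].
move=> H; apply: cvg_trans H; apply: near_eq_cvg; near=> n.
rewrite /powR gt_eqF//; near: n; exact: (cvgr_gt _ al).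
Unshelve. all: by end_near.
Qed.

Section LpSum.
Variables (R : realType) (p : R) (p1 : 1 <= p).
Variable X : completeNormedModType R.

Definition lp_esum (u : nat -> X) : \bar R := (\sum_(n <oo) (`|u n| `^ p)%:E)%E.

Definition p_summable : {pred nat -> X} := fun u => (lp_esum u < +oo)%E.

(* The proof [hp] occurs as a parameter only because the norm instance below
   (the triangle inequality) needs it. *)
Record lp_sum (hp : 1 <= p) :=
  LpSum { lp_seq :> nat -> X; lpP : lp_seq \in p_summable }.
Local Notation lpX := (lp_sum p1).
HB.instance Definition _ := [isSub of lpX for @lp_seq p1].
HB.instance Definition _ := [Choice of lpX by <:].

Definition lp_norm (u : nat -> X) : R := fine (lp_esum u) `^ p^-1.

Let p0 : 0 < p. Proof. exact: lt_le_trans p1. Qed.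
Let pn0 : p != 0. Proof. by rewrite gt_eqF. Qed.

Lemma lp_esum_ge0 u : (0 <= lp_esum u)%E.
Proof. by apply: nneseries_ge0 => n _ _; rewrite lee_fin powR_ge0. Qed.

Let lp_esum_fin u : u \in p_summable -> lp_esum u \is a fin_num.
Proof. by move=> us; rewrite ge0_fin_numE// lp_esum_ge0. Qed.

Let fine_poweR_leD (a b c : \bar R) q :
  a \is a fin_num -> b \is a fin_num -> c \is a fin_num ->
  (c `^ q <= a `^ q + b `^ q)%E -> fine c `^ q <= fine a `^ q + fine b `^ q.
Proof. by case: a b c => [a| |] [b| |] [c| |]. Qed.

Let LnormE u :
  ('N[counting]_p%:E[EFin \o (fun n => `|u n|)%R] = lp_esum u `^ p^-1)%E.
Proof.
rewrite Lnorm_counting//; congr (_ `^ _)%E; apply: eq_eseriesr => n _ /=.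
by rewrite normr_id.
Qed.

Let lp_eminkowski u v :
  (lp_esum (u \+ v)%R `^ p^-1 <= lp_esum u `^ p^-1 + lp_esum v `^ p^-1)%E.
Proof.
rewrite -(LnormE u) -(LnormE v).
apply: le_trans (@minkowski_EFin _ _ _ counting _ _ _ _ _ p1) => //.
rewrite Lnorm_counting//; apply: gt0_ler_poweR.
- by rewrite invr_ge0 ltW.
- by rewrite in_itv/= leey lp_esum_ge0.
- rewrite in_itv/= leey andbT.
  by apply: nneseries_ge0 => n _ _; rewrite lee_fin powR_ge0.
- apply: lee_nneseries => [n _ _|n _]; first by rewrite lee_fin powR_ge0.
  rewrite lee_fin ge0_ler_powR ?nnegrE ?(ltW p0)//.
  by rewrite [leRHS]ger0_norm ?addr_ge0 ?normr_ge0// ler_normD.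
Qed.

Let lp_esumZ a u : (lp_esum (a \*: u)%R = (`|a| `^ p)%:E * lp_esum u)%E.
Proof.
rewrite /lp_esum -nneseriesZl//.
by apply: eq_eseriesr => n _; rewrite normrZ powRM// EFinM.
Qed.

Let lp_esum0 : lp_esum 0 = 0%E.
Proof.
by apply: eseries0 => n _ _; rewrite -[X in `|X|]/(0 : X) normr0 powR0.
Qed.

Lemma p_summable_submod : submod_closed p_summable.
Proof.
split=> [|a u v us vs]; first by rewrite /in_mem/= /p_summable lp_esum0.
have aus : (lp_esum (a \*: u)%R `^ p^-1 < +oo)%E.
  by apply: poweR_lty; rewrite lp_esumZ lte_mul_pinfty// lee_fin powR_ge0.
have vs' : (lp_esum v `^ p^-1 < +oo)%E by apply: poweR_lty.
have := le_lt_trans (lp_eminkowski (a \*: u) v) (lte_add_pinfty aus vs').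
by move=> /(lty_poweRy _); apply; rewrite invr_eq0.
Qed.
HB.instance Definition _ :=
  GRing.isSubmodClosed.Build R (nat -> X) p_summable p_summable_submod.
HB.instance Definition _ := [SubChoice_isSubLmodule of lpX by <:].

Let lp_normD (u v : lpX) : lp_norm (u + v) <= lp_norm u + lp_norm v.
Proof.
apply: fine_poweR_leD (lp_eminkowski u v); apply: lp_esum_fin.
- exact: (lpP u).
- exact: (lpP v).
- exact: (lpP (u + v)).
Qed.

Let lp_normZ a (u : lpX) : lp_norm (a *: u) = `|a| * lp_norm u.
Proof.
rewrite /lp_norm -[X in lp_esum X]/(a \*: (u : nat -> X)) lp_esumZ.
rewrite fineM ?lp_esum_fin ?(lpP u)//= powRM ?powR_ge0 ?fine_ge0 ?lp_esum_ge0//.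
by rewrite -powRrM mulfV// powRr1.
Qed.

Let lp_psum_le (u : lpX) K : \sum_(0 <= k < K) `|u k| `^ p <= lp_norm u `^ p.
Proof.
rewrite /lp_norm -powRrM mulVf// powRr1 ?fine_ge0 ?lp_esum_ge0//.
rewrite -lee_fin fineK ?lp_esum_fin ?(lpP u)// -sumEFin.
by apply: nneseries_lim_ge => n _; rewrite lee_fin powR_ge0.
Qed.

Let lp_norm_coord (u : lpX) k : `|u k| <= lp_norm u.
Proof.
rewrite -[leLHS]powRr1// -[leRHS]powRr1 ?powR_ge0// -(mulfV pn0) !powRrM.
rewrite ge0_ler_powR ?nnegrE ?invr_ge0 ?(ltW p0) ?powR_ge0//.
rewrite (le_trans _ (lp_psum_le u k.+1))// big_nat_recr//= lerDr.
by rewrite sumr_ge0// => n _; rewrite powR_ge0.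
Qed.

Let lp_norm_le (u : nat -> X) e : 0 <= e ->
  (forall n, \sum_(0 <= k < n) `|u k| `^ p <= e `^ p) ->
  u \in p_summable /\ lp_norm u <= e.
Proof.
move=> e0 ue.
have ule : (lp_esum u <= (e `^ p)%:E)%E.
  apply: lime_le.
    by apply: is_cvg_nneseries => n _ _; rewrite lee_fin powR_ge0.
  by apply: nearW => n; rewrite sumEFin lee_fin.
have us : u \in p_summable by apply: le_lt_trans ule (ltry _).
split=> //; rewrite /lp_norm -[leRHS](powRr1 e0) -(mulfV pn0) powRrM.
rewrite ge0_ler_powR ?nnegrE ?invr_ge0 ?(ltW p0) ?powR_ge0 ?fine_ge0 ?lp_esum_ge0//.
by rewrite -lee_fin fineK// lp_esum_fin.
Qed.

Let lp_norm0_eq0 (u : lpX) : lp_norm u = 0 -> u = 0.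
Proof.
move=> u0; apply/val_inj/funext => k; apply/eqP.
by rewrite -[_ == _]/(u k == 0) -normr_le0 -u0 lp_norm_coord.
Qed.

HB.instance Definition _ := @Lmodule_isNormed.Build R lpX
  (fun u => lp_norm u) lp_normD lp_normZ lp_norm0_eq0.

Let lp_complete (F : set_system lpX) : ProperFilter F -> cauchy F -> cvg F.
Proof.
apply: seq_complete => u cu.
have uE m n k : `|u m k - u n k| <= `|u m - u n|.
  exact: (lp_norm_coord (u m - u n)).
have uk k : cvgn (fun n => u n k).
  apply/cauchy_cvgP/cauchyP => e e0.
  have [N HN] := cu _ (divr_gt0 e0 (@ltr0Sn R 1)); exists (u N k).
  exists N => // n /= Nn; rewrite -ball_normE/=.
  rewrite (le_lt_trans (uE _ _ _))// (le_lt_trans (HN _ _ _ _))//.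
  by rewrite ltr_pdivrMr// ltr_pMr// ltr1n.
pose g k : X := limn (fun n => u n k).
have ug e N : 0 < e ->
    (forall m n, (N <= m)%N -> (N <= n)%N -> `|u m - u n| <= e) ->
    forall n, (N <= n)%N ->
      (u n : nat -> X) - g \in p_summable /\ lp_norm ((u n : nat -> X) - g) <= e.
  move=> e0 HN n Nn; apply: lp_norm_le; first exact: ltW.
  move=> K.
  have lim : \sum_(0 <= k < K) `|u n k - u m k| `^ p @[m --> \oo] -->
      \sum_(0 <= k < K) `|u n k - g k| `^ p.
    apply: cvg_big => [|k _]; first exact: add_continuous.
    apply: cvg_powR => //.
    by apply: cvg_norm; apply: cvgB; [exact: cvg_cst|exact: uk].
  rewrite -[leLHS]/(\sum_(0 <= k < K) `|u n k - g k| `^ p) -(cvg_lim _ lim)//.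
  apply: limr_le; first exact: cvgP lim.
  exists N => // m /= Nm.
  apply: le_trans (lp_psum_le (u n - u m) K) _.
  by rewrite ge0_ler_powR ?nnegrE ?powR_ge0 ?(ltW p0) ?(ltW e0)//; exact: HN.
have [N0 HN0] := cu 1 ltr01.
have [ug0 _] := ug 1 N0 ltr01 HN0 N0 (leqnn _).
have gP : g \in p_summable.
  by have := rpredB (lpP (u N0)) ug0; rewrite subKr.
exists (LpSum p1 gP) => e e0; have [N HN] := cu e e0; exists N => n Nn.
by have [] := ug e N e0 HN n Nn.
Qed.
HB.instance Definition _ := Uniform_isComplete.Build lpX lp_complete.

End LpSum.

Definition is_norm (R : realType) (V : lmodType R) (N : V -> R) : Prop :=
  [/\ forall x, N x = 0 -> x = 0,
      forall (a : R) x, N (a *: x) = `|a| * N x &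
      forall x y, N (x + y) <= N x + N y].

Section C00.
Variable R : realType.

Definition finitely_supported : {pred nat -> R} :=
  fun x => `[< \forall n \near \oo, x n = 0 >].

Record c00 :=
  C00 { c00_seq :> nat -> R; c00P : c00_seq \in finitely_supported }.
HB.instance Definition _ := [isSub for c00_seq].
HB.instance Definition _ := [Choice of c00 by <:].

Lemma finitely_supported_submod : submod_closed finitely_supported.
Proof.
split=> [|a x y /asboolP x0 /asboolP y0]; apply/asboolP; first exact: nearW.
move: x0 y0; apply: filterS2 => n x0 y0.
by rewrite -[LHS]/(a * x n + y n) x0 y0 mulr0 addr0.
Qed.
HB.instance Definition _ :=
  GRing.isSubmodClosed.Build R (nat -> R) finitely_supported
    finitely_supported_submod.
HB.instance Definition _ := [SubChoice_isSubLmodule of c00 by <:].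

Lemma restr_finitely_supported (E : set nat) (x : c00) :
  patch (fun=> 0) E x \in finitely_supported.
Proof.
have /asboolP x0 := c00P x; apply/asboolP; move: x0; apply: filterS => n x0.
by rewrite /patch x0 if_same.
Qed.

Definition restr (E : set nat) (x : c00) : c00 :=
  C00 (restr_finitely_supported E x).

(* Coordinates are numbered from 0: the natural number i : nat stands for the
   index i + 1 of {1, 2, 3, ...}, so that k <= min E_1 reads k <= j.+1 for all
   j in E 0.  The sets E_1, ..., E_k are E 0, ..., E k.-1. *)
Definition admissible (k : nat) (E : nat -> set nat) : Prop :=
  [/\ (0 < k)%N,
      forall i, (i < k)%N -> finite_set (E i) /\ E i !=set0,
      forall j, E 0%N j -> (k <= j.+1)%N &
      forall i, (i.+1 < k)%N ->
        forall a b, E i a -> E i.+1 b -> (a < b)%N].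

Definition admissible_sums (N : c00 -> R) (x : c00) : set R :=
  [set s | exists k E, admissible k E /\ s = \sum_(i < k) N (restr (E i) x)].

(* The supremum is taken in the extended reals, where it always exists. *)
Definition tsirelson_equation (N : c00 -> R) : Prop := forall x,
  ((N x)%:E =
   maxe (supnorm x)%:E
        (2^-1%:E * ereal_sup [set s%:E | s in admissible_sums N x]))%E.

Lemma c00_bound (x : c00) : exists n, forall i, (n <= i)%N -> x i = 0.
Proof. by have /asboolP[n _ xn] := c00P x; exists n. Qed.

Lemma c00_eqP (x y : c00) : (forall i, x i = y i) -> x = y.
Proof. by move=> xy; apply/val_inj/funext. Qed.

Lemma c00_bounded (x : c00) : bounded_seq x.
Proof.
have [n xn] := c00_bound x; exists (\sum_(i < n) `|x i|) => i.
have [ni|ni] := leqP n i; first by rewrite xn// normr0 sumr_ge0.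
by rewrite (bigD1 (Ordinal ni))//= lerDl sumr_ge0.
Qed.

Lemma restrZ E a x : restr E (a *: x) = a *: restr E x.
Proof.
apply: c00_eqP => i; rewrite -[RHS]/(a * restr E x i) /= /patch.
by case: ifP; rewrite ?mulr0.
Qed.

Lemma restrD E x y : restr E (x + y) = restr E x + restr E y.
Proof.
apply: c00_eqP => i; rewrite -[RHS]/(restr E x i + restr E y i) /= /patch.
by case: ifP; rewrite ?addr0.
Qed.

Lemma admissible_disj k E : admissible k E -> forall i j, (i < j < k)%N ->
  forall a b, E i a -> E j b -> (a < b)%N.
Proof.
move=> [_ Efin _ Elt] i j; elim: j => [|j IH]; first by rewrite ltn0.
move=> /andP[+ jk] a b Ea Eb; rewrite ltnS leq_eqVlt => /predU1P[ij|ij].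
  by move: Ea Eb; rewrite ij; exact: Elt.
have [_ [c Ec]] := Efin j (ltnW jk).
apply: (@ltn_trans c); last exact: Elt Ec Eb.
by apply: IH => //; rewrite ij ltnW.
Qed.

Lemma admissible1 : admissible 1 (fun=> [set 0%N]).
Proof. by split => // i _; split; [exact: finite_set1|exists 0%N]. Qed.

(* Seminorms dominated by the ell_1 norm, and the right-hand side of the
   Tsirelson equation as an operator on them. *)
Let snorm (M : c00 -> R) :=
  [/\ forall x, 0 <= M x, forall (a : R) x, M (a *: x) <= `|a| * M x,
      forall x y, M (x + y) <= M x + M y &
      forall n (x : c00), (forall i, (n <= i)%N -> x i = 0) ->
        M x <= \sum_(i < n) `|x i|].

Let Phi (M : c00 -> R) (x : c00) : R :=
  Num.max (supnorm x) (2^-1 * sup (admissible_sums M x)).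

Let sums_le M n (x : c00) s : snorm M -> (forall i, (n <= i)%N -> x i = 0) ->
  admissible_sums M x s -> s <= \sum_(i < n) `|x i|.
Proof.
move=> [M0 _ _ Ml] xn [k [E [aE ->]]].
apply: (@le_trans _ _ (\sum_(i < k) \sum_(j < n) `|restr (E i) x j|)).
  by apply: ler_sum => i _; apply: Ml => j nj; rewrite /= /patch xn// if_same.
rewrite exchange_big/=; apply: ler_sum => j _.
have [[i Ei]|nE] := pselect (exists i : 'I_k, E i j).
  rewrite (bigD1 i)//= [X in _ + X]big1 ?addr0.
    by rewrite /patch mem_set.
  move=> i' i'i; rewrite /patch; case: ifPn => [|_]; last by rewrite normr0.
  rewrite inE => Ei'; exfalso; move: i'i.
  rewrite -val_eqE/= neq_ltn => /orP[]h.
    by have := admissible_disj aE _ Ei' Ei; rewrite h ltn_ord ltnn => /(_ isT).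
  by have := admissible_disj aE _ Ei Ei'; rewrite h ltn_ord ltnn => /(_ isT).
rewrite big1// => i _; rewrite /patch; case: ifPn => [|_]; last by rewrite normr0.
by rewrite inE => Ei; exfalso; apply: nE; exists i.
Qed.

Let sums_sup M x : snorm M -> has_sup (admissible_sums M x).
Proof.
move=> sM; split; first by eexists; exists 1%N, (fun=> [set 0%N]); split;
  [exact: admissible1|].
by have [n xn] := c00_bound x; exists (\sum_(i < n) `|x i|) => s; exact: sums_le.
Qed.

Let sums_ub M x k E : snorm M -> admissible k E ->
  \sum_(i < k) M (restr (E i) x) <= sup (admissible_sums M x).
Proof.
by move=> sM aE; apply: sup_upper_bound; [exact: sums_sup|exists k, E].
Qed.

Let sums_lub M x B :
  (forall k E, admissible k E -> \sum_(i < k) M (restr (E i) x) <= B) ->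
  sup (admissible_sums M x) <= B.
Proof.
move=> H; apply: ge_sup.
  by eexists; exists 1%N, (fun=> [set 0%N]); split; [exact: admissible1|].
by move=> _ [k [E [aE ->]]]; exact: H.
Qed.

Let sup_ge0 M x : snorm M -> 0 <= sup (admissible_sums M x).
Proof.
move=> sM; apply: le_trans (sums_ub x sM admissible1).
by apply: sumr_ge0 => i _; case: sM.
Qed.

Let Phi_mono M M' x : snorm M -> snorm M' -> (forall x, M x <= M' x) ->
  Phi M x <= Phi M' x.
Proof.
move=> sM sM' MM'; rewrite /Phi ge_max !le_max lexx/=; apply/orP; right.
rewrite ler_pM2l ?invr_gt0//; apply: sums_lub => k E aE.
by apply: le_trans (sums_ub x sM' aE); apply: ler_sum.
Qed.

Let supnorm_ge0 (x : c00) : 0 <= supnorm x.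
Proof. exact: le_trans (supnorm_ub 0 (@c00_bounded x)). Qed.

Let Phi_snorm M : snorm M -> snorm (Phi M).
Proof.
move=> sM; have [M0 MZ MD Ml] := sM; split.
- by move=> x; rewrite le_max supnorm_ge0.
- move=> a x; rewrite /Phi ge_max; apply/andP; split.
    rewrite (_ : supnorm _ = `|a| * supnorm x); last first.
      exact: (supnormZ a (@c00_bounded x)).
    by rewrite ler_wpM2l// le_max lexx.
  apply: (@le_trans _ _ (`|a| * (2^-1 * sup (admissible_sums M x)))).
    rewrite mulrCA ler_pM2l ?invr_gt0//; apply: sums_lub => k E aE.
    apply: le_trans (ler_wpM2l (normr_ge0 a) (sums_ub x sM aE)).
    by rewrite mulr_sumr; apply: ler_sum => i _; rewrite restrZ.
  by rewrite ler_wpM2l// le_max lexx orbT.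
- move=> x y; rewrite {1}/Phi ge_max; apply/andP; split.
    apply: (le_trans (supnormD (@c00_bounded x) (@c00_bounded y))).
    by rewrite lerD// le_max lexx.
  apply: (@le_trans _ _ (2^-1 * sup (admissible_sums M x) +
                         2^-1 * sup (admissible_sums M y))).
    rewrite -mulrDr ler_pM2l ?invr_gt0//; apply: sums_lub => k E aE.
    apply: le_trans (lerD (sums_ub x sM aE) (sums_ub y sM aE)).
    by rewrite -big_split; apply: ler_sum => i _; rewrite restrD.
  by rewrite lerD// le_max lexx orbT.
- move=> n x xn; rewrite /Phi ge_max; apply/andP; split.
    apply: supnorm_le => i.
    have [ni|ni] := leqP n i; first by rewrite xn// normr0 sumr_ge0.
    by rewrite (bigD1 (Ordinal ni))//= lerDl sumr_ge0.
  apply: (@le_trans _ _ (sup (admissible_sums M x))).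
    by rewrite ler_piMl ?sup_ge0// invf_le1// ler1n.
  apply: ge_sup; first by case: (sums_sup x sM).
  by move=> s; exact: sums_le.
Qed.

Let post := [set M : c00 -> R | snorm M /\ forall x, M x <= Phi M x].

Let post_supnorm : post (fun x => supnorm x).
Proof.
split; last by move=> x; rewrite le_max lexx.
split.
- exact: supnorm_ge0.
- by move=> a x; rewrite (supnormZ a (@c00_bounded x)).
- by move=> x y; exact: (supnormD (@c00_bounded x) (@c00_bounded y)).
- move=> n x xn; apply: supnorm_le => i.
  have [ni|ni] := leqP n i; first by rewrite xn// normr0 sumr_ge0.
  by rewrite (bigD1 (Ordinal ni))//= lerDl sumr_ge0.
Qed.

Let T (x : c00) : R := sup [set M x | M in post].

Let T_has_sup x : has_sup [set M x | M in post].
Proof.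
split; first by exists (supnorm x), (fun x : c00 => supnorm x).
have [n xn] := c00_bound x; exists (\sum_(i < n) `|x i|) => _ [M [[_ _ _ Ml] _] <-].
exact: Ml.
Qed.

Let T_ub M x : post M -> M x <= T x.
Proof. by move=> pM; apply: sup_upper_bound; [exact: T_has_sup|exists M]. Qed.

Let T_lub x B : (forall M, post M -> M x <= B) -> T x <= B.
Proof.
move=> H; apply: ge_sup; first by case: (T_has_sup x).
by move=> _ [M pM <-]; exact: H.
Qed.

Let T_snorm : snorm T.
Proof.
split.
- by move=> x; apply: le_trans (T_ub x post_supnorm); exact: supnorm_ge0.
- move=> a x; apply: T_lub => M pM; have [[_ MZ _ _] _] := pM.
  by apply: (le_trans (MZ a x)); rewrite ler_wpM2l// T_ub.
- move=> x y; apply: T_lub => M pM; have [[_ _ MD _] _] := pM.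
  by apply: (le_trans (MD x y)); rewrite lerD// T_ub.
- by move=> n x xn; apply: T_lub => M [[_ _ _ Ml] _]; exact: Ml.
Qed.

Let T_post x : T x <= Phi T x.
Proof.
apply: T_lub => M pM; have [sM MP] := pM; apply: (le_trans (MP x)).
by apply: Phi_mono => // {}x; exact: T_ub.
Qed.

Let T_fix x : T x = Phi T x.
Proof.
apply/le_anti; rewrite T_post/=; apply: T_ub; split; first exact: Phi_snorm.
by move=> y; apply: Phi_mono => //; exact: Phi_snorm.
Qed.

Lemma tsirelson_norm_exists : exists N, is_norm N /\ tsirelson_equation N.
Proof.
exists T; have [T0 TZ TD _] := T_snorm; split; first split => //.
- move=> x Tx; apply: c00_eqP => i.
  apply: (supnorm0_eq0 (@c00_bounded x)); apply/le_anti.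
  by rewrite supnorm_ge0 -[in leRHS]Tx T_fix le_max lexx.
- move=> a x; apply/le_anti; rewrite TZ/=.
  have [->|a0] := eqVneq a 0; first by rewrite normr0 mul0r.
  rewrite mulrC -ler_pdivlMr ?normr_gt0// mulrC -normfV.
  by rewrite -[in leLHS](scalerK a0 x).
move=> x; have hs := sums_sup x T_snorm; rewrite ereal_sup_EFin; [|by case: hs..].
by rewrite {1}T_fix -EFinM -EFin_max.
Qed.

Lemma is_norm_ge0 (N : c00 -> R) : is_norm N -> forall x, 0 <= N x.
Proof.
move=> [_ NZ ND] x.
have N0 : N 0 = 0 by rewrite -(scale0r 0) NZ normr0 mul0r.
have := ND x (- x); rewrite subrr N0 -scaleN1r NZ normrN normr1 mul1r.
by rewrite -mulr2n pmulrn_lge0.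
Qed.

Let is_norm0 (N : c00 -> R) : is_norm N -> N 0 = 0.
Proof. by move=> [_ NZ _]; rewrite -(scale0r 0) NZ normr0 mul0r. Qed.

Let card_supp b (x : c00) : nat := (\sum_(i < b) (x i != 0%R))%N.

Let card_restr b (E : set nat) (x : c00) : (forall i, (b <= i)%N -> x i = 0) ->
  restr E x <> x -> (card_supp b (restr E x) < card_supp b x)%N.
Proof.
move=> xb Ex.
have [t xt Et] : exists2 t, x t != 0 & ~ E t.
  apply: contrapT => H; apply: Ex; apply: c00_eqP => t; rewrite /= /patch.
  case: ifPn => //; rewrite notin_setE => Et; apply/esym/eqP.
  by apply: contrapT => /negP xt; apply: H; exists t.
have tb : (t < b)%N by rewrite ltnNge; apply: contra xt => /xb ->.
rewrite /card_supp (bigD1 (Ordinal tb))//= [ltnRHS](bigD1 (Ordinal tb))//=.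
rewrite xt {1}/patch memNset// eqxx add0n add1n ltnS.
by apply: leq_sum => i _; rewrite /patch; case: ifP => // _; rewrite eqxx.
Qed.

Let tsirelson_le N N' b (x : c00) :
  is_norm N -> tsirelson_equation N -> is_norm N' -> tsirelson_equation N' ->
  (forall i, (b <= i)%N -> x i = 0) ->
  (forall y : c00, (forall i, (b <= i)%N -> y i = 0) ->
    (card_supp b y < card_supp b x)%N -> N y = N' y) ->
  N x <= N' x.
Proof.
move=> nN eN nN' eN' xb IH.
have N'x : forall k E, admissible k E ->
    \sum_(i < k) N' (restr (E i) x) <= 2 * N' x.
  move=> k E aE; rewrite -ler_pdivrMl// -lee_fin (eN' x) EFinM le_max.
  apply/orP; right; rewrite lee_pmul2l//.
  apply: ereal_sup_ubound; exists (\sum_(i < k) N' (restr (E i) x)) => //.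
  by exists k, E.
suff : N x <= Num.max (N' x) (2^-1 * N x).
  rewrite le_max => /orP[//|h]; apply: le_trans (is_norm_ge0 nN' x).
  have := is_norm_ge0 nN x; lra.
rewrite -lee_fin [leLHS](eN x) ge_max; apply/andP; split.
  by rewrite lee_fin le_max -lee_fin (eN' x) le_max lexx.
rewrite -[X in (_ <= X%:E)%E](@mulKf _ 2)//.
rewrite EFinM lee_pmul2l//; apply: ge_ereal_sup => _ [_ [k [E [aE ->]] <-]].
rewrite lee_fin.
have [[i Ei]|nE] := pselect (exists i : 'I_k, restr (E i) x = x).
  rewrite (bigD1 i)//= Ei big1 ?addr0.
    by rewrite -ler_pdivrMl// le_max lexx orbT.
  move=> j ji; rewrite (_ : restr _ _ = 0) ?is_norm0//.
  apply: c00_eqP => t; rewrite -[RHS]/(0 : R) /= /patch; case: ifPn => //.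
  rewrite inE => Ejt; apply/eqP; apply: contrapT => /negP xt.
  have Eit : E i t.
    apply: contrapT => Eit; move: xt; rewrite -Ei /= /patch memNset//.
    by rewrite eqxx.
  move: ji; rewrite -val_eqE/= neq_ltn => /orP[]h.
    by have := admissible_disj aE _ Ejt Eit; rewrite h ltn_ord ltnn => /(_ isT).
  by have := admissible_disj aE _ Eit Ejt; rewrite h ltn_ord ltnn => /(_ isT).
apply: (@le_trans _ _ (2 * N' x)); last by rewrite ler_pM2l// le_max lexx.
apply: le_trans (N'x k E aE); apply: ler_sum => i _.
rewrite IH//; first by move=> j bj; rewrite /= /patch xb// if_same.
by apply: card_restr => // Ei; apply: nE; exists i.
Qed.

Lemma tsirelson_norm_unique N N' : is_norm N -> tsirelson_equation N ->
  is_norm N' -> tsirelson_equation N' -> N = N'.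
Proof.
move=> nN eN nN' eN'; apply/funext => x; have [b xb] := c00_bound x.
move: {2}(card_supp b x).+1 (ltnSn (card_supp b x)) xb => c.
elim: c x => // c IH x xc xb; apply/le_anti/andP; split.
  by apply: (tsirelson_le nN eN nN' eN' xb) => y yb yx; apply: IH => //;
     exact: leq_trans yx _.
by apply: (tsirelson_le nN' eN' nN eN xb) => y yb yx; apply/esym/IH => //;
   exact: leq_trans yx _.
Qed.

(* By [tsirelson_norm_exists] and [tsirelson_norm_unique], [xget] selects the
   only norm satisfying the equation, and the default value is never used. *)
Definition tsirelson_norm : c00 -> R :=
  xget (fun=> 0) [set N | is_norm N /\ tsirelson_equation N].

Lemma tsirelson_normP : is_norm tsirelson_norm /\ tsirelson_equation tsirelson_norm.
Proof. by rewrite /tsirelson_norm; 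
exact: (@xgetPex _ _ [set N | is_norm N /\ tsirelson_equation N] tsirelson_norm_exists). Qed.

(* An alias of [c00], so that [c00] itself carries no norm. *)
Definition tsirelson_c00 : Type := c00.
HB.instance Definition _ := GRing.Lmodule.on tsirelson_c00.

Let tnD x y : tsirelson_norm (x + y) <= tsirelson_norm x + tsirelson_norm y.
Proof. by case: tsirelson_normP => -[]. Qed.
Let tnZ a x : tsirelson_norm (a *: x) = `|a| * tsirelson_norm x.
Proof. by case: tsirelson_normP => -[]. Qed.
Let tn0 x : tsirelson_norm x = 0 -> x = 0.
Proof. by have [[h _ _] _] := tsirelson_normP; exact: h. Qed.
HB.instance Definition _ := @Lmodule_isNormed.Build R tsirelson_c00
  tsirelson_norm tnD tnZ tn0.

Definition tsirelson_space : completeNormedModType R :=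
  completion tsirelson_c00.

End C00.

Section BanachNotions.
Variable R : realType.

(* Surjectivity of the canonical map of X into its bidual. *)
Definition reflexive_space (X : normedModType R) : Prop :=
  forall phi : dual_space (dual_space X),
    exists x : X, forall f : dual_space X, phi f = f x.

Definition isomorphic (X Y : normedModType R) : Prop :=
  exists (f : {linear X -> Y}) (g : Y -> X),
    [/\ cancel f g, cancel g f, continuous f & continuous g].

Definition is_quotient_of (X P : normedModType R) : Prop :=
  exists (M : subspace P) (clM : closed (subspace_set M)),
    isomorphic X (quotient_space clM).

Definition finite_dimensional (V : lmodType R) (F : subspace V) : Prop :=
  exists (n : nat) (v : 'I_n -> V),
    forall x, F x <-> exists a : 'I_n -> R, x = \sum_(i < n) a i *: v i.

Definition extreme_points (V : lmodType R) (A : set V) : set V :=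
  [set x | A x /\ forall (y z : V) (t : R), A y -> A z -> 0 < t < 1 ->
             x = t *: y + (1 - t) *: z -> y = x /\ z = x].

Definition polyhedral_norm (V : lmodType R) (N : V -> R) : Prop :=
  forall F : subspace V, finite_dimensional F ->
    finite_set (extreme_points [set x | F x /\ N x <= 1]).

Definition equivalent_norm (X : normedModType R) (N : X -> R) : Prop :=
  is_norm N /\
  exists a b : R, [/\ 0 < a, 0 < b & forall x, a * `|x| <= N x <= b * `|x|].

Definition isomorphically_polyhedral (X : normedModType R) : Prop :=
  exists N : X -> R, equivalent_norm N /\ polyhedral_norm N.

Definition schauder_basis (X : normedModType R) (e : nat -> X) : Prop :=
  forall x : X, exists! a : nat -> R, series (fun n => a n *: e n) @ \oo --> x.

Definition unconditional_basis (X : normedModType R) (e : nat -> X) : Prop :=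
  schauder_basis e /\
  forall (x : X) (a : nat -> R), series (fun n => a n *: e n) @ \oo --> x ->
  forall s : nat -> nat, bijective s ->
    series (fun n => a (s n) *: e (s n)) @ \oo --> x.

Definition has_unconditional_basis (X : normedModType R) : Prop :=
  exists e : nat -> X, unconditional_basis e.

(* Average over all 2 ^ n choices of signs. *)
Definition has_type (X : normedModType R) (r : R) : Prop :=
  exists C : R, forall (n : nat) (x : 'I_n -> X),
    (2 ^- n * \sum_(s : {ffun 'I_n -> bool})
                `|\sum_(i < n) (-1) ^+ s i *: x i| `^ r) `^ r^-1 <=
    C * (\sum_(i < n) `|x i| `^ r) `^ r^-1.

Definition nontrivial_type (X : normedModType R) : Prop :=
  exists2 r : R, 1 < r & has_type X r.

Definition quotient_of_polyhedral (X : normedModType R) : Prop :=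
  exists P : completeNormedModType R,
    [/\ isomorphically_polyhedral P, has_unconditional_basis P &
        is_quotient_of X P].

End BanachNotions.

(* Main.v *)
From HB Require Import structures.
Require Import Defs.
From mathcomp Require Import all_boot all_order all_algebra.
From mathcomp Require Import all_classical all_reals all_analysis.
From mathcomp Require Import ring lra zify.

Import Order.TTheory GRing.Theory Num.Theory.
Import numFieldNormedType.Exports.

Local Open Scope classical_set_scope.
Local Open Scope ring_scope.

Set Implicit Arguments.
Unset Strict Implicit.
Unset Printing Implicit Defensive.

(** All three kinds of spaces are handled by one construction.  Let [N] be a
    lattice norm on finitely supported sequences that hardly notices small
    disjoint perturbations, [disjoint_smooth]; an upper estimate
    [N (x + y) `^ r <= N x `^ r + N y `^ r] for disjoint [x], [y] and some
    [r > 1] implies this.  If vectors [e n] with dense span in [Z] carry a norm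
    equivalent to [N], then [Z] is a quotient of a polyhedral space [P] with an
    unconditional basis, [smooth_lattice_quotient].

    The basis of [P] is indexed by a position [n] and a level [j], and the
    quotient map sends the basis vector to [2 ^- j *: e n].  A vector [a] of the
    unit ball of [N] is lifted by storing [a n] on the level [j] with
    [2 ^- j.+1 < `|a n| <= 2 ^- j], as a number of modulus between 1/2 and 1.
    The norm of [P] is the supremum of the sums [\sum_m `|eta m * x m|] over test
    sequences [eta], each multiplied by a factor between 1 and 2.  A test sequence
    of level [i] may have [ell_1] norm [(2 / t) ^+ i], but its entries and its
    values on all lifts are at most [t ^+ i].  So near a point only finitely many
    levels matter.  The factor decreases with the [ell_1] norm, and for this
    reason nothing is lost if the remaining test sequences are cut to finitely
    many coordinates.  Their entries are dyadic, so finitely many are left: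
    locally the norm is a maximum of finitely many functionals, and by
    compactness it is polyhedral, [gspace_locally_finite].  The quotient map is
    bounded because a functional that norms a value of this map splits into
    multiples of test sequences: the coordinates are grouped by the difference
    [i] between the dyadic level of the value and the level of the coordinate,
    smoothness bounds the [i]-th group on lifts by a multiple of [t ^+ (2 * i)],
    so that it is a multiple of [t ^+ i] times a test sequence of level [i], and
    the series of the [t ^+ i] converges, [norming_sum_bound].

    The smooth norms are found as follows.  The sum of copies of [c0] satisfies
    the upper [p]-estimate itself.  In the other two cases a renorming reduces
    the question to a bound for sums of disjoint vectors whose norms have
    [r]-th powers of sum at most one, [spread_lattice_quotient].  For an
    unconditional basis this bound is the inequality of type [r], since changing
    the signs of disjoint vectors changes the norm of their sum by a bounded
    factor only, [type_spread].  For the dual of the Tsirelson space it is dual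
    to a lower 2-estimate for disjoint parts of a vector supported far out,
    [tau_lower2].  That estimate is iterated from [tau_disjoint]: the norms of
    [2 * m] disjoint parts of a vector supported beyond [64 * m] add up to at
    most twice its norm.  Functionals norming the parts are trees whose nodes are
    admissible sums; they are cut simultaneously along an admissible number of
    intervals such that few subtrees meet each interval, [packed_chop].  The
    coordinate functionals span a dense subspace of the dual,
    [tsirelson_dual_dense], because a block and the average of many later blocks
    do not have norm two. *)

(** * The polyhedral space attached to a gauge *)

Section GaugeSpace.
Variable R : realType.

(** In the application [gset] consists of the lifts of the unit ball. *)
Record gauge := Gauge {
  gset : set (nat -> R);
  gtau : R;
  gset_le1 : forall xi m, gset xi -> `|xi m| <= 1;
  gtau01 : 0 < gtau < 1 }.

Variable g : gauge.
Implicit Types (i M m : nat) (eta x y : nat -> R).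

Definition l1 M eta : R := \sum_(m < M) `|eta m|.

Definition scale i : R := (2 / gtau g) ^+ i.

(** The test sequences of level [i] may be large in the [ell_1] sense, but are
    small in every coordinate and on [gset].  The last condition leaves finitely
    many of them on finitely many coordinates. *)
Definition tests i M eta : Prop :=
  [/\ l1 M eta <= scale i,
      forall m, `|eta m| <= gtau g ^+ i /\ ((M <= m)%N -> eta m = 0),
      forall xi, gset g xi -> \sum_(m < M) `|eta m * xi m| <= gtau g ^+ i &
      forall m, exists k : int, eta m = k%:~R / 2 ^+ m].

(** The leading factor lies between 1 and 2 and rewards a small [ell_1] norm;
    this is exploited in [cut_gain]. *)
Definition val i M eta x : R :=
  (2 - l1 M eta / scale i) * \sum_(m < M) `|eta m * x m|.

Definition tail M x : nat -> R := fun m => if (m < M)%N then 0 else x m.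

Definition vals x : set R :=
  [set r | exists i M eta, tests i M eta /\ r = val i M eta x].

Definition gauge_norm x : R := sup (vals x).

(** Tails are uniformly small on the test sequences, so that the finitely
    supported sequences are dense. *)
Definition in_gauge : {pred nat -> R} := fun x =>
  `[< forall e, 0 < e -> exists M0, forall i M eta, tests i M eta ->
        val i M eta (tail M0 x) <= e >].

Lemma gtau_gt0 : 0 < gtau g. Proof. by case/andP: (gtau01 g). Qed.
Lemma gtau_lt1 : gtau g < 1. Proof. by case/andP: (gtau01 g). Qed.

Lemma scale_gt0 i : 0 < scale i.
Proof. by rewrite exprn_gt0// divr_gt0// gtau_gt0. Qed.

Lemma tests_factor i M eta : tests i M eta ->
  1 <= 2 - l1 M eta / scale i <= 2.
Proof.
move=> [h _ _ _]; have : l1 M eta / scale i <= 1.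
  by rewrite ler_pdivrMr ?scale_gt0// mul1r.
have : 0 <= l1 M eta / scale i.
  by rewrite divr_ge0 ?sumr_ge0// ltW// scale_gt0.
lra.
Qed.

Lemma tests_le1 i M eta m : tests i M eta -> `|eta m| <= 1.
Proof.
move=> [_ h _ _]; rewrite (le_trans (h m).1)// exprn_ile1// ltW//.
  exact: gtau_gt0.
exact: gtau_lt1.
Qed.

Lemma val_mono i M eta x y : tests i M eta -> (forall m, `|x m| <= `|y m|) ->
  val i M eta x <= val i M eta y.
Proof.
move=> /tests_factor /andP[h _] xy; apply: ler_wpM2l.
  by rewrite (le_trans ler01).
by apply: ler_sum => m _; rewrite !normrM ler_wpM2l.
Qed.

Lemma valD i M eta x y : tests i M eta ->
  val i M eta (fun m => x m + y m) <= val i M eta x + val i M eta y.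
Proof.
move=> /tests_factor /andP[h _]; rewrite -mulrDr ler_wpM2l//.
  by rewrite (le_trans ler01).
rewrite -big_split; apply: ler_sum => m _ /=.
by rewrite mulrDr ler_normD.
Qed.

Lemma valZ i M eta a x : val i M eta (fun m => a * x m) = `|a| * val i M eta x.
Proof.
rewrite /val mulrCA; congr (_ * _); rewrite mulr_sumr.
by apply: eq_bigr => m _; rewrite mulrCA normrM.
Qed.

Lemma val_head_le i M eta x M0 : tests i M eta ->
  (forall m, (M0 <= m)%N -> x m = 0) ->
  val i M eta x <= 2 * \sum_(m < M0) `|x m|.
Proof.
move=> ts x0; have /andP[h1 h2] := tests_factor ts.
apply: ler_pM => //; first by rewrite (le_trans ler01).
  exact: sumr_ge0.
apply: (@le_trans _ _ (\sum_(m < M) `|x m|)).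
  apply: ler_sum => m _; rewrite normrM ler_piMl//.
  exact: tests_le1 ts.
case: (leqP M M0) => [MM|/ltnW MM].
  rewrite -!(big_mkord xpredT (fun m => `|x m|)) (@big_cat_nat _ _ _ M 0 M0)//=.
  by rewrite lerDl sumr_ge0.
rewrite -!(big_mkord xpredT (fun m => `|x m|)) (@big_cat_nat _ _ _ M0 0 M)//=.
rewrite [X in _ + X]big_nat_cond [X in _ + X]big1 ?addr0// => m.
by rewrite andbT => /andP[/x0 -> _]; rewrite normr0.
Qed.

Lemma val_split i M eta x M0 : tests i M eta ->
  val i M eta x <= 2 * (\sum_(m < M0) `|x m|) + val i M eta (tail M0 x).
Proof.
move=> ts; pose h m := if (m < M0)%N then x m else 0.
have -> : x = (fun m => h m + tail M0 x m).
  apply/funext => m; rewrite /h /tail; case: ifP => _; ring.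
apply: (le_trans (valD _ _ ts)); rewrite lerD//.
  apply: (le_trans (val_head_le (M0 := M0) ts _)).
    by move=> m; rewrite /h ltnNge => ->.
  rewrite ler_wpM2l//; apply: ler_sum => m _; rewrite /h ltn_ord /tail ltn_ord.
  by rewrite addr0.
apply: val_mono => // m; rewrite /h /tail; case: ifP => _.
  by rewrite normr0.
by rewrite add0r.
Qed.

Lemma in_gauge_bounded x : x \in in_gauge ->
  exists B, forall i M eta, tests i M eta -> val i M eta x <= B.
Proof.
move=> /asboolP/(_ 1 ltr01)[M0 h].
exists (2 * (\sum_(m < M0) `|x m|) + 1) => i M eta ts.
by rewrite (le_trans (val_split _ M0 ts))// lerD2l h.
Qed.

Lemma tests_zero : tests 0 0 (fun=> 0).
Proof.
split => [||xi _|m].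
- by rewrite /l1 big_ord0 /scale expr0.
- by move=> m; rewrite normr0 expr0.
- by rewrite big_ord0 expr0.
- by exists 0; rewrite mul0r.
Qed.

Lemma vals_has_sup x : x \in in_gauge -> has_sup (vals x).
Proof.
move=> /in_gauge_bounded[B xB]; split.
  by eexists; exists 0%N, 0%N, (fun=> 0); split; first exact: tests_zero.
by exists B => _ [i [M [eta [ts ->]]]]; exact: xB.
Qed.

Lemma gauge_norm_ub x i M eta : x \in in_gauge -> tests i M eta ->
  val i M eta x <= gauge_norm x.
Proof.
by move=> xg ts; apply: (sup_upper_bound (vals_has_sup xg)); exists i, M, eta.
Qed.

Lemma gauge_norm_le x B :
  (forall i M eta, tests i M eta -> val i M eta x <= B) -> gauge_norm x <= B.
Proof.
move=> h; apply: ge_sup; last by move=> _ [i [M [eta [ts ->]]]]; exact: h.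
by eexists; exists 0%N, 0%N, (fun=> 0); split; first exact: tests_zero.
Qed.

Definition unit_test m : nat -> R := fun k => (k == m)%:R.

Lemma unit_sum m x : \sum_(k < m.+1) `|unit_test m k * x k| = `|x m|.
Proof.
rewrite big_ord_recr/= /unit_test eqxx mul1r big1 ?add0r// => k _.
by rewrite ltn_eqF// mul0r normr0.
Qed.

Lemma tests_unit m : tests 0 m.+1 (unit_test m).
Proof.
split.
- rewrite /l1 -[leRHS](normr1 R) -(unit_sum m (fun=> 1)).
  by apply: ler_sum => k _; rewrite mulr1.
- move=> k; rewrite /unit_test expr0; split.
    by case: (k == m); rewrite ?normr1// normr0.
  by move=> mk; rewrite gtn_eqF.
- by move=> xi gxi; rewrite unit_sum expr0; exact: gset_le1 gxi.
- move=> k; rewrite /unit_test; case: eqP => _.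
    by exists (2 ^+ k); rewrite rmorphXn/= divff// expf_neq0.
  by exists 0; rewrite mul0r.
Qed.

Lemma val_unit m x : val 0 m.+1 (unit_test m) x = `|x m|.
Proof.
rewrite /val unit_sum /scale expr0 divr1 (_ : l1 _ _ = 1); first by ring.
rewrite /l1 -[RHS](normr1 R) -(unit_sum m (fun=> 1)).
by apply: eq_bigr => k _; rewrite mulr1.
Qed.

Lemma gauge_norm_coord x m : x \in in_gauge -> `|x m| <= gauge_norm x.
Proof. by move=> xg; rewrite -val_unit; exact: gauge_norm_ub (tests_unit m). Qed.

Lemma in_gauge_submod : submod_closed in_gauge.
Proof.
split=> [|a x y /asboolP xg /asboolP yg]; apply/asboolP => e e0.
  exists 0%N => i M eta ts; rewrite (le_trans (val_head_le (M0 := 0) ts _))//.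
  by rewrite big_ord0 mulr0 ltW.
have a1 : 0 < `|a| + 1 by rewrite ltr_wpDl.
have [M1 h1] := xg (e / 2 / (`|a| + 1)) ltac:(by rewrite !divr_gt0).
have [M2 h2] := yg (e / 2) ltac:(by rewrite divr_gt0).
exists (maxn M1 M2) => i M eta ts.
pose x' := tail M1 x; pose y' := tail M2 y.
apply: (@le_trans _ _ (val i M eta (fun m => `|a| * `|x' m| + `|y' m|))).
  apply: val_mono => // m; rewrite /tail /x' /y' /tail leq_max.
  rewrite [leRHS]ger0_norm ?addr_ge0 ?mulr_ge0//.
  case: (m < M1)%N; case: (m < M2)%N => //=;
    rewrite ?normr0 ?mulr0 ?add0r ?addr0 ?mulr_ge0 ?addr_ge0 ?mulr_ge0//.
  rewrite -[X in `|X|]/(a * x m + y m).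
  by rewrite (le_trans (ler_normD _ _))// normrM.
apply: (le_trans (valD _ _ ts)); rewrite valZ normr_id (splitr e) lerD//.
  rewrite (@le_trans _ _ (`|a| * (e / 2 / (`|a| + 1))))//.
    rewrite ler_wpM2l// (le_trans _ (h1 i M eta ts))// val_mono// => m.
    by rewrite normr_id.
  by rewrite mulrCA ger_pMr ?divr_gt0// ler_pdivrMr// mul1r lerDl.
by rewrite (le_trans _ (h2 i M eta ts))// val_mono// => m; rewrite normr_id.
Qed.

Record gspace := GSpace { gseq :> nat -> R; gseqP : gseq \in in_gauge }.
HB.instance Definition _ := [isSub for gseq].
HB.instance Definition _ := [Choice of gspace by <:].
HB.instance Definition _ :=
  GRing.isSubmodClosed.Build R (nat -> R) in_gauge in_gauge_submod.
HB.instance Definition _ := [SubChoice_isSubLmodule of gspace by <:].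

Let gs_normD (x y : gspace) :
  gauge_norm (x + y : gspace) <= gauge_norm x + gauge_norm y.
Proof.
apply: gauge_norm_le => i M eta ts; apply: (le_trans (valD _ _ ts)).
by rewrite lerD// gauge_norm_ub// gseqP.
Qed.

Let gs_normZ_le a (x : gspace) : gauge_norm (a *: x : gspace) <= `|a| * gauge_norm x.
Proof.
apply: gauge_norm_le => i M eta ts.
by rewrite (valZ _ _ _ a x) ler_wpM2l// gauge_norm_ub// gseqP.
Qed.

Let gs_normZ a (x : gspace) : gauge_norm (a *: x : gspace) = `|a| * gauge_norm x.
Proof.
apply/le_anti; rewrite gs_normZ_le/=.
have [->|a0] := eqVneq a 0.
  rewrite normr0 mul0r (le_trans (normr_ge0 ((0 *: x : gspace) 0%N)))//.
  exact: gauge_norm_coord (gseqP _).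
rewrite mulrC -ler_pdivlMr ?normr_gt0// mulrC -normfV.
by rewrite -[in leLHS](scalerK a0 x) gs_normZ_le.
Qed.

Let gs_norm0_eq0 (x : gspace) : gauge_norm x = 0 -> x = 0.
Proof.
move=> x0; apply/val_inj/funext => m; apply/eqP.
by rewrite -[_ == _]/(x m == 0) -normr_le0 -x0 gauge_norm_coord// gseqP.
Qed.

HB.instance Definition _ := @Lmodule_isNormed.Build R gspace
  (fun z : gspace => gauge_norm z) gs_normD gs_normZ gs_norm0_eq0.

Lemma gspace_ub (x : gspace) i M eta : tests i M eta -> val i M eta x <= `|x|.
Proof. by apply: gauge_norm_ub; exact: gseqP. Qed.

Lemma gspace_coord (x : gspace) m : `|x m| <= `|x|.
Proof. exact: gauge_norm_coord (gseqP x). Qed.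

Lemma gspace_coordB (x y : gspace) m : `|x m - y m| <= `|x - y|.
Proof. exact: gspace_coord (x - y) m. Qed.

Let gs_complete (F : set_system gspace) : ProperFilter F -> cauchy F -> cvg F.
Proof.
apply: seq_complete => u cu.
have um m : cvgn (fun n => u n m).
  apply/cauchy_cvgP/cauchyP => e e0.
  have [N HN] := cu _ (divr_gt0 e0 (@ltr0Sn R 1)); exists (u N m).
  exists N => // n /= Nn; rewrite -ball_normE/=.
  rewrite (le_lt_trans (gspace_coordB _ _ _))// (le_lt_trans (HN _ _ _ _))//.
  by rewrite ltr_pdivrMr// ltr_pMr// ltr1n.
pose l m : R := limn (fun n => u n m).
have ul e N : (forall m n, (N <= m)%N -> (N <= n)%N -> `|u m - u n| <= e) ->
    forall n i M eta, (N <= n)%N -> tests i M eta ->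
    val i M eta (fun m => u n m - l m) <= e.
  move=> HN n i M eta Nn ts.
  have lim : (fun k => val i M eta (fun m => u n m - u k m)) @ \oo -->
      val i M eta (fun m => u n m - l m).
    rewrite /val; apply: cvgMr; apply: cvg_big => [|m _].
      exact: add_continuous.
    by apply: cvg_norm; apply: cvgMr; apply: cvgB; [exact: cvg_cst|exact: um].
  rewrite -(cvg_lim _ lim)//; apply: limr_le; first exact: cvgP lim.
  exists N => // k /= Nk.
  exact: le_trans (gspace_ub (u n - u k) ts) (HN _ _ Nn Nk).
have lP : l \in in_gauge.
  apply/asboolP => e e0; have e2 : 0 < e / 2 by rewrite divr_gt0.
  have [N HN] := cu _ e2.
  have /asboolP/(_ _ e2)[M0 h] := gseqP (u N); exists M0 => i M eta ts.
  apply: (@le_trans _ _ (val i M eta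
     (fun m => `|u N m - l m| + `|tail M0 (u N) m|))).
    apply: val_mono => // m; rewrite [leRHS]ger0_norm ?addr_ge0// /tail.
    case: ifP => _; first by rewrite normr0 addr_ge0.
    rewrite -[l m](subKr (u N m)) (le_trans (ler_normB _ _))// subKr addrC.
    by rewrite lexx.
  apply: (le_trans (valD _ _ ts)); rewrite (splitr e) lerD//.
    rewrite (le_trans _ (ul _ _ HN N i M eta (leqnn N) ts))// val_mono// => m.
    by rewrite normr_id.
  by rewrite (le_trans _ (h i M eta ts))// val_mono// => m; rewrite normr_id.
exists (GSpace lP) => e e0; have [N HN] := cu e e0; exists N => n Nn.
by apply: gauge_norm_le => i M eta ts; exact: (ul e N HN n i M eta Nn ts).
Qed.
HB.instance Definition _ := Uniform_isComplete.Build gspace gs_complete.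

Lemma gspace_norm_le (x : gspace) B :
  (forall i M eta, tests i M eta -> val i M eta x <= B) -> `|x| <= B.
Proof. exact: gauge_norm_le. Qed.

Lemma fin_in_gauge M x : (forall m, (M <= m)%N -> x m = 0) -> x \in in_gauge.
Proof.
move=> x0; apply/asboolP => e e0; exists M => i K eta ts.
rewrite (le_trans (val_head_le (M0 := 0) ts _)) ?big_ord0 ?mulr0 ?ltW//.
by move=> m _; rewrite /tail; case: ltnP => // /x0.
Qed.

Definition trunc M x : nat -> R := fun m => if (m < M)%N then x m else 0.

Lemma trunc_out M x m : (M <= m)%N -> trunc M x m = 0.
Proof. by rewrite /trunc leqNgt => /negbTE ->. Qed.

Definition gfin M x : gspace := GSpace (fin_in_gauge (@trunc_out M x)).

Lemma gfin_approx (x : gspace) e : 0 < e ->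
  exists M0, forall y : gspace,
    (forall m, (m < M0)%N -> y m = x m) -> (forall m, `|x m - y m| <= `|x m|) ->
    `|x - y| <= e.
Proof.
move=> e0; have /asboolP/(_ _ e0)[M0 h] := gseqP x; exists M0 => y yx yle.
apply: gspace_norm_le => i M eta ts; rewrite (le_trans _ (h i M eta ts))//.
apply: val_mono => // m; rewrite -[X in `|X|]/(x m - y m) /tail.
by case: ltnP => [/yx ->|_]; [rewrite subrr|exact: yle].
Qed.

End GaugeSpace.

(** * Finite-dimensional spheres and extreme points *)

Section FiniteDimension.
Variables (R : realType) (V : normedModType R).

Definition comb n (v : 'I_n -> V) (a : 'rV[R]_n) : V := \sum_i a 0 i *: v i.

Lemma combB n (v : 'I_n -> V) a b : comb v (a - b) = comb v a - comb v b.
Proof.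
by rewrite /comb -sumrB; apply: eq_bigr => i _; rewrite !mxE scalerBl.
Qed.

Lemma combZ n (v : 'I_n -> V) t a : comb v (t *: a) = t *: comb v a.
Proof.
by rewrite /comb scaler_sumr; apply: eq_bigr => i _; rewrite mxE scalerA.
Qed.

Lemma coord_le n (a : 'rV[R]_n) i : `|a 0 i| <= `|a|.
Proof.
rewrite [leRHS]/Num.norm/= mx_normrE; apply/bigmax_geP; right => /=.
by exists (0, i).
Qed.

Lemma comb_le n (v : 'I_n -> V) a : `|comb v a| <= (\sum_i `|v i|) * `|a|.
Proof.
apply: (le_trans (ler_norm_sum _ _ _)); rewrite mulr_suml.
by apply: ler_sum => i _; rewrite normrZ mulrC ler_wpM2l// coord_le.
Qed.

Lemma comb_continuous n (v : 'I_n -> V) : continuous (comb v).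
Proof.
move=> a; apply/(@cvgrPdist_le _ _ _ (nbhs a) (nbhs_filter a)) => e e0.
pose C := \sum_i `|v i| + 1.
have C0 : 0 < C by rewrite ltr_wpDl// sumr_ge0.
apply/nbhs_ballP; exists (e / C) => [|b] /=; first exact: divr_gt0.
rewrite -ball_normE /= => ab; rewrite -combB (le_trans (comb_le _ _))//.
apply: (@le_trans _ _ (C * `|a - b|)); first by rewrite ler_wpM2r// lerDl.
by rewrite mulrC -ler_pdivlMr// ltW.
Qed.

Definition spanning n (v : 'I_n -> V) (F : Defs.subspace V) : Prop :=
  forall x, F x <-> exists a, x = comb v a.

(** A linear relation makes one of the spanning vectors superfluous. *)
Lemma spanning_lift n (v : 'I_n.+1 -> V) (F : Defs.subspace V) i0 a :
  spanning v F -> comb v a = 0 -> a 0 i0 != 0 ->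
  spanning (fun j => v (lift i0 j)) F.
Proof.
move=> vF a0 ai0; split=> [/vF[b ->]|[b ->]]; last first.
  apply/vF; exists (\row_i (if unlift i0 i is Some j then b 0 j else 0)).
  rewrite /comb (bigD1_ord i0)//= mxE unlift_none scale0r add0r.
  by apply: eq_bigr => j _; rewrite mxE liftK.
exists (\row_j (b 0 (lift i0 j) - b 0 i0 / a 0 i0 * a 0 (lift i0 j))).
have {}a0 : v i0 = - (a 0 i0)^-1 *: \sum_j a 0 (lift i0 j) *: v (lift i0 j).
  move: a0; rewrite /comb (bigD1_ord i0)//= => /eqP; rewrite addr_eq0 => /eqP h.
  by apply: (scalerI ai0); rewrite h scalerA mulrN divff// scaleN1r.
rewrite /comb (bigD1_ord i0)//= a0 scalerA scaler_sumr -big_split/=.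
apply: eq_bigr => j _; rewrite mxE scalerA -scalerDl; congr (_ *: _); ring.
Qed.

Lemma finite_dimensional_free (F : Defs.subspace V) : finite_dimensional F ->
  exists n (v : 'I_n -> V), spanning v F /\ forall a, comb v a = 0 -> a = 0.
Proof.
move=> [n [v vF]].
have : exists n, `[< exists v : 'I_n -> V, spanning v F >].
  exists n; apply/asboolP; exists v => x; split=> [/vF[a ->]|[a ->]].
    by exists (\row_i a i); apply: eq_bigr => i _; rewrite mxE.
  by apply/vF; exists (fun i => a 0 i).
move=> ex; case: (ex_minnP ex) => {n v vF ex} n /asboolP[v vF] nmin.
exists n, v; split=> // a a0; apply/rowP => i; rewrite mxE; apply/eqP.
apply: contrapT => /negP ai.
case: n => [|n] in v vF nmin a a0 i ai *; first by case: i ai.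
have /nmin : `[< exists v : 'I_n -> V, spanning v F >].
  by apply/asboolP; eexists; exact: spanning_lift vF a0 ai.
by rewrite ltnn.
Qed.

(** The norm of a combination is positive and continuous on the compact sphere of
    coefficient vectors. *)
Lemma comb_lower n (v : 'I_n -> V) : (forall a, comb v a = 0 -> a = 0) ->
  exists2 c, 0 < c & forall a, c * `|a| <= `|comb v a|.
Proof.
move=> fv; pose S := [set a : 'rV[R]_n | `|a| = 1].
have [/set0P S0|] := boolP (S != set0); last first.
  rewrite negbK => /eqP S0; exists 1; first exact: ltr01.
  move=> a; have [->|a0] := eqVneq a 0; first by rewrite normr0 mulr0.
  exfalso; have : S (`|a|^-1 *: a).
    by rewrite /S/= normrZ normfV normr_id mulVf// normr_eq0.
  by rewrite S0.
have ncont : continuous (fun a : 'rV[R]_n => `|comb v a|).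
  by move=> a; apply: (continuous_comp (@comb_continuous n v a)); exact: norm_continuous.
have Scompact : compact S.
  apply: bounded_closed_compact.
    by exists 1; split; [rewrite num_real|move=> M M1 a /= ->; rewrite ltW].
  rewrite (_ : S = (fun a : 'rV[R]_n => `|a|) @^-1` [set 1])//.
  apply: preimage_closed; last exact: closed_eq.
  by move=> a _; exact: norm_continuous.
have [c cS cmin] := @EVT_min_rV _ _ _ _ S0 Scompact
  (continuous_subspaceT ncont).
move: cS; rewrite inE => cS.
exists `|comb v c|.
  rewrite normr_gt0; apply/eqP => /fv c0; move: cS.
  by rewrite /S/= c0 normr0 => /esym/eqP; rewrite oner_eq0.
move=> a; have [->|a0] := eqVneq a 0; first by rewrite normr0 mulr0.
have na : 0 < `|a| by rewrite normr_gt0.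
rewrite -ler_pdivlMr// mulrC -[X in X * _](gtr0_norm (_ : 0 < `|a|^-1)).
  rewrite -normrZ -combZ; apply: cmin.
  by rewrite inE /S/= normrZ normfV normr_id mulVf// gt_eqF.
by rewrite invr_gt0.
Qed.

(** The unit sphere of a finite-dimensional subspace is compact. *)
Lemma sphere_cover (F : Defs.subspace V) (rho : V -> R) : finite_dimensional F ->
  (forall x, `|x| = 1 -> 0 < rho x) ->
  exists s : seq V, (forall x, x \in s -> `|x| = 1) /\
    forall y, F y -> `|y| = 1 -> exists2 x, x \in s & `|x - y| < rho x.
Proof.
move=> /finite_dimensional_free[n [v [vF fv]]] rho0.
have [c c0 cv] := comb_lower fv.
pose K := [set a : 'rV[R]_n | `|comb v a| = 1].
have ncont : continuous (fun a : 'rV[R]_n => `|comb v a|).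
  by move=> a; apply: (continuous_comp (@comb_continuous n v a)); exact: norm_continuous.
have Kcompact : compact K.
  apply: bounded_closed_compact.
    exists c^-1; split; first by rewrite num_real.
    move=> M M1 a /= Ka; rewrite (le_trans _ (ltW M1))//.
    by rewrite -[leRHS]mul1r ler_pdivlMr// mulrC -Ka.
  rewrite (_ : K = (fun a : 'rV[R]_n => `|comb v a|) @^-1` [set 1])//.
  apply: preimage_closed; last exact: closed_eq.
  by move=> a _; exact: ncont.
pose O a := [set b | `|comb v a - comb v b| < rho (comb v a)].
have := Kcompact; rewrite compact_cover => /(_ 'rV[R]_n K O).
case=> [a Ka|a Ka|D DK Dcov].
- rewrite (_ : O a = comb v @^-1` ball (comb v a) (rho (comb v a))).
    by apply: open_comp; [move=> b _; exact: comb_continuous|exact: ball_open].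
  by apply/seteqP; split=> b; rewrite /O/= -ball_normE.
- by exists a => //; rewrite /O/= subrr normr0; apply: rho0.
exists [seq comb v a | a <- finmap.enum_fset D]; split=> [x /mapP[a Da ->]|y Fy y1].
  by have := DK a Da; rewrite inE.
have [a ya] := (vF y).1 Fy.
have : K a by rewrite /K/= -ya.
move=> /Dcov[b Db hb]; exists (comb v b); last by rewrite ya.
by apply/mapP; exists b.
Qed.

End FiniteDimension.

Section LocallyFinite.
Variables (R : realType) (V : normedModType R).

(** Near every point of the sphere the norm is the maximum of finitely many
    functionals, up to values that are too small to matter. *)
Definition locally_finite_norm : Prop :=
  forall x : V, `|x| = 1 -> exists (rho : R) (G : set (V -> R)),
    [/\ 0 < rho, finite_set G,
        forall h, G h -> (forall a y z, h (a *: y + z) = a * h y + h z) /\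
                         forall y, h y <= `|y| &
        forall y c, `|x - y| < rho -> 2^-1 <= c ->
          (forall h, G h -> h y <= c) -> `|y| <= c].

Lemma small_step (s : seq (V -> R)) (x d : V) :
  (forall h, h \in s -> h x <= 1) ->
  exists2 t, 0 < t & forall h, h \in s -> h x != 1 -> t * `|h d| <= 1 - h x.
Proof.
elim: s => [|h s IH] hs; first by exists 1.
have [|t t0 ts] := IH; first by move=> k ks; rewrite hs// in_cons ks orbT.
have [hx|hx] := eqVneq (h x) 1.
  exists t => // k; rewrite in_cons => /orP[/eqP ->|/ts//].
  by rewrite hx eqxx.
have hx1 : 0 < 1 - h x.
  by rewrite subr_gt0 lt_neqAle hx hs// mem_head.
have d1 : 0 < `|h d| + 1 by rewrite ltr_wpDl.
exists (Num.min t ((1 - h x) / (`|h d| + 1))).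
  by rewrite lt_min t0 divr_gt0.
move=> k; rewrite in_cons => /orP[/eqP -> _|ks kx].
  apply: (@le_trans _ _ ((1 - h x) / (`|h d| + 1) * `|h d|)).
    by rewrite ler_wpM2r// ge_min lexx orbT.
  by rewrite mulrAC ler_pdivrMr// ler_pM2l// lerDl.
by rewrite (le_trans _ (ts k ks kx))// ler_wpM2r// ge_min lexx.
Qed.

(** An extreme point is determined by the functionals that take the value one at
    it: along the difference to another point with the same functionals one could
    move in both directions within the ball. *)
Lemma finite_extreme_points (F : Defs.subspace V) (s : seq (V -> R)) :
  (forall h, h \in s -> forall a y z, h (a *: y + z) = a * h y + h z) ->
  (forall x, F x -> (`|x| <= 1 <-> forall h, h \in s -> h x <= 1)) ->
  finite_set (extreme_points [set x | F x /\ `|x| <= 1]).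
Proof.
move=> slin sball; set E := extreme_points _.
pose act x := [ffun i : 'I_(size s) => nth (fun=> 0) s i x == 1].
suff /(@inj_card_eq _ _)/eq_finite_set <- : {in E &, injective act} by [].
move=> x y; rewrite !inE => xE yE xy; apply/eqP; apply: contrapT => /negP nxy.
have [[[Fx x1] xext] [[Fy y1] _]] := (xE, yE).
have hx1 := (sball x Fx).1 x1.
have [t t0 ts] := @small_step s x (x - y) hx1.
have same h : h \in s -> h x = 1 -> h (x - y) = 0.
  move=> hs hx; have hy : h y = 1.
    have hi : (index h s < size s)%N by rewrite index_mem.
    move/ffunP/(_ (Ordinal hi)) : xy.
    rewrite !ffunE/= nth_index// hx eqxx.
    by move=> /esym/eqP.
  by rewrite addrC -scaleN1r slin// hx hy mulN1r addNr.
have inB e : `|e| = t -> F (x + e *: (x - y)) /\ `|x + e *: (x - y)| <= 1.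
  move=> et; have Fz : F (x + e *: (x - y)).
    by rewrite addrC; apply: subspaceP => //; exact: subspaceB.
  split=> //; apply/(sball _ Fz) => h hs; rewrite addrC slin//.
  have [hx|hx] := eqVneq (h x) 1; first by rewrite same// mulr0 add0r hx.
  rewrite -lerBrDr (le_trans _ (ts h hs hx))// -et -normrM.
  exact: ler_norm.
have [||||] := xext (x + t *: (x - y)) (x + (- t) *: (x - y)) (2^-1).
- by apply: inB; rewrite gtr0_norm.
- by apply: inB; rewrite normrN gtr0_norm.
- by rewrite invr_gt0 ltr0n invf_lt1// ltr1n.
- rewrite (_ : 1 - 2^-1 = 2^-1); last by field.
  rewrite -scalerDr addrACA -scalerDl subrr scale0r addr0 scalerDr -scalerDl.
  by rewrite (_ : 2^-1 + 2^-1 = 1) ?scale1r//; field.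
move=> /eqP; rewrite addrC -subr_eq0 addrK scaler_eq0 gt_eqF//= subr_eq0.
by move=> h; rewrite h in nxy.
Qed.

(** By compactness of the sphere finitely many of the local families suffice. *)
Lemma locally_finite_polyhedral :
  locally_finite_norm -> polyhedral_norm (fun x : V => `|x|).
Proof.
move=> lf F Ffin.
have /choice[D DP] : forall x : V, exists D : R * set (V -> R), `|x| = 1 ->
    [/\ 0 < D.1, finite_set D.2,
        forall h, D.2 h -> (forall a y z, h (a *: y + z) = a * h y + h z) /\
                         forall y, h y <= `|y| &
        forall y c, `|x - y| < D.1 -> 2^-1 <= c ->
          (forall h, D.2 h -> h y <= c) -> `|y| <= c].
  move=> x; have [x1|x1] := eqVneq `|x| 1; last by exists (0, set0) => h; rewrite h eqxx in x1.
  by have [rho [G H]] := lf x x1; exists (rho, G).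
have [|s [s1 scov]] := @sphere_cover _ _ F (fun x => (D x).1) Ffin.
  by move=> x /DP[].
pose G := \bigcup_(x in [set` s]) (D x).2.
have Gfin : finite_set G.
  by apply: bigcup_finite; [exact: finite_seq|move=> x /s1/DP[]].
have /finite_seqP[gs Ggs] := Gfin.
apply: (@finite_extreme_points F gs) => [h hgs|x Fx].
  have [x /s1/DP[_ _ + _]] : G h by rewrite Ggs.
  by move=> + Dh => /(_ h Dh)[].
split=> [x1 h hgs|hx].
  have [y /s1/DP[_ _ + _]] : G h by rewrite Ggs.
  by move=> + Dh => /(_ h Dh)[_ h1]; rewrite (le_trans (h1 x)).
rewrite leNgt; apply/negP => x1.
have x0 : 0 < `|x| by rewrite (lt_trans ltr01).
pose y := `|x|^-1 *: x.
have Fy : F y by apply: subspaceZ.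
have y1 : `|y| = 1 by rewrite normrZ normfV normr_id mulVf// gt_eqF.
have [z zs zy] := scov y Fy y1.
have [_ _ Dlin Dmax] := DP z (s1 z zs).
have : `|y| <= Num.max 2^-1 `|x|^-1.
  apply: (Dmax y _ zy); first by rewrite le_max lexx.
  move=> h Dh; rewrite le_max; apply/orP; right.
  have [hlin _] := Dlin h Dh.
  have h0 : h 0 = 0.
    by have := hlin 1 0 0; rewrite scale1r addr0 mul1r => /eqP;
       rewrite -subr_eq0 opprD addNKr oppr_eq0 => /eqP.
  rewrite /y -[_ *: x]addr0 hlin h0 addr0 ler_piMr ?invr_ge0//.
  apply: hx; have : G h by exists z.
  by rewrite Ggs.
rewrite y1 le_max => /orP[|]; first lra.
by rewrite invf_ge1// leNgt x1.
Qed.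

End LocallyFinite.

(** * Unconditional basis and polyhedrality *)

Section GaugeBasis.
Variables (R : realType) (g : gauge R).
Local Notation P := (gspace g).

Definition gunit m : P := gfin g m.+1 (unit_test R m).

Lemma gunitE m k : gunit m k = (k == m)%:R.
Proof.
rewrite /= /trunc /unit_test; case: ltnP => // mk; rewrite (gtn_eqF mk)//.
Qed.

Lemma gsumE (I : Type) (r : seq I) (F : I -> P) m :
  (\sum_(k <- r) F k) m = \sum_(k <- r) F k m.
Proof. by elim/big_rec2 : _ => // k y1 y2 _ <-. Qed.

Lemma gseries_coord (a : nat -> R) n m :
  series (fun k => a k *: gunit k) n m = if (m < n)%N then a m else 0.
Proof.
rewrite /series/= gsumE.
rewrite (eq_bigr (fun k => if k == m then a m else 0)); last first.
  move=> k _; rewrite -[LHS]/(a k * gunit k m) gunitE eq_sym.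
  by case: eqP => [->|_]; rewrite ?mulr1// mulr0.
rewrite -big_mkcond/= big_mkord.
case: ltnP => mn; first by rewrite (big_pred1 (Ordinal mn)).
by rewrite big1// => i /eqP im; have := ltn_ord i; rewrite im ltnNge mn.
Qed.

Lemma gcvg_coord (u : nat -> P) (x : P) m : u @ \oo --> x -> (u n m) @[n --> \oo] --> x m.
Proof.
move=> /cvgrPdist_le ux; apply/cvgrPdist_le => e /ux; apply: filterS => n.
by apply: le_trans; exact: gspace_coordB.
Qed.

Lemma gseries_lim (a : nat -> R) (x : P) :
  series (fun k => a k *: gunit k) @ \oo --> x -> a = x.
Proof.
move=> ax; apply/funext => m; have /cvg_lim <-// := gcvg_coord (m := m) ax.
apply/esym/cvg_lim => //; apply: cvg_near_cst; exists m.+1 => // n /= mn.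
by rewrite gseries_coord mn.
Qed.

(** By [gfin_approx] the order in which the coordinates are added is
    irrelevant. *)
Lemma gspace_basis : unconditional_basis gunit.
Proof.
have bij_cvg (x : P) s : bijective s ->
    series (fun k => x (s k) *: gunit (s k)) @ \oo --> x.
  move=> [t st ts]; apply/cvgrPdist_le => e e0.
  have [M0 h] := gfin_approx x e0.
  have [N tN] : exists N, forall m, (m < M0)%N -> (t m < N)%N.
    exists (\max_(m < M0) t m).+1 => m mM; rewrite ltnS.
    exact: (leq_bigmax (Ordinal mM)).
  exists N => // n /= Nn; apply: h.
    move=> m /tN tm; rewrite /series/= gsumE.
    rewrite (bigD1_seq (t m))/= ?iota_uniq//; last first.
      by rewrite mem_index_iota (leq_trans tm).
    rewrite big1 => [|k ktm].
      by rewrite addr0 -[LHS]/(x (s (t m)) * gunit (s (t m)) m) gunitE ts eqxx mulr1.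
    rewrite -[LHS]/(x (s k) * gunit (s k) m) gunitE.
    by rewrite (negbTE (_ : m != s k)) ?mulr0//; apply: contra ktm => /eqP ->; rewrite st.
  move=> m; rewrite /series/= gsumE.
  rewrite (eq_bigr (fun k => if k == t m then x m else 0)); last first.
    move=> k _; rewrite -[LHS]/(x (s k) * gunit (s k) m) gunitE.
    case: eqP => [->|h1]; case: eqP => [h2|h2]; rewrite ?mulr1 ?mulr0//.
      by case: h2; rewrite st.
    by case: h1; rewrite h2 ts.
  rewrite -big_mkcond/= big_mkord.
  case: (ltnP (t m) n) => mn.
    by rewrite (big_pred1 (Ordinal mn))// subrr normr0.
  rewrite big1 ?subr0// => i /eqP im.
  by have := ltn_ord i; rewrite im ltnNge mn.
split=> [x|x a ax s bs]; last by rewrite (gseries_lim ax); exact: bij_cvg.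
exists x; split=> [|a /gseries_lim //].
by apply: (bij_cvg x id); exists id.
Qed.

Lemma sum_ord_le (F G : nat -> R) M M' :
  (forall m, 0 <= F m) -> (forall m, (M <= m)%N -> F m = 0) ->
  (forall m, 0 <= G m <= F m) ->
  \sum_(m < M') G m <= \sum_(m < M) F m.
Proof.
move=> F0 Fz GF; apply: (@le_trans _ _ (\sum_(m < M') F m)).
  by apply: ler_sum => m _; case/andP: (GF m).
rewrite -!(big_mkord xpredT).
case: (leqP M M') => [MM|/ltnW MM].
  rewrite (@big_cat_nat _ _ _ M 0 M')//= gerDl big_nat_cond big1// => m.
  by rewrite andbT => /andP[/Fz].
by rewrite [leRHS](@big_cat_nat _ _ _ M' 0 M)//= lerDl sumr_ge0.
Qed.

Lemma tests_sub i M eta M' eta' : tests g i M eta ->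
  (forall m, `|eta' m| <= `|eta m|) -> (forall m, (M' <= m)%N -> eta' m = 0) ->
  (forall m, exists k : int, eta' m = k%:~R / 2 ^+ m) ->
  tests g i M' eta' /\ l1 M' eta' <= l1 M eta.
Proof.
move=> [h1 h2 h3 _] le' z' int'.
have l1le : l1 M' eta' <= l1 M eta.
  apply: (@sum_ord_le (fun m => `|eta m|) (fun m => `|eta' m|)) => // m.
    by move=> /(h2 m).2 ->; rewrite normr0.
  by rewrite normr_ge0 le'.
split=> //; split=> //.
- exact: le_trans h1.
- by move=> m; split; [rewrite (le_trans (le' m))//; case: (h2 m)|exact: z'].
- move=> xi gxi; apply: le_trans (h3 xi gxi).
  apply: (@sum_ord_le (fun m => `|eta m * xi m|) (fun m => `|eta' m * xi m|)) => // m.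
    by move=> /(h2 m).2 ->; rewrite mul0r normr0.
  by rewrite normr_ge0/= !normrM ler_wpM2r.
Qed.

(** [val] without the moduli, hence linear. *)
Definition test_fun i M (eta : nat -> R) (x : P) : R :=
  (2 - l1 M eta / scale g i) * \sum_(m < M) eta m * x m.

Lemma test_fun_linear i M eta a x y :
  test_fun i M eta (a *: x + y) = a * test_fun i M eta x + test_fun i M eta y.
Proof.
rewrite /test_fun mulrCA -mulrDr; congr (_ * _).
rewrite mulr_sumr -big_split; apply: eq_bigr => m _.
have -> : (a *: x + y : P) m = a * x m + y m by [].
by rewrite mulrDr mulrCA.
Qed.

Lemma test_fun_le i M eta x : tests g i M eta -> test_fun i M eta x <= `|x|.
Proof.
move=> ts; rewrite (le_trans _ (gspace_ub x ts))// ler_wpM2l//.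
  by rewrite (le_trans ler01)//; case/andP: (tests_factor ts).
by apply: ler_sum => m _; exact: ler_norm.
Qed.

(** The entries are multiples of [2 ^- m] of modulus at most one. *)
Lemma finite_tests i0 M0 : finite_set
  [set h : P -> R | exists i eta, [/\ (i <= i0)%N, tests g i M0 eta &
                                      h = test_fun i M0 eta]].
Proof.
pose dec (t : 'I_i0.+1 * {ffun 'I_M0 -> 'I_(2 * 2 ^ M0).+1}) : P -> R := test_fun t.1 M0
  (fun m => if insub m is Some o then ((t.2 o)%:R - (2 ^ M0)%:R) / 2 ^+ m else 0).
apply: (@sub_finite_set _ _ (range dec)); last exact: finite_image finite_finset.
move=> _ [i [eta [ii [h1 h2 h3 h4] ->]]].
have /choice[c ec] : forall o : 'I_M0, exists c : 'I_(2 * 2 ^ M0).+1,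
    eta o = (c%:R - (2 ^ M0)%:R) / 2 ^+ o.
  move=> o; have [k ek] := h4 o.
  have k2 : (`|k| <= 2 ^ M0)%N.
    rewrite -(ler_nat R) natr_absz intr_norm natrX.
    have -> : k%:~R = eta o * 2 ^+ o by rewrite ek mulfVK// expf_neq0.
    rewrite normrM [X in _ * X]ger0_norm ?exprn_ge0// (@le_trans _ _ (1 * 2 ^+ o))//.
      rewrite ler_wpM2r ?exprn_ge0//.
      by apply: (@tests_le1 _ g i M0 eta o); split; [exact: h1|exact: h2|exact: h3|exact: h4].
    by rewrite mul1r ler_eXn2l ?ltr1n// ltnW.
  have kc : (`|(k + (2 ^ M0)%N%:Z)%R|%N < (2 * 2 ^ M0).+1)%N by lia.
  exists (Ordinal kc) => /=; rewrite ek; congr (_ / _).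
  by rewrite natr_absz ger0_norm ?rmorphD/= ?addrK//; lia.
exists (Ordinal (ii : (i < i0.+1)%N), [ffun o => c o]) => //.
apply/funext => x; rewrite /dec /test_fun /=.
have ee m : (m < M0)%N -> eta m = if insub m is Some o
    then (([ffun o => c o] o)%:R - (2 ^ M0)%:R) / 2 ^+ m else 0.
  by move=> mM; rewrite insubT/= ffunE -ec.
congr ((2 - _ / _) * _); apply: eq_bigr => m _; by rewrite -ee.
Qed.

End GaugeBasis.

Section GaugePolyhedral.
Variables (R : realType) (g : gauge R).
Local Notation P := (gspace g).

Lemma scale_mono i j : (i <= j)%N -> scale g i <= scale g j.
Proof.
move=> ij; have t0 := gtau_gt0 g; have t1 := gtau_lt1 g.
have h : 1 <= 2 / gtau g by rewrite ler_pdivlMr// mul1r; lra.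
exact: (ler_weXn2l h ij).
Qed.

Lemma val_tau i M eta (z : nat -> R) M1 : tests g i M eta ->
  (forall m, (M1 <= m)%N -> z m = 0) ->
  val g i M eta z <= 2 * (gtau g ^+ i * \sum_(m < M1) `|z m|).
Proof.
move=> ts z0; have /andP[h1 h2] := tests_factor ts.
have [_ eta_le _ _] := ts.
apply: ler_pM => //; first by rewrite (le_trans ler01).
  exact: sumr_ge0.
rewrite mulr_sumr.
apply: (@sum_ord_le _ (fun m => gtau g ^+ i * `|z m|) (fun m => `|eta m * z m|)) => m.
- by rewrite mulr_ge0// exprn_ge0// ltW// gtau_gt0.
- by move=> /z0 ->; rewrite normr0 mulr0.
- by rewrite normr_ge0/= normrM ler_wpM2r//; case: (eta_le m).
Qed.

Lemma gtau_small (S e : R) : 0 <= S -> 0 < e ->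
  exists i0, forall i, (i0 <= i)%N -> 2 * (gtau g ^+ i * S) <= e.
Proof.
move=> S0 e0.
have : (gtau g ^+ n) @[n --> \oo] --> (0 : R).
  by apply: cvg_expr; rewrite gtr0_norm ?gtau_gt0// gtau_lt1.
have e2 : 0 < e / (2 * (S + 1)) by rewrite divr_gt0// mulr_gt0// ltr_wpDl.
move=> /cvgrPdist_le/(_ _ e2)[i0 _ h]; exists i0 => i ii.
have t0 : 0 <= gtau g ^+ i by rewrite exprn_ge0// ltW// gtau_gt0.
have := h i ii; rewrite /= sub0r normrN ger0_norm//.
rewrite ler_pdivlMr ?mulr_gt0 ?ltr_wpDl// => h'; nra.
Qed.

Lemma gfin_sub_le (x : P) e : 0 < e -> exists M0,
  `|x - gfin g M0 x| <= e /\ forall m, (M0 <= m)%N -> `|x m| <= e.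
Proof.
move=> e0; have [M0 h] := gfin_approx x e0; exists M0.
have le : `|x - gfin g M0 x| <= e.
  apply: h => [m mM|m]; rewrite /= /trunc; first by rewrite mM.
  by case: ifP => _; rewrite ?subrr ?normr0// subr0.
split=> // m mM; rewrite (le_trans _ le)// -[x m]subr0.
have <- : gfin g M0 x m = 0 by rewrite /= trunc_out.
exact: gspace_coordB.
Qed.

(** A test sequence that is cut down to the finitely many coordinates where the
    point is not small gains in its leading factor more than the cut costs. *)
Lemma cut_gain (B e w w' T S : R) : 0 < B -> 0 <= e -> 32 * (e * B) <= 1 ->
  0 <= w' <= w -> w <= B -> T <= S + 2 * e * (w - w') ->
  2^-1 < (2 - w / B) * T -> (2 - w / B) * T <= (2 - w' / B) * S.
Proof.
move=> B0 e0 eB /andP[w'0 w'w] wB TS hT.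
have wB1 : w / B <= 1 by rewrite ler_pdivrMr// mul1r.
have wB0 : 0 <= w / B by apply: divr_ge0; [exact: le_trans w'0 w'w|exact: ltW].
have D0 : 0 <= w - w' by lra.
have T4 : 4^-1 < T by nra.
have D1 : e * (w - w') <= 32^-1 by nra.
have S0 : 4 * (e * B) <= S by nra.
have : 4 * (e * (w - w')) <= (w - w') / B * S.
  rewrite mulrAC ler_pdivlMr//.
  have -> : 4 * (e * (w - w')) * B = (w - w') * (4 * (e * B)) by ring.
  exact: ler_wpM2l.
rewrite mulrBl; set a := w / B in wB1 wB0 hT *; set a' := w' / B => key.
have eD : 0 <= e * (w - w') by exact: mulr_ge0.
apply: (@le_trans _ _ ((2 - a) * (S + 2 * e * (w - w')))).
  by apply: ler_wpM2l => //; lra.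
have : a * (e * (w - w')) >= 0 by exact: mulr_ge0.
lra.
Qed.

(** Test sequences of high level are small near the point, and the others lose
    nothing when they are cut to the coordinates where the point is not small. *)
Lemma gspace_locally_finite : locally_finite_norm P.
Proof.
move=> x x1; have e8 : 0 < 8^-1 :> R by rewrite invr_gt0.
have [M1 [xM1 _]] := gfin_sub_le x e8.
have [i0 hi0] := @gtau_small (\sum_(m < M1) `|gfin g M1 x m|) 8^-1
  (sumr_ge0 _ (fun _ _ => normr_ge0 _)) e8.
pose B := scale g i0; pose e := (32 * B)^-1.
have B1 : 1 <= B by rewrite (le_trans _ (scale_mono (leq0n i0)))// /scale expr0.
have B0 : 0 < B by exact: lt_le_trans B1.
have e0 : 0 < e by rewrite invr_gt0 mulr_gt0.
have eB : 32 * (e * B) = 1 by rewrite /e; field; rewrite gt_eqF.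
have e32 : e <= 32^-1 by nra.
have [M0 [_ xM0]] := gfin_sub_le x e0.
exists e, [set h | exists i eta, [/\ (i <= i0)%N, tests g i M0 eta &
                                      h = test_fun i M0 eta]].
split=> //; first exact: finite_tests.
  move=> h [i [eta [_ ts ->]]]; split=> [a y z|y].
    exact: test_fun_linear.
  exact: test_fun_le.
move=> y c xy c2 hc; apply: gspace_norm_le => i M eta ts.
(* From the level [i0] on the value is at most 1/8 + 1/8 + 1/32, below 1/2. *)
have [ii|/ltnW ii] := leqP i0 i.
  have val3 : val g i M eta y <= val g i M eta (gfin g M1 x) +
      (val g i M eta (x - gfin g M1 x) + val g i M eta (x - y)).
    rewrite (_ : gseq y = (fun m => gfin g M1 x m +
        ((x m - gfin g M1 x m) + -1 * (x m - y m)))); last first.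
      by apply/funext => m; ring.
    rewrite (le_trans (valD _ _ ts))// lerD2l (le_trans (valD _ _ ts))//.
    by rewrite lerD2l valZ normrN normr1 mul1r.
  have := gspace_ub (x - gfin g M1 x) ts; have := gspace_ub (x - y) ts.
  have := @val_tau i M eta (gfin g M1 x) M1 ts (fun m => @trunc_out _ M1 x m).
  have := hi0 i ii; lra.
have [v2|v2] := leP (val g i M eta y) 2^-1; first exact: le_trans c2.
pose eta' m := if (m < M0)%N then (-1) ^+ (y m < 0)%R * `|eta m| else 0.
have [_ eta_sup _ eta_int] := ts.
have abs_eta' m : `|eta' m| = if (m < M0)%N then `|eta m| else 0.
  by rewrite /eta'; case: ifP => _; rewrite ?normr0// normrMsign normr_id.
have le_eta' m : `|eta' m| <= `|eta m|.
  by rewrite abs_eta'; case: ifP.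
have [||ts' l1le] := @tests_sub _ g i M eta M0 eta' ts le_eta'.
- by move=> m; rewrite /eta' ltnNge => ->.
- move=> m; rewrite /eta'; have [k ->] := eta_int m; case: ifP => _.
    exists ((-1) ^+ (y m < 0)%R * `|k|); rewrite normrM normfV.
    rewrite [`|_ ^+ m|]ger0_norm ?exprn_ge0// mulrA; congr (_ / _).
    by rewrite rmorphM/= rmorphXn/= rmorphN1 intr_norm.
  by exists 0; rewrite mul0r.
apply: (@le_trans _ _ (test_fun i M0 eta' y)); last first.
  by apply: hc; exists i, eta'.
have iB := scale_mono ii.
have si := scale_gt0 g i.
rewrite /val /test_fun; apply: (@cut_gain _ e) => //.
- exact: ltW.
- apply: (@le_trans _ _ (32 * (e * B))); last by rewrite eB.
  by rewrite ler_pM2l// ler_wpM2l// ltW.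
- by rewrite l1le andbT; apply: sumr_ge0.
- by case: ts.
have yM0 m : (M0 <= m)%N -> `|y m| <= 2 * e.
  move=> mM; have -> : y m = x m - (x m - y m) by ring.
  rewrite (le_trans (ler_normB _ _))//.
  have := xM0 m mM; have := gspace_coordB x y m; move: xy => /ltW; lra.
apply: (@le_trans _ _ (\sum_(m < M) (`|eta' m * y m| + 2 * e * (`|eta m| - `|eta' m|)))).
  apply: ler_sum => m _; rewrite !normrM abs_eta'; case: ltnP => mM.
    by rewrite subrr mulr0 addr0.
  by rewrite mul0r add0r subr0 mulrC ler_wpM2r// yM0.
rewrite big_split/= -mulr_sumr sumrB; apply: lerD.
  apply: (@le_trans _ _ (\sum_(m < M0) `|eta' m * y m|)).
    apply: (@sum_ord_le _ (fun m => `|eta' m * y m|) (fun m => `|eta' m * y m|)) => // m.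
      by rewrite /eta' ltnNge => ->; rewrite mul0r normr0.
    by rewrite lexx normr_ge0.
  apply: ler_sum => m _; rewrite normrM abs_eta' /eta' ltn_ord mulrAC.
  by rewrite -normrEsign mulrC.
apply: ler_wpM2l; first by rewrite mulr_ge0// ltW.
rewrite /l1 lerD2l lerN2.
apply: (@sum_ord_le _ (fun m => `|eta' m|) (fun m => `|eta' m|)) => // m.
  move=> mM; apply/eqP; rewrite -normr_le0 normr_id.
  by rewrite (le_trans (le_eta' m))// (eta_sup m).2// normr0.
by rewrite lexx normr_ge0.
Qed.

Lemma gspace_polyhedral : isomorphically_polyhedral P.
Proof.
exists (fun x : P => `|x|); split; last first.
  exact: locally_finite_polyhedral gspace_locally_finite.
split; last first.
  by exists 1, 1; split=> // x; rewrite mul1r lexx.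
split=> [x /eqP|a x|x y]; [|exact: normrZ|exact: ler_normD].
by rewrite normr_eq0 => /eqP.
Qed.

End GaugePolyhedral.

(** * Quotient maps from approximate liftings *)

Section ApproximateLifting.
Variables (R : realType) (P Z : completeNormedModType R) (T : {linear P -> Z}).
Variables (K C : R).
Hypothesis Tle : forall x, `|T x| <= K * `|x|.
Hypothesis C0 : 0 <= C.
Hypothesis Tlift : forall z, exists x, `|z - T x| <= `|z| / 2 /\ `|x| <= C * `|z|.

Lemma bounded_linear_cvg (V W : normedModType R) (f : {linear V -> W}) (M : R) :
  (forall x, `|f x| <= M * `|x|) -> continuous f.
Proof.
move=> fM; suff : bounded_near f (nbhs 0) by move=> /bounded_linear_continuous.
apply/linear_boundedP; exists M; split => [|B MB x]; first by rewrite num_real.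
by rewrite (le_trans (fM x))// ler_wpM2r// ltW.
Qed.

(** The usual iteration from the open mapping theorem. *)
Lemma exact_lift z : exists x, T x = z /\ `|x| <= 2 * C * `|z|.
Proof.
have /choice[psi hpsi] := Tlift.
pose r := fix r n := if n is k.+1 then r k - T (psi (r k)) else z.
have rle n : `|r n| <= `|z| / 2 ^+ n.
  elim: n => [|n IH]; first by rewrite expr0 divr1.
  rewrite /= (le_trans (hpsi (r n)).1)// exprS invfM mulrA mulrAC.
  by rewrite ler_wpM2r.
pose x n := psi (r n).
have xle n : `|x n| <= C * `|z| / 2 ^+ n.
  by rewrite (le_trans (hpsi (r n)).2)// -mulrA ler_wpM2l.
have geo n : \sum_(0 <= k < n) C * `|z| / 2 ^+ k <= 2 * C * `|z|.
  suff -> : \sum_(0 <= k < n) C * `|z| / 2 ^+ k = C * `|z| * (2 - 2 / 2 ^+ n).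
    have -> : 2 * C * `|z| = C * `|z| * 2 by ring.
    rewrite ler_wpM2l ?mulr_ge0// gerBl.
    by rewrite divr_ge0// exprn_ge0.
  elim: n => [|n IH]; first by rewrite big_nil expr0; field.
  by rewrite big_nat_recr//= IH exprS; field; rewrite expf_neq0.
have xle' n : \sum_(0 <= k < n) `|x k| <= 2 * C * `|z|.
  by apply: le_trans (geo n); apply: ler_sum_nat.
have xcvg : cvgn (series x).
  apply: normed_cvg; apply: nondecreasing_is_cvgn.
    apply/nondecreasing_seqP => n.
    by rewrite -[leRHS]/(\sum_(0 <= k < n.+1) `|x k|) big_nat_recr//= lerDl.
  by exists (2 * C * `|z|) => _ [n _ <-]; exact: xle'.
exists (limn (series x)); split; last first.
  have nlim : (fun n => `|series x n|) @ \oo --> `|limn (series x)|.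
    exact: cvg_norm.
  rewrite -(cvg_lim _ nlim)//; apply: limr_le; first exact: cvgP nlim.
  by apply: nearW => n; rewrite (le_trans (ler_norm_sum _ _ _)).
have Tc := bounded_linear_cvg Tle.
have Tr n : T (series x n) = z - r n.
  rewrite /series/=; elim: n => [|n IH]; first by rewrite big_nil linear0 subrr.
  by rewrite big_nat_recr//= linearD IH opprB addrAC -addrA.
have T1 : T (series x n) @[n --> \oo] --> T (limn (series x)).
  by apply: continuous_cvg; [exact: Tc|exact: xcvg].
have T2 : T (series x n) @[n --> \oo] --> z.
  apply/cvgrPdist_le => e e0.
  have : (fun n => `|z| * 2^-1 ^+ n) @ \oo --> `|z| * 0.
    by apply: cvgMr; apply: cvg_expr; rewrite gtr0_norm ?invf_lt1 ?ltr1n// invr_gt0.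
  rewrite mulr0 => /cvgrPdist_le/(_ e e0); apply: filterS => n.
  rewrite sub0r normrN ger0_norm ?mulr_ge0 ?exprn_ge0 ?invr_ge0// => h.
  by rewrite Tr subKr (le_trans (rle n))// -exprVn.
by rewrite -(cvg_lim _ T1)// (cvg_lim _ T2).
Qed.

Definition kernel_subspace : Defs.subspace P.
Proof.
by exists [set x | T x = 0] => [|a x y /= x0 y0]; rewrite /= ?linear0// linearP x0 y0 scaler0 addr0.
Defined.

Lemma kernel_closed : closed (subspace_set kernel_subspace).
Proof.
rewrite (_ : subspace_set _ = (fun x => `|T x|) @^-1` [set 0]); last first.
  by apply/seteqP; split=> x /= => [->|/normr0_eq0 //]; rewrite normr0.
apply: preimage_closed; last exact: closed_eq.
move=> x _; apply: (continuous_comp (bounded_linear_cvg Tle (x := x))).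
exact: norm_continuous.
Qed.

Lemma lift_quotient : is_quotient_of Z P.
Proof.
exists kernel_subspace, kernel_closed.
have /choice[s hs] := exact_lift.
pose f z : quotient_space kernel_closed := lin_proj kernel_subspace (s z).
have flin : linear f.
  move=> a x y; rewrite /f -linearP; apply/lin_projP; rewrite /= linearB linearP.
  by rewrite !(hs _).1 subrr.
pose fL : {linear Z -> quotient_space kernel_closed} :=
  HB.pack f (GRing.isLinear.Build R Z (quotient_space kernel_closed) *:%R f flin).
pose gq (q : quotient_space kernel_closed) : Z := T (repr (q : lin_quot kernel_subspace)).
have gpi x : gq (lin_proj kernel_subspace x) = T x.
  apply/eqP; rewrite -subr_eq0 -linearB; apply/eqP.
  by have /lin_projP := lin_projK (lin_proj kernel_subspace x).
have glin : linear gq.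
  move=> a q r; rewrite -[q]lin_projK -[r]lin_projK.
  by rewrite -[X in gq X]linearP !gpi linearP.
pose gL : {linear quotient_space kernel_closed -> Z} :=
  HB.pack gq (GRing.isLinear.Build R (quotient_space kernel_closed) Z *:%R gq glin).
exists fL, gq; split.
- by move=> z; rewrite /= /f gpi (hs z).1.
- move=> q; rewrite -[q]lin_projK gpi; apply/lin_projP => /=.
  by rewrite linearB (hs _).1 subrr.
- apply: (@bounded_linear_cvg _ _ fL (2 * C)) => z.
  rewrite (le_trans _ (hs z).2)//; exact: quotient_norm_pi.
- apply: (@bounded_linear_cvg _ _ gL `|K|) => q.
  apply/ler_addgt0Pr => e e0; have K1 : 0 < `|K| + 1 by rewrite ltr_wpDl.
  have [x <- xq] := @quotient_norm_lt _ _ kernel_subspace q (`|q| + e / (`|K| + 1))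
    ltac:(by rewrite ltrDl divr_gt0).
  rewrite /= gpi (le_trans (Tle x))// (@le_trans _ _ (`|K| * `|x|))//.
    by rewrite ler_wpM2r// ler_norm.
  rewrite (@le_trans _ _ (`|K| * (`|lin_proj kernel_subspace x : quotient_space kernel_closed| + e / (`|K| + 1))))//.
    by rewrite ler_wpM2l// ltW//.
  by rewrite mulrDr lerD2l mulrCA ger_pMr// ler_pdivrMr// mul1r lerDl.
Qed.

End ApproximateLifting.

(** * Lattice norms on finitely supported sequences *)

Section FinitelySupported.
Variable R : realType.
Local Notation C := (c00 R).
Implicit Types (x y z a : C) (b t : nat -> R).

Lemma c00D x y n : (x + y) n = x n + y n. Proof. by []. Qed.
Lemma c00Z (s : R) x n : (s *: x) n = s * x n. Proof. by []. Qed.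
Lemma c00N x n : (- x) n = - x n. Proof. by []. Qed.

Lemma c00sum (I : Type) (r : seq I) (F : I -> C) n :
  (\sum_(k <- r) F k) n = \sum_(k <- r) F k n.
Proof. by elim/big_rec2 : _ => // k y1 y2 _ <-. Qed.

Lemma cmul_subproof t x : (fun n => t n * x n) \in @finitely_supported R.
Proof.
have /asboolP xf := c00P x; apply/asboolP; move: xf.
by apply: filterS => n ->; rewrite mulr0.
Qed.
Definition cmul t x : C := C00 (cmul_subproof t x).

Lemma cmulE t x n : cmul t x n = t n * x n. Proof. by []. Qed.

Lemma cdelta_subproof k : (fun n => (n == k)%:R) \in @finitely_supported R.
Proof. by apply/asboolP; exists k.+1 => // n /= kn; rewrite gtn_eqF. Qed.
Definition cdelta k : C := C00 (cdelta_subproof k).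

Lemma cdeltaE k n : cdelta k n = (n == k)%:R. Proof. by []. Qed.

Definition cabs x : C := cmul (fun n => (-1) ^+ (x n < 0)%R) x.

Lemma cabsE x n : cabs x n = `|x n|.
Proof. by rewrite cmulE -normrEsign. Qed.

Definition crestr (A : set nat) x : C := cmul (fun n => (n \in A)%:R) x.

Lemma crestrE A x n : crestr A x n = if n \in A then x n else 0.
Proof. by rewrite cmulE; case: (n \in A); rewrite ?mul1r ?mul0r. Qed.

Definition bnd x : nat := projT1 (cid (c00_bound x)).

Lemma bndP x n : (bnd x <= n)%N -> x n = 0.
Proof. by rewrite /bnd; case: cid => /= M h; exact: h. Qed.

Definition pair b x : R := \sum_(n < bnd x) b n * x n.

Lemma sum_ord_eq (F : nat -> R) M M' :
  (forall n, (M <= n)%N -> F n = 0) -> (forall n, (M' <= n)%N -> F n = 0) ->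
  \sum_(n < M) F n = \sum_(n < M') F n.
Proof.
wlog MM : M M' / (M <= M')%N => [h|].
  have [MM|/ltnW MM] := leqP M M' => h1 h2; first exact: h.
  by rewrite (h M' M).
move=> h1 h2; rewrite -!(big_mkord xpredT) [RHS](@big_cat_nat _ _ _ M 0 M')//=.
rewrite [X in _ + X]big_nat_cond [X in _ + X]big1 ?addr0// => n.
by rewrite andbT => /andP[/h1].
Qed.

Lemma pairE b x M : (forall n, (M <= n)%N -> x n = 0) ->
  pair b x = \sum_(n < M) b n * x n.
Proof.
move=> xM; apply: (@sum_ord_eq (fun n => b n * x n)) => n.
  by move=> /bndP ->; rewrite mulr0.
by move=> /xM ->; rewrite mulr0.
Qed.

Lemma pairD b x y : pair b (x + y) = pair b x + pair b y.
Proof.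
pose M := maxn (bnd x) (bnd y).
have xM n : (M <= n)%N -> x n = 0 by rewrite geq_max => /andP[/bndP].
have yM n : (M <= n)%N -> y n = 0 by rewrite geq_max => /andP[_ /bndP].
rewrite (pairE _ xM) (pairE _ yM) (@pairE _ _ M) => [|n Mn].
  by rewrite -big_split; apply: eq_bigr => n _; rewrite c00D mulrDr.
by rewrite c00D xM// yM// addr0.
Qed.

Lemma pairZ b s x : pair b (s *: x) = s * pair b x.
Proof.
rewrite (@pairE _ _ (bnd x)) => [|n /bndP xn]; last by rewrite c00Z xn mulr0.
by rewrite mulr_sumr; apply: eq_bigr => n _; rewrite c00Z mulrCA.
Qed.

Lemma pair0 b : pair b 0 = 0.
Proof. by rewrite -[X in pair b X](scale0r (0 : C)) pairZ mul0r. Qed.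

Lemma pairN b x : pair b (- x) = - pair b x.
Proof. by rewrite -scaleN1r pairZ mulN1r. Qed.

Lemma pair_sum (I : Type) (r : seq I) (F : I -> C) b :
  pair b (\sum_(k <- r) F k) = \sum_(k <- r) pair b (F k).
Proof.
elim: r => [|k r IH]; first by rewrite !big_nil pair0.
by rewrite !big_cons pairD IH.
Qed.

Lemma pair_delta b k : pair b (cdelta k) = b k.
Proof.
rewrite (@pairE _ _ k.+1) => [|n kn]; last by rewrite cdeltaE gtn_eqF.
rewrite big_ord_recr/= eqxx mulr1 big1 ?add0r// => n _.
by rewrite /= ltn_eqF// mulr0.
Qed.

Lemma pair_le b b' x y : (forall n, b n * x n <= b' n * y n) ->
  pair b x <= pair b' y.
Proof.
move=> h; pose M := maxn (bnd x) (bnd y).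
rewrite !(@pairE _ _ M) => [|n|n].
- by apply: ler_sum => n _.
- by rewrite geq_max => /andP[_ /bndP].
- by rewrite geq_max => /andP[/bndP].
Qed.

Lemma pair_eq b b' x y : (forall n, b n * x n = b' n * y n) ->
  pair b x = pair b' y.
Proof. by move=> h; apply/le_anti; rewrite !pair_le// => n; rewrite h. Qed.

Record lattice_norm (N : C -> R) : Prop := LatticeNorm {
  ln_mono : forall x y, (forall n, `|x n| <= `|y n|) -> N x <= N y;
  lnD : forall x y, N (x + y) <= N x + N y;
  lnZ : forall s x, N (s *: x) = `|s| * N x;
  ln_delta : forall n, N (cdelta n) = 1 }.

Section LatticeNormTheory.
Variables (N : C -> R) (latN : lattice_norm N).

Lemma ln_eq x y : (forall n, `|x n| = `|y n|) -> N x = N y.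
Proof.
by move=> h; apply/le_anti/andP; split; apply: (ln_mono latN) => n; rewrite h.
Qed.

Lemma ln0 : N 0 = 0.
Proof. by rewrite -(scale0r 0) (lnZ latN) normr0 mul0r. Qed.

Lemma ln_ge0 x : 0 <= N x.
Proof. by rewrite -ln0; apply: (ln_mono latN) => n; rewrite normr0. Qed.

Lemma ln_coord x n : `|x n| <= N x.
Proof.
rewrite -[leLHS]mulr1 -(ln_delta latN n) -(lnZ latN).
apply: (ln_mono latN) => k; rewrite c00Z cdeltaE.
by case: eqP => [->|_]; rewrite ?mulr1// mulr0 normr0.
Qed.

Lemma ln_sum (I : Type) (r : seq I) (P : pred I) (F : I -> C) :
  N (\sum_(k <- r | P k) F k) <= \sum_(k <- r | P k) N (F k).
Proof.
elim/big_rec2 : _ => [|k y1 y2 _ h]; first by rewrite ln0.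
by rewrite (le_trans (lnD latN _ _))// lerD2l.
Qed.

(* The functional with value [N z] at [z] that is given by [b] on the first [k]
   coordinates is dominated by the norm. *)
Let extends z k b := forall s a, (forall n, (k <= n)%N -> a n = 0) ->
  s * N z + pair b a <= N (s *: z + a).

Let extend_step z k b : extends z k b -> exists b', extends z k.+1 b'.
Proof.
move=> ext; pose low a := forall n, (k <= n)%N -> a n = 0.
pose S := [set r | exists s a, low a /\
  r = s * N z + pair b a - N (s *: z + a - cdelta k)].
have Sub s a r : low a -> S r -> r <= N (s *: z + a + cdelta k) - (s * N z + pair b a).
  move=> la [s' [a' [la' ->]]].
  suff : s * N z + pair b a + (s' * N z + pair b a') <=
      N (s *: z + a + cdelta k) + N (s' *: z + a' - cdelta k) by lra.
  have -> : s * N z + pair b a + (s' * N z + pair b a') =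
            (s + s') * N z + pair b (a + a') by rewrite pairD; ring.
  apply: (@le_trans _ _ (N ((s + s') *: z + (a + a')))).
    by apply: ext => n kn; rewrite c00D la// la'// addr0.
  apply: le_trans (lnD latN _ _); rewrite le_eqVlt; apply/orP; left.
  apply/eqP; congr N; apply: c00_eqP => n; rewrite !c00D !c00Z c00N; ring.
have Ssup : has_sup S.
  split; first by exists (0 * N z + pair b 0 - N (0 *: z + 0 - cdelta k)), 0, 0.
  exists (N (0 *: z + 0 + cdelta k) - (0 * N z + pair b 0)) => r Sr.
  exact: Sub.
pose c := sup S.
have c1 s a : low a -> s * N z + pair b a + c <= N (s *: z + a + cdelta k).
  move=> la; rewrite addrC -lerBrDr.
  by apply: ge_sup => [|r Sr]; [case: Ssup|exact: Sub].
have c2 s a : low a -> s * N z + pair b a - c <= N (s *: z + a - cdelta k).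
  move=> la; rewrite lerBlDl -lerBlDr.
  by apply: (sup_upper_bound Ssup); exists s, a.
exists (fun n => if n == k then c else b n) => s a ka.
pose a' := crestr [set n | (n < k)%N] a.
have la' : low a'.
  by move=> n kn; rewrite crestrE memNset//= ltnNge kn.
have aE : a = a' + a k *: cdelta k.
  apply: c00_eqP => n; rewrite c00D c00Z cdeltaE crestrE.
  case: (ltngtP n k) => nk.
  - by rewrite mem_set//= mulr0 addr0.
  - by rewrite memNset/= ?mulr0 ?addr0 ?ka//; apply/negP; rewrite -leqNgt ltnW.
  - by rewrite nk memNset/= ?mulr1 ?add0r// ltnn.
have -> : pair (fun n => if n == k then c else b n) a = pair b a' + a k * c.
  rewrite {1}aE pairD pairZ pair_delta eqxx; congr (_ + _).
  apply: pair_eq => n; case: eqP => // ->.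
  by rewrite la'// !mulr0.
have [ak|ak|ak] := ltgtP (a k) 0; last first.
- rewrite ak mul0r addr0 aE ak scale0r addr0.
  exact: ext.
- have := c1 (s / a k) ((a k)^-1 *: a') (fun n kn => ltac:(by rewrite c00Z la' ?mulr0)).
  rewrite pairZ -(ler_pM2l ak) -[X in _ <= X * _](gtr0_norm ak) -(lnZ latN).
  have -> : a k * (s / a k * N z + (a k)^-1 * pair b a' + c) =
    s * N z + (pair b a' + a k * c) by field; rewrite gt_eqF.
  move=> /le_trans; apply; rewrite [X in _ <= N (_ + X)]aE.
  rewrite le_eqVlt; apply/orP; left; apply/eqP; congr N; apply: c00_eqP => n.
  by rewrite !(c00D, c00Z); field; rewrite gt_eqF.
- have Nak : 0 < - a k by rewrite oppr_gt0.
  have := c2 (s / - a k) ((- a k)^-1 *: a') (fun n kn => ltac:(by rewrite c00Z la' ?mulr0)).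
  rewrite pairZ -(ler_pM2l Nak) -[X in _ <= X * _](gtr0_norm Nak) -(lnZ latN).
  have -> : - a k * (s / - a k * N z + (- a k)^-1 * pair b a' - c) =
    s * N z + (pair b a' + a k * c) by field; rewrite lt_eqF.
  move=> /le_trans; apply; rewrite [X in _ <= N (_ + X)]aE.
  rewrite le_eqVlt; apply/orP; left; apply/eqP; congr N; apply: c00_eqP => n.
  by rewrite !(c00D, c00Z, c00N); field; rewrite lt_eqF.
Qed.

(** Hahn-Banach for a lattice norm: the supporting functional can be chosen
    nonnegative. *)
Lemma norming_functional z : exists b, [/\ forall n, 0 <= b n,
  pair b (cabs z) = N z & forall a, pair b (cabs a) <= N a].
Proof.
have [b ext] : exists b, extends z (bnd z) b.
  elim: (bnd z) => [|k [b /extend_step //]].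
  exists (fun=> 0) => s a a0; have -> : a = 0 by apply: c00_eqP => n; rewrite a0.
  by rewrite addr0 pair0 addr0 (lnZ latN) ler_wpM2r ?ln_ge0// ler_norm.
have bz : N z <= pair b z.
  have := ext 1 (- z) (fun n zn => ltac:(by rewrite c00N bndP ?oppr0)).
  by rewrite scale1r subrr ln0 mul1r pairN subr_le0.
pose b' n := if (n < bnd z)%N then `|b n| else 0.
have b'le a : pair b' (cabs a) <= N a.
  pose a' := cmul (fun n => if (n < bnd z)%N then (-1) ^+ (b n < 0)%R else 0) (cabs a).
  apply: (@le_trans _ _ (pair b a')).
    apply: pair_le => n; rewrite [a' n]cmulE /b'; case: ifP => _; last first.
      by rewrite !mul0r mulr0.
    by rewrite mulrA [b n * _]mulrC -normrEsign.
  apply: (@le_trans _ _ (N a')).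
    have := ext 0 a'; rewrite mul0r add0r scale0r add0r; apply => n zn.
    by rewrite [a' n]cmulE ltnNge zn mul0r.
  apply: (ln_mono latN) => n; rewrite [a' n]cmulE; case: ifP => _.
    by rewrite normrMsign cabsE normr_id.
  by rewrite mul0r normr0.
exists b'; split=> // [n|]; first by rewrite /b'; case: ifP.
apply/le_anti; rewrite b'le (le_trans bz)//; apply: pair_le => n.
rewrite cabsE /b'; case: ltnP => [_|zn]; last by rewrite bndP// normr0 !mulr0.
by rewrite -normrM ler_norm.
Qed.

(** A quantitative form of uniform smoothness along disjoint vectors; an upper
    [r]-estimate with constant one gives it with [t ^+ 2 = 2 `^ (1 - r)]. *)
Definition disjoint_smooth (K t : R) : Prop := forall x y i,
  (forall n, x n = 0 \/ y n = 0) -> N x <= 1 -> N y <= 2 ^- i ->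
  N (x + y) <= 1 + K * (2 ^- i * t ^+ (2 * i)).

(** Where [a] is much larger than the normalised vector [c], a functional
    norming [c] is small on [a]: otherwise adding a small multiple of that part
    of [a] to [c] would increase the norm too much. *)
Lemma norming_small (K t : R) (c : C) b : 0 < t < 1 -> disjoint_smooth K t ->
  N c <= 1 -> (forall n, 0 <= b n) -> pair b (cabs c) = 1 ->
  (forall a, pair b (cabs a) <= N a) ->
  forall a (A : set nat) i, N a <= 1 ->
    (forall n, A n -> 2 ^+ i * `|c n| <= `|a n|) ->
    pair b (crestr A (cabs a)) <= Num.max 1 (2 * K / t ^+ 2) * t ^+ (2 * i).
Proof.
move=> /andP[t0 t1] sm c1 b0 bc bN a A i a1 Aa.
case: i Aa => [|i] Aa.
  rewrite muln0 expr0 mulr1 le_max; apply/orP; left.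
  apply: le_trans a1; apply: le_trans (bN a); apply: pair_le => n.
  by rewrite crestrE; case: ifP => _; rewrite ?lexx// mulr0 mulr_ge0// cabsE.
pose u : C := crestr (~` A) (cabs c).
pose h : C := crestr A (cabs c + 2 ^- i.+1 *: cabs a).
have p0 : 0 < 2 ^+ i.+1 :> R by rewrite exprn_gt0.
have uh1 : N (u + h) <= 1 + K * (2 ^- i * t ^+ (2 * i)).
  apply: sm.
  - by move=> n; rewrite !crestrE in_setC; case: (n \in A) => /=; [left|right].
  - apply: le_trans c1; apply: (ln_mono latN) => n; rewrite crestrE.
    by case: ifP => _; rewrite ?cabsE ?normr_id ?normr0.
  - apply: (@le_trans _ _ (N (2 ^- i *: a))); last first.
      by rewrite (lnZ latN) ger0_norm ?invr_ge0 ?exprn_ge0// ler_piMr ?invr_ge0 ?exprn_ge0.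
    apply: (ln_mono latN) => n; rewrite crestrE; case: ifP => [|_]; last by rewrite normr0.
    rewrite inE => /Aa; rewrite c00D !c00Z !cabsE => ca.
    rewrite [leLHS]ger0_norm ?addr_ge0 ?mulr_ge0 ?invr_ge0 ?exprn_ge0//.
    rewrite [leRHS]normrM [X in _ <= X * _]ger0_norm ?invr_ge0 ?exprn_ge0//.
    have -> : 2 ^- i * `|a n| = 2 ^- i.+1 * `|a n| + 2 ^- i.+1 * `|a n|.
      by rewrite exprS invfM; field; rewrite expf_neq0.
    by rewrite lerD2r ler_pdivlMl.
have : pair b (u + h) <= N (u + h).
  apply: le_trans (bN _); apply: pair_le => n; rewrite cabsE ler_wpM2l//.
  exact: ler_norm.
have -> : pair b (u + h) =
    pair b (cabs c) + 2 ^- i.+1 * pair b (crestr A (cabs a)).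
  rewrite -pairZ -pairD; apply: pair_eq => n; congr (_ * _).
  rewrite c00D [in RHS]c00D c00Z !crestrE in_setC.
  case: (n \in A); first by rewrite add0r c00D c00Z.
  by rewrite mulr0.
rewrite bc; move=> /le_trans/(_ uh1); rewrite lerD2l ler_pdivrMl// => /le_trans; apply.
have ti : 0 <= t ^+ (2 * i.+1) by rewrite exprn_ge0// ltW.
apply: (@le_trans _ _ (2 * K / t ^+ 2 * t ^+ (2 * i.+1))).
  rewrite mulnS exprD exprS.
  rewrite (_ : _ * (K * _) = 2 * K * t ^+ (2 * i)); last first.
    by field; rewrite expf_neq0.
  by rewrite mulrA divfK// expf_neq0// gt_eqF.
by rewrite ler_wpM2r// le_max lexx orbT.
Qed.

End LatticeNormTheory.
End FinitelySupported.

(** * Every sufficiently smooth lattice is a quotient of a gauge space *)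

Lemma nat_pair_bijection : exists (f : nat -> nat * nat) (f' : nat * nat -> nat),
  cancel f f' /\ cancel f' f.
Proof.
have /ppcard_eqP[F] := card_nat2.
have := 'bij_F; rewrite setTT_bijective => -[G FG GF].
by exists G, F; split.
Qed.

Section DyadicLevel.
Variable R : realType.

Definition dyadic_level (t : R) : nat :=
  xget 0%N [set j | 2 ^- j.+1 < t <= 2 ^- j].

Lemma dyadic_levelP (t : R) : 0 < t <= 1 ->
  2 ^- (dyadic_level t).+1 < t <= 2 ^- (dyadic_level t).
Proof.
move=> /andP[t0 t1].
suff ex : exists j, [set j | 2 ^- j.+1 < t <= 2 ^- j] j.
  exact: (@xgetPex _ 0%N [set j | 2 ^- j.+1 < t <= 2 ^- j] ex).
have ex : exists j, 2 ^- j.+1 < t.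
  exists (Num.bound t^-1); rewrite invf_plt ?posrE ?exprn_gt0//.
  have /(archi_boundP (x := t^-1)) : 0 <= t^-1 by rewrite invr_ge0 ltW.
  move=> /lt_le_trans; apply; rewrite -natrX ler_nat.
  by rewrite ltnW// (ltn_trans (ltnSn _))// ltn_expl.
case: (ex_minnP ex) => j tj jmin; exists j => /=; rewrite tj/=.
case: j tj jmin => [|j] tj jmin; first by rewrite expr0 invr1.
rewrite leNgt; apply/negP => /jmin; by rewrite ltnn.
Qed.

End DyadicLevel.

Section Synthesis.
Variables (R : realType) (Z : normedModType R) (e : nat -> Z).
Local Notation C := (c00 R).

Definition synth (a : C) : Z := \sum_(n < bnd a) a n *: e n.

Lemma synthE (a : C) M : (forall n, (M <= n)%N -> a n = 0) ->
  synth a = \sum_(n < M) a n *: e n.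
Proof.
move=> aM; rewrite /synth.
have h K : (forall n, (K <= n)%N -> a n = 0) -> forall K', (K <= K')%N ->
    \sum_(n < K') a n *: e n = \sum_(n < K) a n *: e n.
  move=> aK K' KK; rewrite -!(big_mkord xpredT (fun n => a n *: e n)).
  rewrite (@big_cat_nat _ _ _ K 0 K')//=.
  rewrite [X in _ + X]big_nat_cond [X in _ + X]big1 ?addr0// => n.
  by rewrite andbT => /andP[/aK -> _]; rewrite scale0r.
have [le|/ltnW le] := leqP M (bnd a); first exact: h.
by rewrite (h _ (@bndP _ a) _ le).
Qed.

Lemma synth_linear : linear synth.
Proof.
move=> s x y; pose M := maxn (bnd x) (bnd y).
have xM n : (M <= n)%N -> x n = 0 by rewrite geq_max => /andP[/bndP].
have yM n : (M <= n)%N -> y n = 0 by rewrite geq_max => /andP[_ /bndP].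
rewrite (synthE xM) (synthE yM) (@synthE _ M) => [|n Mn].
  rewrite scaler_sumr -big_split; apply: eq_bigr => n _; rewrite [RHS]/=.
  by rewrite c00D c00Z scalerDl scalerA.
by rewrite c00D c00Z xM// yM// mulr0 addr0.
Qed.
HB.instance Definition _ := GRing.isLinear.Build R C Z *:%R synth synth_linear.

Lemma synth_delta k : synth (cdelta R k) = e k.
Proof.
rewrite (@synthE _ k.+1) => [|n kn]; last by rewrite cdeltaE gtn_eqF.
rewrite big_ord_recr/= eqxx scale1r big1 ?add0r// => n _.
by rewrite /= ltn_eqF// scale0r.
Qed.

End Synthesis.

Section Extension.
Variables (R : realType) (g : gauge R) (Z : completeNormedModType R).
Variables (v : nat -> Z) (K : R).
Local Notation P := (gspace g).
Hypothesis vK : forall (x : P) M, `|\sum_(m < M) x m *: v m| <= K * `|x|.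

Lemma gspace_extension : exists T : {linear P -> Z},
  (forall x, `|T x| <= K * `|x|) /\ forall m, T (gunit g m) = v m.
Proof.
pose S (x : P) M := \sum_(m < M) x m *: v m.
have Scvg x : cvgn (S x).
  apply/cauchy_cvgP/cauchyP => d d0.
  have K1 : 0 < `|K| + 1 by rewrite ltr_wpDl.
  have [M0 [xM0 _]] := gfin_sub_le x (divr_gt0 d0 (mulr_gt0 (@ltr0Sn R 1) K1)).
  exists (S x M0); exists M0 => // M /= MM; rewrite -ball_normE/=.
  have -> : S x M0 - S x M = - \sum_(m < M) (x - gfin g M0 x) m *: v m.
    rewrite /S -!(big_mkord xpredT (fun m => x m *: v m)).
    rewrite -(big_mkord xpredT (fun m => (x - gfin g M0 x : P) m *: v m)).
    rewrite (@big_cat_nat _ _ _ M0 0 M)//= [in RHS](@big_cat_nat _ _ _ M0 0 M)//=.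
    rewrite opprD addrA subrr add0r [X in _ = - (X + _)]big_nat_cond.
    rewrite [X in _ = - (X + _)]big1 ?add0r => [|m]; last first.
      rewrite andbT => /andP[_ mM].
      rewrite -[LHS]/((x m - gfin g M0 x m) *: v m).
      by rewrite /= /trunc mM subrr scale0r.
    congr (- _); apply: eq_big_nat => m /andP[mM _]; congr (_ *: _).
    rewrite -[RHS]/(x m - gfin g M0 x m).
    by rewrite /= trunc_out// subr0.
  rewrite normrN (le_lt_trans (vK _ _))//.
  apply: (@le_lt_trans _ _ ((`|K| + 1) * (d / (2 * (`|K| + 1))))).
    apply: (@le_trans _ _ ((`|K| + 1) * `|x - gfin g M0 x|)).
      by rewrite ler_wpM2r// (le_trans (ler_norm _))// lerDl.
    by rewrite ler_wpM2l// ltW.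
  have -> : (`|K| + 1) * (d / (2 * (`|K| + 1))) = d / 2.
    by field; rewrite gt_eqF.
  by rewrite ltr_pdivrMr// ltr_pMr// ltr1n.
pose t x := limn (S x).
have tlin : linear t.
  move=> s x y; rewrite /t; apply/cvg_lim => //.
  rewrite (_ : S (s *: x + y) = (fun n => s *: S x n + S y n)); last first.
    apply/funext => M; rewrite /S scaler_sumr -big_split; apply: eq_bigr => m _ /=.
    rewrite -[LHS]/((s * x m + y m) *: v m).
    by rewrite scalerDl scalerA.
  by apply: cvgD; [apply: cvgZr; exact: Scvg|exact: Scvg].
pose T : {linear P -> Z} := HB.pack t (GRing.isLinear.Build R P Z *:%R t tlin).
exists T; split=> [x|m].
  have nlim : (fun n => `|S x n|) @ \oo --> `|t x| by apply: cvg_norm; exact: Scvg.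
  rewrite -[T x]/(t x) -(cvg_lim _ nlim)//; apply: limr_le; first exact: cvgP nlim.
  by apply: nearW => n; exact: vK.
rewrite -[T _]/(t _); apply/cvg_lim => //; apply: cvg_near_cst.
exists m.+1 => // M /= mM; rewrite /S (bigD1 (Ordinal mM))//.
rewrite gunitE eqxx scale1r big1; first exact: addr0.
move=> k km; by rewrite gunitE (negbTE (_ : nat_of_ord k != m)) ?scale0r//.
Qed.

End Extension.

Lemma half_geometric (R : realType) n : \sum_(m < n) 2 ^- m <= 2 :> R.
Proof.
suff -> : \sum_(m < n) 2 ^- m = 2 - 2 / 2 ^+ n :> R.
  by rewrite gerBl divr_ge0// exprn_ge0.
elim: n => [|n IH]; first by rewrite big_ord0 expr0; field.
by rewrite big_ord_recr/= IH exprS; field; rewrite expf_neq0.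
Qed.

Section SmoothLatticeQuotient.
Variables (R : realType) (N : c00 R -> R) (K t : R).
Hypotheses (latN : lattice_norm N) (t01 : 0 < t < 1).
Hypothesis smN : disjoint_smooth N K t.
Variables (f : nat -> nat * nat) (f' : nat * nat -> nat).
Hypotheses (fK : cancel f f') (f'K : cancel f' f).
Local Notation C := (c00 R).

Let pos m := (f m).1.
Let lev m := (f m).2.

Let pos_inj m m' : pos m = pos m' -> lev m = lev m' -> m = m'.
Proof.
move=> hp hl; apply: (can_inj fK).
by rewrite [f m]surjective_pairing [f m']surjective_pairing -/(pos m) hp -/(lev m) hl.
Qed.

(** The entry [a n] is stored only on the level of its modulus, where the weight
    brings it to a modulus between 1/2 and 1. *)
Definition lift_fun (a : C) : nat -> R := fun m =>
  if lev m == dyadic_level `|a (pos m)| then 2 ^+ lev m * a (pos m) else 0.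

Let lift_le1 xi m : [set xi | exists2 a, N a <= 1 & xi = lift_fun a] xi ->
  `|xi m| <= 1.
Proof.
move=> [a a1 ->]; rewrite /lift_fun; case: eqP => [lm|_]; last by rewrite normr0.
have [->|a0] := eqVneq (a (pos m)) 0; first by rewrite mulr0 normr0.
have : 0 < `|a (pos m)| <= 1.
  by rewrite normr_gt0 a0/= (le_trans _ a1)// ln_coord.
move=> /dyadic_levelP; rewrite -lm => /andP[_ h].
rewrite normrM ger0_norm ?exprn_ge0// (le_trans (ler_wpM2l _ h)) ?exprn_ge0//.
by rewrite divff// expf_neq0.
Qed.

Definition lift_gauge : gauge R := Gauge lift_le1 t01.
Local Notation g := lift_gauge.
Local Notation P := (gspace lift_gauge).

Definition lift (a : C) : P :=
  \sum_(n < bnd a) (2 ^+ dyadic_level `|a n| * a n) *: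
     gunit g (f' (nat_of_ord n, dyadic_level `|a n|)).

Lemma liftE a m : lift a m = lift_fun a m.
Proof.
rewrite /lift gsumE /lift_fun.
rewrite (eq_bigr (fun n : 'I_(bnd a) =>
    if nat_of_ord n == pos m then lift_fun a m else 0)); last first.
  move=> n _.
  rewrite -[LHS]/((2 ^+ dyadic_level `|a n| * a n) *
     gunit g (f' (nat_of_ord n, dyadic_level `|a n|)) m) gunitE /lift_fun.
  have -> : (m == f' (nat_of_ord n, dyadic_level `|a n|)) =
            (nat_of_ord n == pos m) && (lev m == dyadic_level `|a n|).
    rewrite -(can_eq fK m) f'K.
    by rewrite [f m]surjective_pairing xpair_eqE [pos m == _]eq_sym.
  case: eqP => [<-|_] /=; last by rewrite mulr0.
  by case: eqP => [->|_]; rewrite ?mulr1// mulr0.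
rewrite -big_mkcond/=.
have [pm|pm] := ltnP (pos m) (bnd a); first by rewrite (big_pred1 (Ordinal pm)).
rewrite big1 => [|i /eqP ip]; first by rewrite (bndP pm) mulr0 if_same.
by have := ltn_ord i; rewrite ip ltnNge pm.
Qed.

Lemma lift_norm a : N a <= 1 -> `|lift a| <= 2.
Proof.
move=> a1; apply: gspace_norm_le => i M eta ts.
have /andP[h1 h2] := tests_factor ts.
rewrite -[leRHS]mulr1; apply: ler_pM => //; first by rewrite (le_trans ler01).
  exact: sumr_ge0.
have [_ _ hW _] := ts.
apply: (@le_trans _ _ (t ^+ i)).
  rewrite (le_trans _ (hW (lift_fun a) _))//; last by exists a.
  by apply: ler_sum => m _; rewrite liftE.
by case/andP: t01 => t0 t1; rewrite exprn_ile1// ltW.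
Qed.

(** Distinct indices satisfying [Q] have distinct positions, so the sum is
    dominated by a part of the sum that defines [pair b y]. *)
Lemma fiber_sum (y : C) (b : nat -> R) (G : nat -> R) (Q : pred nat) M :
  (forall n, 0 <= b n * y n) ->
  (forall m m', Q m -> Q m' -> pos m = pos m' -> m = m') ->
  (forall m, Q m -> G m <= b (pos m) * y (pos m)) ->
  \sum_(m < M | Q m) G m <= pair b y.
Proof.
move=> by0 Qinj Gle; apply: (@le_trans _ _ (\sum_(m < M | Q m) b (pos m) * y (pos m))).
  by apply: ler_sum => m Qm; exact: Gle.
rewrite -(big_mkord Q (fun m => b (pos m) * y (pos m))).
rewrite -big_filter -(big_map pos xpredT (fun n => b n * y n)).
set s := map pos _.
have us : uniq s.
  rewrite map_inj_in_uniq ?filter_uniq ?iota_uniq// => m m'.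
  by rewrite !mem_filter => /andP[Qm _] /andP[Qm' _]; exact: Qinj.
rewrite (bigID (fun n => (n < bnd y)%N))/= [X in _ + X]big1 ?addr0; last first.
  by move=> n; rewrite -leqNgt => /bndP ->; rewrite mulr0.
rewrite -big_filter.
have -> : \sum_(n <- [seq n <- s | (n < bnd y)%N]) b n * y n =
    \sum_(n <- [seq n <- iota 0 (bnd y) | n \in s]) b n * y n.
  apply: perm_big; apply: uniq_perm; rewrite ?filter_uniq ?iota_uniq// => n.
  by rewrite !mem_filter mem_iota add0n andbC.
rewrite big_filter /pair -(big_mkord xpredT (fun n => b n * y n)) /index_iota subn0.
rewrite big_mkcond/=; apply: ler_sum => n _; case: ifP => // _; exact: by0.
Qed.

(* The division by [t ^+ 2] compensates for the dyadic level that is lost in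
   [small_class]. *)
Let D0 : R := Num.max 2 (Num.max 1 (2 * K / t ^+ 2) / t ^+ 2).

Section Norming.
Variables (c : C) (b : nat -> R).
Hypotheses (c1 : N c <= 1) (b0 : forall n, 0 <= b n).
Hypotheses (bc : pair b (cabs c) = 1) (bN : forall a, pair b (cabs a) <= N a).
Let k n := dyadic_level `|c n|.

Let k_le n : c n != 0 -> 2 ^- (k n).+1 < `|c n| <= 2 ^- k n.
Proof.
by move=> cn; apply: dyadic_levelP; rewrite normr_gt0 cn (le_trans _ c1)// ln_coord.
Qed.

Let t0 : 0 < t. Proof. by case/andP: t01. Qed.
Let t1 : t < 1. Proof. by case/andP: t01. Qed.
Let D02 : 2 <= D0. Proof. by rewrite le_max lexx. Qed.
Let D00 : 0 < D0. Proof. by rewrite (lt_le_trans _ D02). Qed.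

Let small_class (a : C) (A : set nat) i : N a <= 1 ->
  (forall n, A n -> c n != 0 /\ exists2 j, k n = (j + i)%N & 2 ^- j.+1 < `|a n|) ->
  pair b (crestr A (cabs a)) <= D0 * t ^+ (2 * i).
Proof.
move=> a1 Aa; case: i Aa => [|i] Aa.
  rewrite muln0 expr0 mulr1 (le_trans _ D02)// (le_trans _ (ler1n R 2))//.
  apply: le_trans a1; apply: le_trans (bN a); apply: pair_le => n.
  by rewrite crestrE; case: ifP => _; rewrite ?lexx// mulr0 mulr_ge0// cabsE.
have Aa' n : A n -> 2 ^+ i * `|c n| <= `|a n|.
  move=> An; have [/k_le /andP[_ ck] [j kj ja]] := Aa n An.
  rewrite (le_trans _ (ltW ja))// (le_trans (ler_wpM2l _ ck)) ?exprn_ge0//.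
  rewrite kj -addSnnS exprD; set u := _ ^+ i; set v := _ ^+ j.+1.
  by have -> : u / (v * u) = v^-1 by field; rewrite !expf_neq0.
apply: (le_trans (norming_small latN t01 smN c1 b0 bc bN a1 Aa')).
rewrite mulnS exprD mulrA.
have ti : 0 <= t ^+ (2 * i) by rewrite exprn_ge0// ltW.
rewrite ler_wpM2r// -ler_pdivrMr ?exprn_gt0//.
by rewrite le_max lexx orbT.
Qed.

(* The coordinates whose level lies [i] below the dyadic level of [c] at their
   position, and those whose level exceeds it by [d.+1].  In each class a
   position occurs at most once. *)
Let Qc i m := (c (pos m) != 0) && (k (pos m) == lev m + i)%N.
Let Qd d m := (c (pos m) != 0) && (lev m == k (pos m) + d.+1)%N.

Let Qc_inj i m m' : Qc i m -> Qc i m' -> pos m = pos m' -> m = m'.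
Proof.
move=> /andP[_ /eqP h] /andP[_ /eqP h'] pm; apply: pos_inj => //.
by move: h h'; rewrite pm => -> /eqP; rewrite eqn_add2r => /eqP.
Qed.

Let Qd_inj i m m' : Qd i m -> Qd i m' -> pos m = pos m' -> m = m'.
Proof.
by move=> /andP[_ /eqP h] /andP[_ /eqP h'] pm; apply: pos_inj => //; rewrite h h' pm.
Qed.

Let pow2_le n : c n != 0 -> 2 ^- k n <= 2 * `|c n|.
Proof.
move=> /k_le /andP[h _]; have := ltW h; rewrite exprS invfM => h'.
by rewrite -ler_pdivrMl.
Qed.

(** Here the weight [2 ^- lev m] is at most [2 ^- d] times the modulus of [c]. *)
Let deep_class (x : P) M d :
  \sum_(m < M | Qd d m) b (pos m) * 2 ^- lev m * `|x m| <= `|x| * 2 ^- d.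
Proof.
apply: (@le_trans _ _ (\sum_(m < M | Qd d m) `|x| * (b (pos m) * 2 ^- lev m))).
  apply: ler_sum => m _; rewrite mulrC ler_wpM2r ?gspace_coord//.
  by rewrite mulr_ge0// invr_ge0 exprn_ge0.
rewrite -mulr_sumr ler_wpM2l//.
rewrite [leRHS](_ : _ = pair b (2 ^- d *: cabs c)); last by rewrite pairZ bc mulr1.
apply: (@fiber_sum _ _ (fun m => b (pos m) * 2 ^- lev m) (Qd d)) => [n||m].
- by rewrite c00Z cabsE !mulr_ge0// invr_ge0 exprn_ge0.
- exact: Qd_inj.
- move=> /andP[cm /eqP ->]; rewrite ler_wpM2l// c00Z cabsE.
  rewrite exprD invfM mulrC exprS invfM [2^-1 * _]mulrC -mulrA.
  rewrite ler_wpM2l ?invr_ge0 ?exprn_ge0//.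
  by rewrite ler_pdivrMl// pow2_le.
Qed.

(* The part of the norming functional that belongs to the class [i], scaled to
   the size of a test sequence of level [i]; [eta] has the entries rounded down
   to dyadic numbers. *)
Let theta i M m : R :=
  if (m < M)%N && Qc i m then b (pos m) * 2 ^- lev m / (D0 * t ^+ i) else 0.

Let eta i M m : R := (Num.truncn (2 ^+ m * theta i M m))%:R / 2 ^+ m.

Let theta_ge0 i M m : 0 <= theta i M m.
Proof.
rewrite /theta; case: ifP => // _.
by rewrite !mulr_ge0// ?invr_ge0 ?mulr_ge0 ?exprn_ge0 ?(ltW D00) ?(ltW t0).
Qed.

Let eta_itv i M m : 0 <= eta i M m <= theta i M m /\
  theta i M m <= eta i M m + 2 ^- m.
Proof.
have p0 : 0 < 2 ^+ m :> R by rewrite exprn_gt0.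
have h0 : 0 <= 2 ^+ m * theta i M m by rewrite mulr_ge0 ?(ltW p0).
have /andP[h1 h2] := truncn_itv h0.
split; first by rewrite /eta divr_ge0 ?(ltW p0)//= ler_pdivrMr// [leRHS]mulrC.
rewrite /eta -[X in _ + X]mul1r -mulrDl ler_pdivlMr// [leLHS]mulrC.
by apply: ltW; rewrite natr1.
Qed.

Let Dt0 i : 0 < D0 * t ^+ i. Proof. by rewrite mulr_gt0// exprn_gt0. Qed.

Let theta_sum i M (F : nat -> R) : \sum_(m < M) theta i M m * F m =
  (\sum_(m < M | Qc i m) b (pos m) * 2 ^- lev m * F m) / (D0 * t ^+ i).
Proof.
rewrite mulr_suml [RHS]big_mkcond/=; apply: eq_bigr => m _.
rewrite /theta ltn_ord/=; case: ifP => _; last by rewrite mul0r.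
by rewrite mulrAC.
Qed.

(** This is where smoothness enters: by [small_class] the functional is of order
    [t ^+ (2 * i)] on lifts, and the scaling leaves [t ^+ i] of it. *)
Let eta_tests i M : tests g i M (eta i M).
Proof.
have eta0 m : 0 <= eta i M m by case: (eta_itv i M m) => /andP[].
have etale m : eta i M m <= theta i M m by case: (eta_itv i M m) => /andP[].
split.
- apply: (@le_trans _ _ (\sum_(m < M) theta i M m * 1)).
    by apply: ler_sum => m _; rewrite ger0_norm// mulr1.
  rewrite (theta_sum i M (fun=> 1)) ler_pdivrMr//.
  apply: (@le_trans _ _ (2 ^+ i.+1)).
    rewrite [leRHS](_ : _ = pair b (2 ^+ i.+1 *: cabs c)); last by rewrite pairZ bc mulr1.
    apply: (@fiber_sum _ _ (fun m => b (pos m) * 2 ^- lev m * 1) (Qc i)) => [n||m].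
    - by rewrite c00Z cabsE !mulr_ge0// exprn_ge0.
    - exact: Qc_inj.
    - move=> /andP[cm /eqP km]; rewrite mulr1 ler_wpM2l// c00Z cabsE exprSr -mulrA.
      have -> : 2 ^- lev m = 2 ^+ i * 2 ^- k (pos m) :> R.
        rewrite km exprD; set u := _ ^+ i; set w := _ ^+ lev m.
        by field; rewrite !expf_neq0.
      by rewrite ler_wpM2l ?exprn_ge0// pow2_le.
  rewrite /scale expr_div_n.
  have -> : 2 ^+ i / t ^+ i * (D0 * t ^+ i) = D0 * 2 ^+ i :> R.
    by field; rewrite expf_neq0// gt_eqF.
  by rewrite exprS ler_wpM2r// exprn_ge0.
- move=> m; split; last first.
    by rewrite /eta /theta ltnNge => -> /=; rewrite mulr0 truncn0 mul0r.
  rewrite ger0_norm// (le_trans (etale m))// /theta.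
  case: ifP => [/andP[_ /andP[cm /eqP km]]|_]; last by rewrite exprn_ge0// ltW.
  rewrite ler_pdivrMr// mulrCA -exprD addnn -mul2n.
  have := @small_class (2 ^- lev m *: cdelta R (pos m)) [set pos m] i.
  have -> : pair b (crestr [set pos m] (cabs (2 ^- lev m *: cdelta R (pos m)))) =
      b (pos m) * 2 ^- lev m.
    rewrite [RHS]mulrC -(pair_delta b (pos m)) -pairZ; apply: pair_eq => n; congr (_ * _).
    rewrite crestrE cabsE !c00Z cdeltaE; have [->|nm] := eqVneq n (pos m).
      by rewrite mem_set// mulr1 ger0_norm// invr_ge0 exprn_ge0.
    by rewrite memNset ?mulr0//; apply/eqP.
  apply.
    by rewrite (lnZ latN) (ln_delta latN) mulr1 ger0_norm ?invr_ge0 ?exprn_ge0//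
      invf_le1 ?exprn_gt0// exprn_ege1// ler1n.
  move=> _ ->; split=> //; exists (lev m) => //.
  rewrite c00Z cdeltaE eqxx mulr1 ger0_norm ?invr_ge0 ?exprn_ge0//.
  by rewrite ltf_pV2 ?posrE ?exprn_gt0// ltr_eXn2l ?ltr1n.
- move=> _ [a a1 ->].
  apply: (@le_trans _ _ (\sum_(m < M) theta i M m * `|lift_fun a m|)).
    by apply: ler_sum => m _; rewrite normrM ger0_norm// ler_wpM2r.
  rewrite (theta_sum i M (fun m => `|lift_fun a m|)) ler_pdivrMr// mulrCA -exprD addnn -mul2n.
  pose A := [set n | [/\ c n != 0, a n != 0 & k n = (dyadic_level `|a n| + i)%N]].
  apply: le_trans (@small_class a A i a1 _); last first.
    move=> n [cn an kn]; split=> //; exists (dyadic_level `|a n|) => //.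
    have /dyadic_levelP/andP[] // : 0 < `|a n| <= 1.
    by rewrite normr_gt0 an (le_trans _ a1)// ln_coord.
  apply: (@fiber_sum _ _ (fun m => b (pos m) * 2 ^- lev m * `|lift_fun a m|) (Qc i)) => [n||m].
  - by rewrite mulr_ge0// crestrE cabsE; case: ifP.
  - exact: Qc_inj.
  - move=> /andP[cm /eqP km]; rewrite /lift_fun.
    have [am|am] := eqVneq (a (pos m)) 0.
      rewrite am mulr0 if_same normr0 mulr0 mulr_ge0// crestrE cabsE.
      by case: ifP.
    case: eqP => [lm|_]; last first.
      by rewrite normr0 mulr0 mulr_ge0// crestrE cabsE; case: ifP.
    rewrite crestrE mem_set; last by split=> //; rewrite -lm.
    rewrite cabsE normrM ger0_norm ?exprn_ge0// mulrA mulfVK// expf_neq0//.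
- by move=> m; exists (Posz (Num.truncn (2 ^+ m * theta i M m))).
Qed.

(** Rounding costs at most [2 ^- m] in the coordinate [m]. *)
Let class_bound (x : P) M i :
  \sum_(m < M | Qc i m) b (pos m) * 2 ^- lev m * `|x m| <=
  3 * D0 * `|x| * t ^+ i.
Proof.
suff : \sum_(m < M) theta i M m * `|x m| <= 3 * `|x|.
  rewrite (theta_sum i M (fun m => `|x m|)) ler_pdivrMr// => /le_trans; apply.
  by rewrite le_eqVlt; apply/orP; left; apply/eqP; ring.
apply: (@le_trans _ _ (\sum_(m < M) (`|eta i M m * x m| + `|x| * 2 ^- m))).
  apply: ler_sum => m _; have [/andP[e0 e1] e2] := eta_itv i M m.
  apply: (@le_trans _ _ ((eta i M m + 2 ^- m) * `|x m|)); first exact: ler_wpM2r.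
  rewrite mulrDl normrM (ger0_norm e0) lerD2l [leLHS]mulrC.
  by apply: ler_wpM2r; [rewrite invr_ge0 exprn_ge0|exact: gspace_coord].
rewrite big_split/= -mulr_sumr.
have -> : 3 * `|x| = `|x| + `|x| * 2 by ring.
apply: lerD; last by apply: ler_wpM2l => //; exact: half_geometric.
rewrite (le_trans _ (gspace_ub x (eta_tests i M)))// /val.
rewrite -[leLHS]mul1r ler_wpM2r ?sumr_ge0//.
by case/andP: (tests_factor (eta_tests i M)).
Qed.

Let geo_t n : \sum_(i < n) t ^+ i <= (1 - t)^-1.
Proof.
have h : 0 < 1 - t by rewrite subr_gt0.
rewrite -[leRHS]mul1r ler_pdivlMr//.
suff -> : (\sum_(i < n) t ^+ i) * (1 - t) = 1 - t ^+ n.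
  by rewrite gerBl exprn_ge0// ltW.
elim: n => [|n IH]; first by rewrite big_ord0 mul0r expr0 subrr.
by rewrite big_ord_recr/= mulrDl IH exprS; ring.
Qed.

(** The classes cover all coordinates, and their bounds form geometric series. *)
Lemma norming_sum_bound (x : P) M :
  \sum_(m < M | c (pos m) != 0) b (pos m) * 2 ^- lev m * `|x m| <=
  (3 * D0 / (1 - t) + 2) * `|x|.
Proof.
pose w m := b (pos m) * 2 ^- lev m * `|x m|.
have w0 m : 0 <= w m by rewrite !mulr_ge0// invr_ge0 exprn_ge0.
pose I := (\sum_(m < M) (k (pos m) + lev m)).+1.
apply: (@le_trans _ _ (\sum_(i < I) \sum_(m < M | Qc i m) w m +
                       \sum_(d < I) \sum_(m < M | Qd d m) w m)).
  under [X in _ <= X + _]eq_bigr do rewrite big_mkcond.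
  under [X in _ <= _ + X]eq_bigr do rewrite big_mkcond.
  rewrite exchange_big [X in _ <= _ + X]exchange_big -big_split/= big_mkcond/=.
  apply: ler_sum => m _; case: ifP => [cm|_]; last first.
    by apply: addr_ge0; apply: sumr_ge0 => i _; case: ifP.
  have mI : (k (pos m) + lev m < I)%N.
    by rewrite ltnS (bigD1 m)//= leq_addr.
  have [kl|lk] := leqP (lev m) (k (pos m)).
    have iI : (k (pos m) - lev m < I)%N.
      by rewrite (leq_ltn_trans _ mI)// (leq_trans (leq_subr _ _))// leq_addr.
    rewrite (bigD1 (Ordinal iI))//= {1}/Qc cm subnKC// eqxx/= -addrA lerDl.
    by rewrite addr_ge0//; apply: sumr_ge0 => i _; case: ifP.
  have dI : ((lev m - k (pos m)).-1 < I)%N.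
    rewrite (leq_ltn_trans _ mI)// (leq_trans (leq_pred _))//.
    by rewrite (leq_trans (leq_subr _ _))// leq_addl.
  rewrite [X in _ + X](bigD1 (Ordinal dI))//= {1}/Qd cm prednK ?subn_gt0//.
  rewrite subnKC ?(ltnW lk)// eqxx/= addrCA lerDl.
  by rewrite addr_ge0//; apply: sumr_ge0 => i _; case: ifP.
rewrite mulrDl lerD//.
  apply: (@le_trans _ _ (\sum_(i < I) 3 * D0 * `|x| * t ^+ i)).
    by apply: ler_sum => i _; exact: class_bound.
  rewrite -mulr_sumr [leRHS]mulrAC; apply: ler_wpM2l; last exact: geo_t.
  by rewrite !mulr_ge0// ltW.
apply: (@le_trans _ _ (\sum_(d < I) `|x| * 2 ^- d)).
  by apply: ler_sum => i _; exact: deep_class.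
rewrite -mulr_sumr mulrC ler_wpM2r//.
exact: half_geometric.
Qed.

End Norming.

(** The partial sums of the quotient map at [x], written in [c00]. *)
Definition flat (x : P) M : C :=
  \sum_(m < M) (x m * 2 ^- lev m) *: cdelta R (pos m).

Lemma flat_bound (x : P) M : N (flat x M) <= (3 * D0 / (1 - t) + 2) * `|x|.
Proof.
set z := flat x M.
have [z0|z0] := eqVneq (N z) 0.
  rewrite z0 mulr_ge0// addr_ge0// mulr_ge0 ?invr_ge0 ?mulr_ge0//.
    by rewrite (@le_trans _ _ 2)// le_max lexx.
  by case/andP: t01 => _ t1; rewrite subr_ge0 ltW.
have zN : 0 < N z by rewrite lt_neqAle eq_sym z0 ln_ge0.
have [b [b0 bz bN]] := norming_functional latN z.
pose c := (N z)^-1 *: z.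
have c1 : N c <= 1 by rewrite (lnZ latN) normfV ger0_norm ?mulVf// ltW.
have bc : pair b (cabs c) = 1.
  transitivity (pair b ((N z)^-1 *: cabs z)); last by rewrite pairZ bz mulVf.
  apply: pair_eq => n; congr (_ * _).
  by rewrite c00Z !cabsE c00Z normrM normfV (gtr0_norm zN).
have := norming_sum_bound c1 b0 bc bN x M; apply: le_trans.
pose b' n := if c n != 0 then b n else 0.
have -> : N z = pair b' (cabs z).
  rewrite -bz; apply: pair_eq => n; rewrite /b' cabsE c00Z.
  have [->|zn] := eqVneq (z n) 0; first by rewrite normr0 !mulr0.
  by rewrite mulf_neq0// invr_eq0.
pose z' : C := \sum_(m < M) (`|x m| * 2 ^- lev m) *: cdelta R (pos m).
apply: (@le_trans _ _ (pair b' z')).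
  apply: pair_le => n; rewrite cabsE ler_wpM2l//.
    by rewrite /b'; case: ifP.
  rewrite /z /flat /z' !c00sum (le_trans (ler_norm_sum _ _ _))//.
  apply: ler_sum => m _; rewrite !c00Z cdeltaE !normrM normr_nat.
  by rewrite [X in _ * X * _]ger0_norm// invr_ge0 exprn_ge0.
rewrite /z' pair_sum [leRHS]big_mkcond/=; apply: ler_sum => m _.
rewrite pairZ pair_delta /b'; case: ifP => _; last by rewrite mulr0.
by rewrite le_eqVlt; apply/orP; left; apply/eqP; ring.
Qed.

Section Quotient.
Variables (Z : completeNormedModType R) (e : nat -> Z) (C1 C2 : R).
Hypothesis (eN : forall a, `|synth e a| <= C1 * N a).
Hypothesis (Ne : forall a, N a <= C2 * `|synth e a|).
Hypothesis (edense : forall z d, 0 < d -> exists a, `|z - synth e a| <= d).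

Lemma gauge_quotient : quotient_of_polyhedral Z.
Proof.
exists P; split; first exact: gspace_polyhedral.
  by exists (gunit g); exact: gspace_basis.
pose v m := 2 ^- lev m *: e (pos m).
have vE (x : P) M : \sum_(m < M) x m *: v m = synth e (flat x M).
  rewrite /flat linear_sum; apply: eq_bigr => m _.
  by rewrite [RHS]linearZ/= synth_delta /v scalerA.
pose K0 : R := `|C1| * (3 * D0 / (1 - t) + 2).
have [|T [Tle Tv]] := @gspace_extension R g Z v K0.
  move=> x M; rewrite vE (le_trans (eN _))// /K0 -[leRHS]mulrA.
  apply: (@le_trans _ _ (`|C1| * N (flat x M))).
    by rewrite ler_wpM2r ?ln_ge0// ler_norm.
  by rewrite ler_wpM2l// flat_bound.
have Tlift a : T (lift a) = synth e a.
  rewrite /lift linear_sum /synth; apply: eq_bigr => n _.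
  rewrite linearZ/= Tv /v /lev /pos f'K/= scalerA; congr (_ *: _).
  by field; rewrite expf_neq0.
apply: (@lift_quotient _ _ _ T K0 (4 * `|C2|)) => //.
move=> z; have [->|z0] := eqVneq z 0.
  by exists 0; rewrite linear0 subrr !normr0 mul0r mulr0 lexx.
have nz : 0 < `|z| by rewrite normr_gt0.
have [a za] := edense z (divr_gt0 nz (@ltr0Sn R 1)).
have Sa : `|synth e a| <= 2 * `|z|.
  rewrite -[synth e a](subKr z) (le_trans (ler_normB _ _))//.
  by move: za; have := nz; lra.
have Na : N a <= 2 * `|C2| * `|z|.
  rewrite (le_trans (Ne a))// (@le_trans _ _ (`|C2| * `|synth e a|))//.
    by rewrite ler_wpM2r// ler_norm.
  have -> : 2 * `|C2| * `|z| = `|C2| * (2 * `|z|) by ring.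
  exact: ler_wpM2l.
have [N0|N0] := eqVneq (N a) 0.
  exists 0; rewrite linear0 subr0 normr0 mulr_ge0// ?mulr_ge0//; split=> //.
  have Sa0 : synth e a = 0.
    by apply/eqP; rewrite -normr_le0 (le_trans (eN a))// N0 mulr0.
  by move: za; rewrite Sa0 subr0.
have Np : 0 < N a by rewrite lt_neqAle eq_sym N0 ln_ge0.
exists (N a *: lift ((N a)^-1 *: a)); split.
  by rewrite linearZ/= Tlift [synth e (_ *: _)]linearZ/= scalerA divff// scale1r.
rewrite normrZ ger0_norm ?ln_ge0//.
rewrite (@le_trans _ _ (N a * 2))//.
  rewrite ler_wpM2l ?ln_ge0// lift_norm// (lnZ latN) normfV ger0_norm ?ln_ge0//.
  by rewrite mulVf.
by have := Na; lra.
Qed.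

End Quotient.
End SmoothLatticeQuotient.

Theorem smooth_lattice_quotient (R : realType) (N : c00 R -> R) (K t : R)
    (Z : completeNormedModType R) (e : nat -> Z) (C1 C2 : R) :
  lattice_norm N -> 0 < t < 1 -> disjoint_smooth N K t ->
  (forall a, `|synth e a| <= C1 * N a) -> (forall a, N a <= C2 * `|synth e a|) ->
  (forall z d, 0 < d -> exists a, `|z - synth e a| <= d) ->
  quotient_of_polyhedral Z.
Proof.
move=> latN t01 sm h1 h2 h3; have [f [f' [fK f'K]]] := nat_pair_bijection.
exact: (gauge_quotient latN t01 sm fK f'K h1 h2 h3).
Qed.

(** * Power estimates and sums of copies of [c0] *)

Section PowerEstimate.
Variables (R : realType).

Lemma powRK (p s : R) : 0 < p -> 0 <= s -> (s `^ p^-1) `^ p = s.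
Proof. by move=> p0 s0; rewrite -powRrM mulVf ?gt_eqF// powRr1. Qed.

Lemma powRVK (p s : R) : 0 < p -> 0 <= s -> (s `^ p) `^ p^-1 = s.
Proof. by move=> p0 s0; rewrite -powRrM mulfV ?gt_eqF// powRr1. Qed.

Lemma powR_le (p s u : R) : 0 < p -> 0 <= s -> 0 <= u -> s <= u ->
  s `^ p <= u `^ p.
Proof. by move=> p0 s0 u0 su; apply: ge0_ler_powR => //; rewrite ltW. Qed.

Lemma powR_le_inv (p s u : R) : 0 < p -> 0 <= s -> 0 <= u ->
  s `^ p <= u `^ p -> s <= u.
Proof.
move=> p0 s0 u0 su; rewrite -(powRVK p0 s0) -(powRVK p0 u0).
by apply: powR_le; rewrite ?invr_gt0 ?powR_ge0.
Qed.

Lemma le1_powR (r s u : R) : 1 <= r -> 0 <= s -> 0 <= u -> s `^ r <= 1 + u ->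
  s <= 1 + u.
Proof.
move=> r1 s0 u0 h; have [s1|s1] := leP s 1.
  by rewrite (le_trans s1)// lerDl.
apply: le_trans h; rewrite -[leLHS]powRr1//.
by apply: ler_powR => //; exact: ltW.
Qed.

Definition smooth_rate (r : R) : R := 2 `^ ((1 - r) / 2).

Lemma smooth_rate01 r : 1 < r -> 0 < smooth_rate r < 1.
Proof.
move=> r1; rewrite powR_gt0//= /smooth_rate /powR gt_eqF//.
rewrite -[ltRHS]expR0 ltr_expR pmulr_llt0 ?ln_gt0 ?ltr1n//.
by rewrite pmulr_llt0 ?invr_gt0// subr_lt0.
Qed.

Lemma smooth_rateE r i : (2 ^- i) `^ r = 2 ^- i * smooth_rate r ^+ (2 * i).
Proof.
have E k : 2 ^- k = 2 `^ (- k%:R) :> R by rewrite powRN powR_mulrn.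
rewrite -powR_mulrn ?powR_ge0// /smooth_rate !E -!powRrM -powRD; last first.
  by rewrite pnatr_eq0/= implybT.
by congr (_ `^ _); rewrite natrM; field.
Qed.

Definition upper_estimate (N : c00 R -> R) (r : R) : Prop :=
  forall x y : c00 R, (forall n, x n = 0 \/ y n = 0) ->
    N (x + y) `^ r <= N x `^ r + N y `^ r.

Lemma upper_estimate_smooth (N : c00 R -> R) r : lattice_norm N -> 1 < r ->
  upper_estimate N r -> disjoint_smooth N 1 (smooth_rate r).
Proof.
move=> latN r1 up x y i xy x1 y1; have r0 : 0 < r by exact: lt_trans r1.
have p0 : 0 <= 2 ^- i :> R by rewrite invr_ge0 exprn_ge0.
rewrite mul1r -smooth_rateE.
have h : N (x + y) `^ r <= 1 + (2 ^- i) `^ r.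
  apply: (le_trans (up x y xy)); apply: lerD.
    apply: (@le_trans _ _ (1 `^ r)); last by rewrite powR1.
    by apply: powR_le => //; exact: ln_ge0.
  by apply: powR_le => //; exact: ln_ge0.
have [N0 u0] : 0 <= N (x + y) /\ 0 <= (2 ^- i) `^ r.
  by split; [exact: ln_ge0|exact: powR_ge0].
exact: (le1_powR (ltW r1) N0 u0 h).
Qed.

End PowerEstimate.

Section LpSumOfC0.
Variables (R : realType) (p : R) (p1 : 1 < p).

(* The properties of [c0] that matter: coordinates [co] that determine the
   norm as their supremum, and unit vectors spanning a dense subspace. *)
Variables (X : completeNormedModType R) (unit : nat -> X) (co : X -> nat -> R).
Hypothesis co_linear : forall s u v l, co (s *: u + v) l = s * co u l + co v l.
Hypothesis co_unit : forall l k, co (unit l) k = (k == l)%:R.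
Hypothesis co_le : forall w l, `|co w l| <= `|w|.
Hypothesis le_co : forall w s, (forall l, `|co w l| <= s) -> `|w| <= s.
Hypothesis unit_dense : forall w d, 0 < d ->
  exists L, `|w - \sum_(l < L) co w l *: unit l| <= d.

Local Notation Z := (lp_sum X (ltW p1)).

Let p0 : 0 < p. Proof. exact: lt_trans p1. Qed.

Let psum_le (u : Z) K : \sum_(k < K) `|u k| `^ p <= `|u| `^ p.
Proof.
have u0 : (0 <= lp_esum p u)%E by exact: lp_esum_ge0.
have ufin : lp_esum p u \is a fin_num by rewrite ge0_fin_numE//; exact: (lpP u).
rewrite -[`|u|]/(lp_norm p u) /lp_norm powRK ?fine_ge0//.
rewrite -lee_fin fineK// -sumEFin -(big_mkord xpredT (fun k => (`|u k| `^ p)%:E)).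
by apply: nneseries_lim_ge => n _; rewrite lee_fin powR_ge0.
Qed.

Let summable_le (u : nat -> X) s : 0 <= s ->
  (forall n, \sum_(k < n) `|u k| `^ p <= s `^ p) -> u \in @p_summable R p X.
Proof.
move=> s0 us; apply: (@le_lt_trans _ _ (s `^ p)%:E); last exact: ltry.
apply: lime_le.
  by apply: is_cvg_nneseries => n _ _; rewrite lee_fin powR_ge0.
by apply: nearW => n; rewrite big_mkord sumEFin lee_fin.
Qed.

Let lp_le (u : Z) s : 0 <= s ->
  (forall n, \sum_(k < n) `|u k| `^ p <= s `^ p) -> `|u| <= s.
Proof.
move=> s0 us; have u0 : (0 <= lp_esum p u)%E by exact: lp_esum_ge0.
have ufin : lp_esum p u \is a fin_num by rewrite ge0_fin_numE//; exact: (lpP u).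
apply: (powR_le_inv p0) => //.
rewrite -[`|u|]/(lp_norm p u) /lp_norm powRK ?fine_ge0//.
rewrite -lee_fin fineK//; apply: lime_le.
  by apply: is_cvg_nneseries => n _ _; rewrite lee_fin powR_ge0.
by apply: nearW => n; rewrite big_mkord sumEFin lee_fin.
Qed.

Let lp_linear s (u v : Z) m : (s *: u + v) m = s *: u m + v m.
Proof. by []. Qed.

Let single_sum (w : X) m n (F : X -> R) : F 0 = 0 ->
  \sum_(k < n) F (if nat_of_ord k == m then w else 0) = if (m < n)%N then F w else 0.
Proof.
move=> F0; rewrite (eq_bigr (fun k : 'I_n => if nat_of_ord k == m then F w else 0)).
  rewrite -big_mkcond/=; case: ltnP => mn; first by rewrite (big_pred1 (Ordinal mn)).
  rewrite big1// => i /eqP im.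
  by have := ltn_ord i; rewrite im ltnNge mn.
by move=> k _; case: eqP.
Qed.

Let single_sum' (w : X) m n :
  \sum_(k < n) (if nat_of_ord k == m then w else 0) = if (m < n)%N then w else 0.
Proof.
rewrite -big_mkcond/=; case: ltnP => mn; first by rewrite (big_pred1 (Ordinal mn)).
by rewrite big1// => i /eqP im; have := ltn_ord i; rewrite im ltnNge mn.
Qed.

Let single_psum m (w : X) n :
  \sum_(k < n) `|if nat_of_ord k == m then w else 0| `^ p <= `|w| `^ p.
Proof.
rewrite (@single_sum w m n (fun u => `|u| `^ p)).
  by case: ifP => _ //; rewrite powR_ge0.
by rewrite normr0 powR0// gt_eqF.
Qed.

Let single m w : Z :=
  LpSum (ltW p1) (@summable_le (fun k => if k == m then w else 0) _
    (normr_ge0 w) (single_psum m w)).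

Let singleE m w k : single m w k = if k == m then w else 0.
Proof. by []. Qed.

Let single_norm m w : `|single m w| = `|w|.
Proof.
apply/le_anti/andP; split.
  by apply: lp_le => // n; exact: single_psum.
apply: (powR_le_inv p0) => //; apply: le_trans (psum_le _ m.+1).
rewrite big_ord_recr/= eqxx lerDr; apply: sumr_ge0 => k _.
exact: powR_ge0.
Qed.

Variables (f : nat -> nat * nat) (f' : nat * nat -> nat).
Hypotheses (fK : cancel f f') (f'K : cancel f' f).

Let e k : Z := single (f k).1 (unit (f k).2).

Let co0 l : co 0 l = 0.
Proof.
by have := co_linear 1 0 0 l; rewrite scale1r addr0 mul1r => /eqP;
   rewrite -subr_eq0 opprD addNKr oppr_eq0 => /eqP.
Qed.

Let zco (u : Z) m l := co (u m) l.

Let zco_linear s (u v : Z) m l : zco (s *: u + v) m l = s * zco u m l + zco v m l.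
Proof. by rewrite /zco lp_linear co_linear. Qed.

Let zco0 m l : zco 0 m l = 0.
Proof.
by have := zco_linear 1 0 0 m l; rewrite scale1r addr0 mul1r => /eqP;
   rewrite -subr_eq0 opprD addNKr oppr_eq0 => /eqP.
Qed.

Let zcoD (u v : Z) m l : zco (u + v) m l = zco u m l + zco v m l.
Proof. by rewrite -[u]scale1r zco_linear mul1r scale1r. Qed.

Let zcoZ s (u : Z) m l : zco (s *: u) m l = s * zco u m l.
Proof. by rewrite -[s *: u]addr0 zco_linear zco0 addr0. Qed.

Let zco_e k m l : zco (e k) m l = (k == f' (m, l))%:R.
Proof.
have -> : (k == f' (m, l)) = (m == (f k).1) && (l == (f k).2).
  rewrite -(can_eq fK) f'K [f k]surjective_pairing xpair_eqE.
  by rewrite eq_sym [_ == l]eq_sym.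
by rewrite /zco /e singleE; case: eqP => _; rewrite ?co0// co_unit.
Qed.

Let synth_coord a m l : zco (synth e a) m l = a (f' (m, l)).
Proof.
have zsum (I : Type) (r : seq I) (F : I -> Z) :
    zco (\sum_(k <- r) F k) m l = \sum_(k <- r) zco (F k) m l.
  elim: r => [|k r IH]; first by rewrite !big_nil zco0.
  by rewrite !big_cons zcoD IH.
rewrite /synth zsum.
rewrite (eq_bigr (fun k : 'I_(bnd a) =>
    if nat_of_ord k == f' (m, l) then a (f' (m, l)) else 0)); last first.
  move=> k _; rewrite zcoZ zco_e.
  by case: eqP => [->|_]; rewrite ?mulr1// mulr0.
rewrite -big_mkcond/=.
have [pm|pm] := ltnP (f' (m, l)) (bnd a); first by rewrite (big_pred1 (Ordinal pm)).
rewrite big1 => [|i /eqP ip]; first by rewrite bndP.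
by have := ltn_ord i; rewrite ip ltnNge pm.
Qed.

Let N a : R := `|synth e a|.

Let N_lattice : lattice_norm N.
Proof.
split=> [x y xy|x y|s x|n].
- apply: (@lp_le (synth e x) `|synth e y| (normr_ge0 _)) => n.
  apply: (le_trans _ (psum_le (synth e y) n)); apply: ler_sum => m _.
  apply: (powR_le p0 (normr_ge0 _) (normr_ge0 _)); apply: le_co => l.
  apply: (le_trans _ (co_le (synth e y m) l)).
  by rewrite -/(zco _ m l) -/(zco _ m l) !synth_coord; exact: xy.
- by rewrite /N linearD ler_normD.
- by rewrite /N linearZ normrZ.
- rewrite /N synth_delta /e single_norm; apply/le_anti/andP; split.
    by apply: le_co => l; rewrite co_unit; case: eqP => _; rewrite ?normr1 ?normr0.
  by rewrite (le_trans _ (co_le _ (f n).2))// co_unit eqxx normr1.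
Qed.

(** In each copy of [c0] the norm of a disjoint sum is the maximum of the norms. *)
Let N_upper : upper_estimate N p.
Proof.
move=> x y xy.
have s0 : 0 <= N x `^ p + N y `^ p by rewrite addr_ge0// powR_ge0.
rewrite -[leRHS](powRK p0 s0); apply: powR_le; rewrite ?powR_ge0//.
apply: (@lp_le (synth e (x + y)) _ (powR_ge0 _ _)) => n; rewrite (powRK p0 s0).
apply: le_trans (lerD (psum_le (synth e x) n) (psum_le (synth e y) n)).
rewrite -big_split/=; apply: ler_sum => m _.
have : `|synth e (x + y) m| <= Num.max `|synth e x m| `|synth e y m|.
  apply: le_co => l; rewrite le_max -/(zco _ m l) synth_coord c00D.
  have [h|h] := xy (f' (nat_of_ord m, l)); rewrite h ?add0r ?addr0 -synth_coord.
    by rewrite (co_le (synth e y m)) orbT.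
  by rewrite (co_le (synth e x m)).
rewrite le_max => /orP[h|h].
  by rewrite -[leLHS]addr0 lerD ?powR_ge0//; apply: powR_le.
by rewrite -[leLHS]add0r lerD ?powR_ge0//; apply: powR_le.
Qed.

Let dense z d : 0 < d -> exists a, `|z - synth e a| <= d.
Proof.
move=> d0; have d2 : 0 < d / 2 by rewrite divr_gt0.
have [M hM] : exists M, `|z| `^ p - (d / 2) `^ p <= \sum_(k < M) `|z k| `^ p.
  apply: contrapT => /forallNP h.
  have dp : 0 < (d / 2) `^ p by rewrite powR_gt0.
  pose s := `|z| `^ p - (d / 2) `^ p.
  have hn n : \sum_(k < n) `|z k| `^ p <= s.
    by have /negP := h n; rewrite -ltNge => /ltW.
  have s0 : 0 <= s by have := hn 0%N; rewrite big_ord0.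
  have : `|z| <= s `^ p^-1.
    apply: lp_le; first exact: powR_ge0.
    by move=> n; rewrite powRK.
  move=> /(powR_le p0 (normr_ge0 _) (powR_ge0 _ _)); rewrite powRK// /s.
  by rewrite lerBrDl gerDr leNgt dp.
have /choice[L hL] : forall m : 'I_M, exists L,
    `|z m - \sum_(l < L) co (z m) l *: unit l| <= d / 2 / M.+1%:R.
  by move=> m; apply: unit_dense; rewrite divr_gt0.
pose a := \sum_(m < M) \sum_(l < L m) co (z m) l *: cdelta R (f' (nat_of_ord m, nat_of_ord l)).
have single_lin m : linear (single m).
  move=> s u v; apply/val_inj/funext => k; rewrite [LHS]singleE.
  rewrite -[RHS]/((s *: single m u + single m v) k) lp_linear !singleE.
  by case: eqP => _; rewrite ?scaler0 ?addr0.
exists a.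
have Sa : synth e a = \sum_(m < M) single m (\sum_(l < L m) co (z m) l *: unit l).
  rewrite /a linear_sum; apply: eq_bigr => m _; rewrite linear_sum/=.
  pose SL : {linear X -> Z} :=
    HB.pack (single m) (GRing.isLinear.Build R X Z *:%R (single m) (single_lin m)).
  rewrite -[RHS]/(SL _) linear_sum; apply: eq_bigr => l _.
  by rewrite !linearZ/= synth_delta /e f'K.
rewrite Sa -(subrKA (\sum_(m < M) single m (z m))) (splitr d).
rewrite (le_trans (ler_normD _ _))// lerD//; last first.
  rewrite -sumrB (le_trans (ler_norm_sum _ _ _))//.
  apply: (@le_trans _ _ (\sum_(m < M) d / 2 / M.+1%:R)).
    apply: ler_sum => m _; rewrite (le_trans _ (hL m))//.
    rewrite -(single_norm m) le_eqVlt; apply/orP; left; apply/eqP; congr `|_|.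
    have := single_lin m (-1) (\sum_(l < L m) co (z m) l *: unit l) (z m).
    by rewrite !scaleN1r [in LHS]addrC [in RHS]addrC => ->.
  rewrite sumr_const card_ord -[leLHS]mulr_natr -[leLHS]mulrA ger_pMr//.
  by rewrite mulrC ler_pdivrMr// mul1r ler_nat.
have zM k : (z - \sum_(m < M) single m (z m)) k = if (k < M)%N then 0 else z k.
  rewrite addrC -scaleN1r lp_linear scaleN1r.
  have -> : (\sum_(m < M) single m (z m)) k =
      \sum_(m < M) (if nat_of_ord m == k then z k else 0).
    elim/big_ind2 : _ => // [x1 x2 y1 y2 <- <- //|m _].
    by rewrite singleE eq_sym; case: eqP => // ->.
  rewrite (@single_sum' (z k) k M); case: ltnP => _; first by rewrite addNr.
  by rewrite oppr0 add0r.
move: (z - _) zM => y zM; apply: lp_le => [|n]; first exact: ltW.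
have [nM|/ltnW Mn] := leqP n M.
  rewrite big1 ?powR_ge0// => k _; rewrite zM (leq_trans (ltn_ord k) nM).
  by rewrite normr0 powR0// gt_eqF.
apply: (@le_trans _ _ (`|z| `^ p - \sum_(k < M) `|z k| `^ p)); last by lra.
rewrite lerBrDl; apply: le_trans (psum_le z n).
rewrite -!(big_mkord xpredT (fun k => `|z k| `^ p)).
rewrite -(big_mkord xpredT (fun k => `|y k| `^ p)).
rewrite (@big_cat_nat _ _ _ M 0 n)//= [leRHS](@big_cat_nat _ _ _ M 0 n)//=.
rewrite lerD2l big_nat_cond [X in X + _]big1 ?add0r; last first.
  move=> k; rewrite andbT => /andP[_ kM].
  by rewrite zM kM normr0 powR0// gt_eqF.
apply: ler_sum_nat => k /andP[Mk _].
by rewrite zM ltnNge Mk.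
Qed.

Lemma lp_sum_enumerated : quotient_of_polyhedral Z.
Proof.
apply: (smooth_lattice_quotient (e := e) (C1 := 1) (C2 := 1) N_lattice
  (smooth_rate01 p1) (upper_estimate_smooth N_lattice p1 N_upper)).
- by move=> a; rewrite mul1r.
- by move=> a; rewrite mul1r.
- exact: dense.
Qed.

End LpSumOfC0.

Section C0Coordinates.
Variable R : realType.
Implicit Types w : c0 R.

Lemma c0_coord w l : `|w l| <= `|w|.
Proof. exact: supnorm_ub (c0_bounded w). Qed.

Lemma c0_le w s : (forall l, `|w l| <= s) -> `|w| <= s.
Proof. exact: supnorm_le. Qed.

Lemma c0_unit_subproof l : (fun k => (k == l)%:R) \in @tends_to_0 R.
Proof.
apply/asboolP; apply: cvg_near_cst; exists l.+1 => // k /= lk.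
by rewrite gtn_eqF.
Qed.
Definition c0_unit l : c0 R := C0 (c0_unit_subproof l).

Lemma c0_linear (s : R) w (v : c0 R) l : (s *: w + v) l = s * w l + v l.
Proof. by []. Qed.

Lemma c0_unit_dense w d : 0 < d ->
  exists L, `|w - \sum_(l < L) w l *: c0_unit l| <= d.
Proof.
move=> d0; have /cvgrPdist_le/(_ _ d0)[L _ wL] := c0_cvg w; exists L.
apply: c0_le => l.
have -> : (w - \sum_(l < L) w l *: c0_unit l) l = if (l < L)%N then 0 else w l.
  rewrite addrC -scaleN1r c0_linear.
  have -> : (\sum_(l < L) w l *: c0_unit l) l =
      \sum_(k < L) (if nat_of_ord k == l then w l else 0).
    elim/big_ind2 : _ => // [x1 x2 y1 y2 <- <- //|k _].
    rewrite -[LHS]/(w k * (l == k)%:R) eq_sym.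
    by case: eqP => [->|_]; rewrite ?mulr1 ?mulr0.
  rewrite -big_mkcond/=; case: ltnP => lL.
    by rewrite (big_pred1 (Ordinal lL))// mulN1r addNr.
  rewrite big1 ?mulr0 ?add0r// => i /eqP il.
  by have := ltn_ord i; rewrite il ltnNge lL.
case: ltnP => [_|lL]; first by rewrite normr0 ltW.
by have := wL l lL; rewrite /= sub0r normrN.
Qed.

End C0Coordinates.

Lemma lp_sum_c0_quotient (R : realType) (p : R) (p1 : 1 < p) :
  quotient_of_polyhedral (lp_sum (c0 R) (ltW p1)).
Proof.
have [f [f' [fK f'K]]] := nat_pair_bijection.
exact: (@lp_sum_enumerated R p p1 (c0 R) (@c0_unit R) (fun w l => w l)
  (@c0_linear R) (fun l k => erefl) (@c0_coord R) (@c0_le R)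
  (@c0_unit_dense R) f f' fK f'K).
Qed.

(** * Renorming with an upper estimate of constant one *)

Section Spread.
Variables (R : realType) (N0 : c00 R -> R) (r : R).
Local Notation C := (c00 R).

Definition disjoint (x y : C) : Prop := forall n, x n = 0 \/ y n = 0.

(** [spread s x] says that [x] is a sum of disjoint vectors whose norms have
    [r]-th powers of sum [s]. *)
Inductive spread : R -> C -> Prop :=
| spread_one y : spread (N0 y `^ r) y
| spread_add s t x y : disjoint x y -> spread s x -> spread t y ->
    spread (s + t) (x + y).

Hypothesis latN0 : lattice_norm N0.
Hypothesis r1 : 1 < r.

Let r0 : 0 < r. Proof. exact: lt_trans r1. Qed.

Lemma spread_ge0 s x : spread s x -> 0 <= s.
Proof. by elim=> [y|{}s t {}x y _ _ s0 _ t0]; rewrite ?powR_ge0// addr_ge0. Qed.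

Lemma spread_cmul s x t : spread s x -> (forall n, `|t n| <= 1) ->
  exists2 s', s' <= s & spread s' (cmul t x).
Proof.
move=> sx t1; elim: sx => [y|{}s u {}x y xy _ [s' s's sx] _ [u' u'u sy]].
  exists (N0 (cmul t y) `^ r); last exact: spread_one.
  apply: powR_le => //; try exact: ln_ge0.
  by apply: (ln_mono latN0) => n; rewrite cmulE normrM ler_piMl.
exists (s' + u'); first exact: lerD.
rewrite (_ : cmul t (x + y) = cmul t x + cmul t y); last first.
  by apply: c00_eqP => n; rewrite c00D !cmulE c00D mulrDr.
apply: spread_add => // n.
by case: (xy n) => h; [left|right]; rewrite cmulE h mulr0.
Qed.

Lemma spread_scale s x k : spread s x -> spread (`|k| `^ r * s) (k *: x).
Proof.
elim=> [y|{}s u {}x y xy _ sx _ sy].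
  rewrite -powRM ?ln_ge0// -(lnZ latN0); exact: spread_one.
rewrite mulrDr scalerDr; apply: spread_add => // n.
by case: (xy n) => h; [left|right]; rewrite c00Z h mulr0.
Qed.

Lemma spread_coord s x n : spread s x -> `|x n| `^ r <= s.
Proof.
elim=> [y|{}s u {}x y xy sx hx sy hy].
  by apply: powR_le => //; [exact: ln_ge0|exact: ln_coord].
have := spread_ge0 sx; have := spread_ge0 sy.
rewrite c00D; case: (xy n) => ->; rewrite ?add0r ?addr0 => h1 h2.
  by rewrite (le_trans hy)// lerDr.
by rewrite (le_trans hx)// lerDl.
Qed.

Variable K : R.
Hypothesis K0 : 0 < K.
Hypothesis spreadK : forall s x, spread s x -> s <= 1 -> N0 x <= K.

(** The new norm is the supremum of the functionals that are at most one on all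
    spread vectors of total mass one. *)
Definition polar (b : nat -> R) : Prop :=
  forall s x, spread s x -> s <= 1 -> pair b x <= 1.

Definition renorm (z : C) : R := sup [set pair b z | b in polar].

Lemma pair_mul (b t : nat -> R) (x : C) :
  pair (fun n => b n * t n) x = pair b (cmul t x).
Proof. by apply: pair_eq => n; rewrite cmulE mulrA. Qed.

Lemma polar_mul b t : polar b -> (forall n, `|t n| <= 1) ->
  polar (fun n => b n * t n).
Proof.
move=> pb t1 s x sx s1; rewrite pair_mul.
by have [s' s's sx'] := spread_cmul sx t1; apply: pb sx' (le_trans s's s1).
Qed.

Lemma polar_le b z : polar b -> pair b z <= N0 z.
Proof.
move=> pb; have [N00|Np] := eqVneq (N0 z) 0.
  have z0 : z = 0.
    by apply: c00_eqP => n; apply/eqP; rewrite -normr_le0 -N00 ln_coord.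
  by rewrite z0 pair0 ln0.
have N0p : 0 < N0 z by rewrite lt_neqAle eq_sym Np ln_ge0.
have := pb _ _ (spread_one ((N0 z)^-1 *: z)).
rewrite (lnZ latN0) normfV gtr0_norm// mulVf// powR1 => /(_ (lexx _)).
by rewrite pairZ ler_pdivrMl// mulr1.
Qed.

Lemma polar0 : polar (fun=> 0).
Proof.
by move=> s x _ _; rewrite /pair big1 ?ler01// => n _; rewrite mul0r.
Qed.

Lemma renorm_has_sup z : has_sup [set pair b z | b in polar].
Proof.
split; first by eexists; exists (fun=> 0); [exact: polar0|].
by exists (N0 z) => _ [b pb <-]; exact: polar_le.
Qed.

Lemma renorm_ub b z : polar b -> pair b z <= renorm z.
Proof. by move=> pb; apply: (sup_upper_bound (renorm_has_sup z)); exists b. Qed.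

Lemma renorm_lub z B : (forall b, polar b -> pair b z <= B) -> renorm z <= B.
Proof.
move=> h; apply: ge_sup; first by case: (renorm_has_sup z).
by move=> _ [b pb <-]; exact: h.
Qed.

Lemma renorm_le z : renorm z <= N0 z.
Proof. by apply: renorm_lub => b; exact: polar_le. Qed.

Lemma renorm_ge0 z : 0 <= renorm z.
Proof.
apply: le_trans (renorm_ub z polar0).
by rewrite /pair big1// => n _; rewrite mul0r.
Qed.

Lemma renorm_mono (x y : C) : (forall n, `|x n| <= `|y n|) -> renorm x <= renorm y.
Proof.
move=> xy; apply: renorm_lub => b pb.
pose t n := x n / y n.
have t1 n : `|t n| <= 1.
  have [y0|y0] := eqVneq (y n) 0.
    by rewrite /t y0 invr0 mulr0 normr0.
  by rewrite normrM normfV ler_pdivrMr ?normr_gt0// mul1r.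
have -> : pair b x = pair (fun n => b n * t n) y.
  apply: pair_eq => n; have [y0|y0] := eqVneq (y n) 0.
    have := xy n; rewrite y0 normr0 normr_le0 => /eqP ->.
    by rewrite !mulr0.
  by rewrite /t -mulrA divfK.
by apply: renorm_ub; exact: polar_mul.
Qed.

Lemma renorm_lattice : lattice_norm renorm.
Proof.
have Zle s z : renorm (s *: z) <= `|s| * renorm z.
  apply: renorm_lub => b pb; rewrite pairZ.
  apply: (@le_trans _ _ (`|s| * `|pair b z|)); first by rewrite -normrM ler_norm.
  rewrite ler_wpM2l// ler_norml renorm_ub// andbT.
  rewrite lerNl -pairN -scaleN1r.
  rewrite (_ : pair b (-1 *: z) = pair (fun n => b n * -1) z).
    by apply: renorm_ub; apply: polar_mul => // n; rewrite normrN normr1.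
  by apply: pair_eq => n; rewrite c00Z mulrA.
split=> [x y|x y|s z|n].
- exact: renorm_mono.
- by apply: renorm_lub => b pb; rewrite pairD lerD// renorm_ub.
- apply/le_anti; rewrite Zle/=.
  have [->|s0] := eqVneq s 0; first by rewrite normr0 mul0r renorm_ge0.
  rewrite mulrC -ler_pdivlMr ?normr_gt0// mulrC -normfV.
  by rewrite -[in leLHS](scalerK s0 z) Zle.
- apply/le_anti; rewrite -{1}(ln_delta latN0 n) renorm_le/=.
  have pb : polar (fun k => (k == n)%:R).
    move=> s x sx s1.
    have -> : pair (fun k => (k == n)%:R) x = x n.
      rewrite -[RHS]mul1r -(pair_delta (fun k => x k) n).
      rewrite mul1r; apply/le_anti; rewrite !pair_le// => k; rewrite cdeltaE;
      by rewrite mulrC.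
    rewrite (le_trans (ler_norm _))//; apply: (powR_le_inv r0) => //.
    by rewrite powR1 (le_trans (spread_coord n sx)).
  by apply: le_trans (renorm_ub _ pb); rewrite pair_delta eqxx.
Qed.

(** A nonnegative functional that norms [z] belongs to the polar after division
    by [K]. *)
Lemma renorm_ge z : N0 z <= K * renorm z.
Proof.
have [b [b0 bz bN]] := norming_functional latN0 z.
have pb : polar (fun n => K^-1 * b n).
  move=> s x sx s1; apply: (@le_trans _ _ (K^-1 * pair b (cabs x))).
    rewrite -pairZ; apply: pair_le => n; rewrite c00Z cabsE mulrCA mulrA.
    by rewrite ler_wpM2l ?ler_norm// mulr_ge0// invr_ge0 ltW.
  by rewrite ler_pdivrMl// mulr1 (le_trans (bN x))// (spreadK sx).
have := renorm_ub (cabs z) pb.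
rewrite (_ : pair _ (cabs z) = K^-1 * N0 z); last first.
  by rewrite -bz -pairZ; apply: pair_eq => n; rewrite [in RHS]c00Z; ring.
rewrite ler_pdivrMl// => /le_trans; apply; rewrite ler_pM2l//.
by apply: renorm_mono => n; rewrite cabsE normr_id.
Qed.

(* The norm dual to [renorm] of the restriction of [b] to [A]. *)
Let part b (A : set nat) : R :=
  sup [set pair b u | u in [set u | (exists2 s, s <= 1 & spread s u) /\
                                    forall n, ~ A n -> u n = 0]].

Let part_has_sup b A : polar b ->
  has_sup [set pair b u | u in [set u | (exists2 s, s <= 1 & spread s u) /\
                                    forall n, ~ A n -> u n = 0]].
Proof.
move=> pb; split; last by exists 1 => _ [u [[s s1 su] _] <-]; exact: pb su s1.
exists (pair b 0), 0 => //; split=> //; exists (N0 0 `^ r); last exact: spread_one.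
by rewrite ln0// powR0 ?gt_eqF.
Qed.

Let part_ge0 b A : polar b -> 0 <= part b A.
Proof.
move=> pb; apply: (sup_upper_bound (part_has_sup A pb)); exists 0; last exact: pair0.
split=> //; exists (N0 0 `^ r); last exact: spread_one.
by rewrite ln0// powR0 ?gt_eqF.
Qed.

Let part_le b (A : set nat) (x : C) (e : R) : polar b -> 0 < e -> (forall n, ~ A n -> x n = 0) ->
  pair b x <= (part b A + e) * renorm x.
Proof.
move=> pb e0 xA; have pe : 0 < part b A + e by rewrite ltr_wpDl// part_ge0.
pose b' n := (part b A + e)^-1 * (b n * (n \in A)%:R).
have pb' : polar b'.
  move=> s u su s1.
  have -> : pair b' u = (part b A + e)^-1 * pair b (crestr A u).
    by rewrite -pairZ; apply: pair_eq => n; rewrite c00Z crestrE /b'; case: ifP => _ /=; ring.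
  rewrite ler_pdivrMl// mulr1 (@le_trans _ _ (part b A))//; last by rewrite lerDl ltW.
  apply: (sup_upper_bound (part_has_sup A pb)); exists (crestr A u) => //; split.
    have [s' s's su'] := @spread_cmul s u (fun n => (n \in A)%:R) su
      (fun n => ltac:(by rewrite normr_nat lern1 leq_b1)).
    by exists s' => //; exact: le_trans s's s1.
  by move=> n An; rewrite crestrE memNset.
have := renorm_ub x pb'.
have -> : pair b' x = (part b A + e)^-1 * pair b x.
  rewrite -pairZ; apply: pair_eq => n; rewrite c00Z /b'.
  have [/set_mem An|nA] := boolP (n \in A); first by rewrite mulr1; ring.
  by rewrite xA ?mulr0//; move/negP : nA => + An; apply; exact: mem_set.
by rewrite ler_pdivrMl.
Qed.

(** Spread vectors with disjoint supports can be scaled and added, which gives the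
    conjugate inequality for the two parts of a functional. *)
Let part_sum b (A : set nat) (s t : R) : polar b -> 0 <= s -> 0 <= t -> s `^ r + t `^ r <= 1 ->
  s * part b A + t * part b (~` A) <= 1.
Proof.
move=> pb s0 t0 st.
have uv u v : (exists2 k, k <= 1 & spread k u) -> (forall n, ~ A n -> u n = 0) ->
    (exists2 k, k <= 1 & spread k v) -> (forall n, ~ (~` A) n -> v n = 0) ->
    s * pair b u + t * pair b v <= 1.
  move=> [k k1 ku] uA [l l1 lv] vA; rewrite -!pairZ -pairD.
  apply: (pb (`|s| `^ r * k + `|t| `^ r * l)).
    apply: spread_add; [|exact: spread_scale|exact: spread_scale].
    move=> n; have [An|nA] := pselect (A n).
      by right; rewrite c00Z vA ?mulr0//; apply.
    by left; rewrite c00Z uA ?mulr0.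
  rewrite (le_trans _ st)// !ger0_norm//.
  by apply: lerD; apply: ler_piMr => //; exact: powR_ge0.
suff step (a c : R) (B : set R) : has_sup B -> 0 <= a -> c <= 1 ->
    (forall y, B y -> a * y + c <= 1) -> a * sup B + c <= 1.
  have z1 : exists2 k, k <= 1 & spread k 0.
    by exists (N0 0 `^ r); [rewrite ln0// powR0 ?gt_eqF|exact: spread_one].
  have tv : t * part b (~` A) + 0 <= 1.
    apply: (step _ _ _ (part_has_sup (~` A) pb) t0 ler01).
    move=> _ [v' [kv vA] <-].
    by have := uv 0 v' z1 (fun _ _ => erefl) kv vA; rewrite pair0 mulr0 add0r addr0.
  rewrite addr0 in tv.
  apply: (step _ _ _ (part_has_sup A pb) s0 tv) => _ [u' [ku uA] <-]; rewrite addrC.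
  apply: (step _ _ _ (part_has_sup (~` A) pb) t0) => [|_ [v' [kv vA] <-]].
    by have := uv u' 0 ku uA z1 (fun _ _ => erefl); rewrite pair0 mulr0 addr0.
  by rewrite addrC; exact: uv.
move=> Bs a0 c1 h; have [->|a0'] := eqVneq a 0; first by rewrite mul0r add0r.
have ap : 0 < a by rewrite lt_neqAle eq_sym a0' a0.
rewrite -lerBrDr mulrC -ler_pdivlMr//; apply: ge_sup; first by case: Bs.
by move=> y By; rewrite ler_pdivlMr// mulrC lerBrDr h.
Qed.

Lemma renorm_upper : upper_estimate renorm r.
Proof.
move=> x y xy; pose X := renorm x; pose Y := renorm y.
have S0 : 0 <= X `^ r + Y `^ r by rewrite addr_ge0// powR_ge0.
pose L := (X `^ r + Y `^ r) `^ r^-1.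
have LE : L `^ r = X `^ r + Y `^ r by rewrite powRK.
have X0 : 0 <= X := renorm_ge0 x; have Y0 : 0 <= Y := renorm_ge0 y.
have XL : X <= L by apply: (powR_le_inv r0) => //; rewrite ?powR_ge0// LE lerDl powR_ge0.
have YL : Y <= L by apply: (powR_le_inv r0) => //; rewrite ?powR_ge0// LE lerDr powR_ge0.
rewrite -/X -/Y -LE; apply: powR_le => //; first exact: renorm_ge0.
  exact: powR_ge0.
apply: renorm_lub => b pb.
pose A := [set n | x n <> 0].
have xA n : ~ A n -> x n = 0 by move=> /contrapT.
have yA n : ~ (~` A) n -> y n = 0.
  by move=> /contrapT xn; case: (xy n).
have [L0|L0] := eqVneq L 0.
  have [X00 Y00] : X = 0 /\ Y = 0 by split; apply/le_anti; rewrite ?X0 ?Y0 -L0 ?XL ?YL.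
  rewrite pairD L0.
  have := part_le pb ltr01 xA; have := part_le pb ltr01 yA.
  by rewrite -/X -/Y X00 Y00 !mulr0 => h1 h2; rewrite -[leRHS]addr0 lerD.
have Lp : 0 < L by rewrite lt_neqAle eq_sym L0 powR_ge0.
apply/ler_addgt0Pr => d d0.
pose e := d / (2 * L).
have e0 : 0 < e by rewrite divr_gt0// mulr_gt0.
have h1 := part_le pb e0 xA; have h2 := part_le pb e0 yA.
have h3 : X / L * part b A + Y / L * part b (~` A) <= 1.
  apply: part_sum => //; rewrite ?divr_ge0 ?(ltW Lp)//.
  rewrite !powRM ?invr_ge0 ?(ltW Lp)// -mulrDl -LE -powRM ?invr_ge0 ?(ltW Lp)//.
  by rewrite divff// powR1.
have h4 : X * part b A + Y * part b (~` A) <= L.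
  rewrite -[leRHS]mul1r -ler_pdivrMr// mulrDl mulrAC [Y * _ / _]mulrAC.
  exact: h3.
have h5 : e * (X + Y) <= d.
  apply: (@le_trans _ _ (e * (2 * L))); last by rewrite /e divfK// mulf_neq0.
  by rewrite ler_pM2l//; lra.
rewrite pairD; apply: (le_trans (lerD h1 h2)); rewrite -/X -/Y.
by rewrite !mulrDl; lra.
Qed.

End Spread.

Theorem spread_lattice_quotient (R : realType) (N0 : c00 R -> R) (r K : R)
    (Z : completeNormedModType R) (e : nat -> Z) (C1 C2 : R) :
  lattice_norm N0 -> 1 < r ->
  (forall s x, spread N0 r s x -> s <= 1 -> N0 x <= K) ->
  0 <= C1 ->
  (forall a, `|synth e a| <= C1 * N0 a) -> (forall a, N0 a <= C2 * `|synth e a|) ->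
  (forall z d, 0 < d -> exists a, `|z - synth e a| <= d) ->
  quotient_of_polyhedral Z.
Proof.
move=> latN0 r1 spK C10 eN Ne dens.
have K0 : 0 < K.
  have := spK _ _ (spread_one N0 r (cdelta R 0)).
  by rewrite (ln_delta latN0) powR1 => /(_ (lexx _)); apply: lt_le_trans.
have latN := renorm_lattice latN0 r1.
apply: (smooth_lattice_quotient (e := e) (C1 := C1 * K) (C2 := C2) latN
  (smooth_rate01 r1) (upper_estimate_smooth latN r1 (renorm_upper latN0 r1))) => //.
  move=> a; rewrite (le_trans (eN a))// -mulrA ler_wpM2l//.
  exact: renorm_ge.
by move=> a; rewrite (le_trans _ (Ne a))// renorm_le.
Qed.

(** * The constant of an unconditional basis *)

Section UnconditionalConstant.
Variables (R : realType) (X : completeNormedModType R) (e : nat -> X).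
Hypothesis unc : unconditional_basis e.

Definition coef (x : X) : nat -> R := projT1 (cid (unc.1 x)).

Lemma coef_cvg x : series (fun n => coef x n *: e n) @ \oo --> x.
Proof. by have [] := projT2 (cid (unc.1 x)). Qed.

Lemma coef_unique x a : series (fun n => a n *: e n) @ \oo --> x -> coef x = a.
Proof. by have [_ h /h] := projT2 (cid (unc.1 x)). Qed.

Lemma coef_linear s x y n : coef (s *: x + y) n = s * coef x n + coef y n.
Proof.
suff -> : coef (s *: x + y) = (fun n => s * coef x n + coef y n) by [].
apply: coef_unique.
rewrite (_ : series _ = (fun n => s *: series (fun n => coef x n *: e n) n +
                                  series (fun n => coef y n *: e n) n)).
  by apply: cvgD; [apply: cvgZr; exact: coef_cvg|exact: coef_cvg].
apply/funext => k; rewrite /series/= scaler_sumr -big_split/=.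
by apply: eq_bigr => i _; rewrite scalerDl scalerA.
Qed.

Definition psum (s : seq nat) (x : X) : X := \sum_(n <- s) coef x n *: e n.

Lemma psum_linear s a x y : psum s (a *: x + y) = a *: psum s x + psum s y.
Proof.
rewrite /psum scaler_sumr -big_split/=; apply: eq_bigr => n _.
by rewrite coef_linear scalerDl scalerA.
Qed.

Lemma psumB s x y : psum s (x - y) = psum s x - psum s y.
Proof. by rewrite [x - y]addrC -(scaleN1r y) psum_linear scaleN1r addrC. Qed.

Lemma psum0 s : psum s 0 = 0.
Proof. by rewrite -[X in psum s X](subrr (0 : X)) psumB subrr. Qed.

Lemma psumZ s a x : psum s (a *: x) = a *: psum s x.
Proof. by rewrite -[a *: x]addr0 psum_linear psum0 addr0. Qed.

Definition psum_bounded (B : R) (x : X) : Prop :=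
  forall s, uniq s -> `|psum s x| <= B.

Lemma psum_boundedB B B' x y : psum_bounded B x -> psum_bounded B' y ->
  psum_bounded (B + B') (x - y).
Proof.
by move=> hx hy s us; rewrite psumB (le_trans (ler_normB _ _))// lerD ?hx ?hy.
Qed.

Lemma psum_boundedZ B a x : psum_bounded B x -> psum_bounded (`|a| * B) (a *: x).
Proof. by move=> hx s us; rewrite psumZ normrZ ler_wpM2l// hx. Qed.

(* The lists [L k] are initial segments of one enumeration of the naturals. *)
Section Rearrangement.
Variable L : nat -> seq nat.
Hypothesis Lpre : forall k, exists t, L k.+1 = L k ++ t.
Hypothesis Lperm : forall k, perm_eq (L k) (iota 0 (size (L k))).
Hypothesis Lsize : forall k, (k <= size (L k))%N.

Let Lpre_le j k : (j <= k)%N -> exists t, L k = L j ++ t.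
Proof.
elim: k => [|k IH]; first by rewrite leqn0 => /eqP ->; exists [::]; rewrite cats0.
rewrite leq_eqVlt => /predU1P[->|]; first by exists [::]; rewrite cats0.
rewrite ltnS => /IH[t Lk]; have [u Lk1] := Lpre k.
by exists (t ++ u); rewrite Lk1 Lk catA.
Qed.

Definition rearrange n := nth 0%N (L n.+1) n.
Definition rearrange_inv v := index v (L v.+1).

Lemma rearrangeE k n : (n < size (L k))%N -> rearrange n = nth 0%N (L k) n.
Proof.
move=> nk; rewrite /rearrange; have [|/ltnW] := leqP n.+1 k => /Lpre_le[t ->].
  by rewrite nth_cat Lsize.
by rewrite nth_cat nk.
Qed.

Let Lmem k v : (v < size (L k))%N = (v \in L k).
Proof. by rewrite (perm_mem (Lperm k)) mem_iota add0n. Qed.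

Let Luniq k : uniq (L k).
Proof. by rewrite (perm_uniq (Lperm k)) iota_uniq. Qed.

Lemma rearrange_invE k v : v \in L k -> rearrange_inv v = index v (L k).
Proof.
have vL : v \in L v.+1 by rewrite -Lmem.
move=> vk; rewrite /rearrange_inv; have [|/ltnW] := leqP v.+1 k => /Lpre_le[t ->].
  by rewrite index_cat vL.
by rewrite index_cat vk.
Qed.

Lemma rearrange_bij : bijective rearrange.
Proof.
exists rearrange_inv => [n|v].
  have nk : (n < size (L n.+1))%N by exact: Lsize.
  rewrite (rearrangeE nk) (rearrange_invE (k := n.+1)) ?mem_nth//.
  exact: index_uniq.
have vk : v \in L v.+1 by rewrite -Lmem.
rewrite (rearrange_invE vk) (rearrangeE (k := v.+1)) ?index_mem//.
exact: nth_index.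
Qed.

Lemma rearrange_sum (F : nat -> X) k t : prefix t (L k) ->
  \sum_(0 <= n < size t) F (rearrange n) = \sum_(v <- t) F v.
Proof.
move=> /prefixP[u Lk]; rewrite [RHS](big_nth 0%N); apply: eq_big_nat => n /andP[_ nt].
rewrite (rearrangeE (k := k)) Lk ?nth_cat ?nt//.
by rewrite size_cat (leq_trans nt)// leq_addr.
Qed.

End Rearrangement.

(** If the finite partial sums of some expansion were unbounded, there would be
    blocks of norm at least one arbitrarily far out, and a rearrangement listing
    these blocks consecutively would not converge. *)
Lemma psum_bounded_ex x : exists m : nat, psum_bounded m%:R x.
Proof.
apply: contrapT => /forallNP nb.
have far M : exists s, [/\ uniq s, all (fun n => M <= n)%N s & 1 <= `|psum s x|].
  pose B := \sum_(n < M) `|coef x n *: e n| + 1.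
  have /existsNP[s /not_implyP[us /negP]] := nb (Num.truncn B).+1.
  rewrite -ltNge => hs; exists [seq n <- s | (M <= n)%N].
  rewrite filter_uniq// filter_all; split=> //.
  have -> : psum [seq n <- s | (M <= n)%N] x =
      psum s x - psum [seq n <- s | ~~ (M <= n)%N] x.
    rewrite /psum !big_filter; apply/eqP; rewrite eq_sym subr_eq; apply/eqP.
    exact: bigID.
  have hB : B < `|psum s x|.
    by apply: lt_trans hs; rewrite truncnS_gt.
  have hl : `|psum [seq n <- s | ~~ (M <= n)%N] x| <= \sum_(n < M) `|coef x n *: e n|.
    rewrite (le_trans (ler_norm_sum _ _ _))//.
    have -> : \sum_(n <- [seq n <- s | ~~ (M <= n)%N]) `|coef x n *: e n| =
              \sum_(n <- [seq n <- iota 0 M | n \in s]) `|coef x n *: e n|.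
      apply: perm_big; apply: uniq_perm; rewrite ?filter_uniq ?iota_uniq// => n.
      by rewrite !mem_filter mem_iota add0n -ltnNge andbC.
    rewrite big_filter -(big_mkord xpredT (fun n => `|coef x n *: e n|)).
    by rewrite /index_iota subn0 big_mkcond/=; apply: ler_sum => n _; case: ifP.
  rewrite (le_trans _ (lerB_dist _ _))//.
  by move: hB hl; rewrite /B; lra.
have /choice[s hs] := far.
pose nx M := maxn M.+1 (\max_(n <- s M) n).+1.
pose blk M := s M ++ [seq n <- iota M (nx M - M) | n \notin s M].
have nxM M : (M < nx M)%N by rewrite leq_max ltnSn.
have snx M n : n \in s M -> (M <= n < nx M)%N.
  move=> ns; have [_ /allP/(_ n ns) -> _] := hs M.
  by rewrite /= leq_max ltnS [X in _ || X](@leq_bigmax_seq _ _ _ id)// orbT.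
have blk_perm M : perm_eq (blk M) (iota M (nx M - M)).
  have [us _ _] := hs M; apply: uniq_perm; rewrite ?iota_uniq//.
    rewrite cat_uniq us filter_uniq ?iota_uniq// andbT/=.
    by apply/hasPn => n; rewrite mem_filter => /andP[].
  move=> n; rewrite mem_cat mem_filter mem_iota subnKC ?(ltnW (nxM M))//.
  by have [/snx ->|] := boolP (n \in s M).
pose L := fix L k := if k is j.+1 then L j ++ blk (size (L j)) else [::].
have LS k : L k.+1 = L k ++ blk (size (L k)) by [].
have size_blk M : size (blk M) = (nx M - M)%N.
  by rewrite (perm_size (blk_perm M)) size_iota.
have Lpre k : exists t, L k.+1 = L k ++ t by exists (blk (size (L k))).
have Lperm k : perm_eq (L k) (iota 0 (size (L k))).
  elim: k => [//|k IH]; rewrite LS size_cat iotaD add0n perm_cat//.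
  by rewrite size_blk.
have Lsize k : (k <= size (L k))%N.
  elim: k => [//|k IH]; rewrite LS size_cat size_blk.
  by rewrite subnKC ?(ltnW (nxM _))// (leq_ltn_trans IH).
have bij := rearrange_bij Lpre Lperm Lsize.
have /cvgrPdist_le/(_ 3^-1 ltac:(by rewrite invr_gt0)) := unc.2 _ _ (@coef_cvg x) _ bij.
move=> [N0 _ hN]; pose t1 := L N0; pose t2 := L N0 ++ s (size (L N0)).
have p1 : prefix t1 (L N0.+1) by rewrite LS prefix_prefix.
have p2 : prefix t2 (L N0.+1) by rewrite LS /blk catA prefix_prefix.
pose F n := coef x n *: e n.
have S1 : series (fun n => F (rearrange L n)) (size t1) = psum t1 x.
  have := rearrange_sum Lpre Lsize F p1; by [].
have S2 : series (fun n => F (rearrange L n)) (size t2) = psum t2 x.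
  have := rearrange_sum Lpre Lsize F p2; by [].
have h1 : `|x - psum t1 x| <= 3^-1 by rewrite -S1; apply: hN; exact: Lsize.
have h2 : `|x - psum t2 x| <= 3^-1.
  rewrite -S2; apply: hN; rewrite /= size_cat (leq_trans (Lsize N0))//.
  exact: leq_addr.
have [_ _] := hs (size (L N0)).
have -> : psum (s (size (L N0))) x = (x - psum t1 x) - (x - psum t2 x).
  by rewrite opprB addrC subrKA /psum /t2 big_cat/= addrAC subrr add0r.
move=> /le_trans/(_ (ler_normB _ _)); lra.
Qed.

Lemma basis_neq0 n : e n != 0.
Proof.
apply/eqP => en.
have h1 : coef 0 = (fun=> 0).
  apply: coef_unique; rewrite (_ : series _ = fun=> 0); first exact: cvg_cst.
  by apply/funext => k; rewrite /series/= big1// => i _; rewrite scale0r.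
have h2 : coef 0 = (fun k => (k == n)%:R).
  apply: coef_unique; rewrite (_ : series _ = fun=> 0); first exact: cvg_cst.
  apply/funext => k; rewrite /series/= big1// => i _.
  by case: eqP => [->|_]; rewrite ?en ?scaler0// scale0r.
have := h1; rewrite h2 => /(congr1 (fun h => h n)); rewrite eqxx => /eqP.
by rewrite oner_eq0.
Qed.

(** Baire's theorem makes the bound uniform on a dense subset of a ball. *)
Lemma psum_bounded_approx : exists2 K, 0 <= K &
  forall y, exists x, psum_bounded (K * `|y|) x /\ `|y - x| <= `|y| / 2.
Proof.
pose E (m : nat) : set X := psum_bounded m%:R.
have [m [x0 [rho rho0 hball]]] : exists m x0, exists2 rho, 0 < rho &
    forall y, `|x0 - y| < rho -> closure (E m) y.
  apply: contrapT => H.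
  have /Baire hB : forall m, open (~` closure (E m)) /\ dense (~` closure (E m)).
    move=> m; split; first by apply: closed_openC; exact: closed_closure.
    move=> O [x0 Ox0] oO; apply: contrapT => OE; apply: H; exists m, x0.
    have /nbhs_ballP[rho rho0 hrho] : nbhs x0 O by apply: open_nbhs_nbhs.
    exists rho => // y xy; apply: contrapT => nc; apply: OE; exists y; split=> //.
    by apply: hrho; rewrite -ball_normE.
  have [x [_ hx]] := hB setT (ex_intro _ 0 I) openT.
  have [m xm] := psum_bounded_ex x.
  by apply: (hx m I); exact: subset_closure.
have approx z d : `|z| < rho -> 0 < d ->
    exists x, psum_bounded (m%:R + m%:R) x /\ `|z - x| <= d.
  move=> zr d0; have d2 : 0 < d / 2 by rewrite divr_gt0.
  have c1 : closure (E m) (x0 + z).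
    by apply: hball; rewrite opprD addrA subrr add0r normrN.
  have c2 : closure (E m) x0 by apply: hball; rewrite subrr normr0.
  have [x1 [Ex1]] := c1 _ (nbhsx_ballx _ _ d2); rewrite -ball_normE/= => h1.
  have [x2 [Ex2]] := c2 _ (nbhsx_ballx _ _ d2); rewrite -ball_normE/= => h2.
  exists (x1 - x2); split; first exact: psum_boundedB.
  have -> : z - (x1 - x2) = (x0 + z - x1) - (x0 - x2).
    by rewrite !opprB [x0 + z]addrC -!addrA; congr (_ + _); rewrite addrCA [x2 - x0]addrC addNKr addrC.
  rewrite (le_trans (ler_normB _ _))// (splitr d) lerD// ltW//.
exists (4 * m%:R / rho); first by rewrite divr_ge0 ?mulr_ge0// ltW.
move=> y; have [->|y0] := eqVneq y 0.
  by exists 0; rewrite subrr normr0 mul0r mulr0; split=> // s _; rewrite psum0 normr0.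
have yp : 0 < `|y| by rewrite normr_gt0.
pose k := rho / (2 * `|y|).
have k0 : 0 < k by rewrite divr_gt0// mulr_gt0.
have [||x [xm xz]] := approx (k *: y) (k * (`|y| / 2)).
- rewrite normrZ gtr0_norm// /k invfM mulrA divfK ?gt_eqF//.
  by rewrite gtr_pMr// invf_lt1// ltr1n.
- by rewrite mulr_gt0// divr_gt0.
exists (k^-1 *: x); split.
  have := psum_boundedZ k^-1 xm.
  rewrite gtr0_norm ?invr_gt0// (_ : k^-1 * _ = 4 * m%:R / rho * `|y|)//.
  by rewrite /k; field; rewrite !gt_eqF.
have -> : y - k^-1 *: x = k^-1 *: (k *: y - x).
  by rewrite scalerBr scalerA mulVf ?scale1r// gt_eqF.
by rewrite normrZ gtr0_norm ?invr_gt0// ler_pdivrMl.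
Qed.

(** The approximations are summed as in the proof of the open mapping theorem.  The
    coefficients of the sum are obtained as limits of coefficients: the
    coefficient functionals are not known to be continuous beforehand. *)
Lemma unconditional_constant : exists2 K, 0 <= K &
  forall x, psum_bounded (K * `|x|) x.
Proof.
have [K K0 /choice[psi hpsi]] := psum_bounded_approx.
exists (2 * K); first by rewrite mulr_ge0.
move=> y; pose r := fix r n := if n is k.+1 then r k - psi (r k) else y.
have rle n : `|r n| <= `|y| / 2 ^+ n.
  elim: n => [|n IH]; first by rewrite expr0 divr1.
  rewrite /= (le_trans (hpsi (r n)).2)// exprS invfM mulrA mulrAC.
  by rewrite ler_wpM2r.
have step n : psum_bounded (K * `|y| / 2 ^+ n) (r n - r n.+1).
  rewrite /= subKr => s us; rewrite (le_trans ((hpsi (r n)).1 s us))//.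
  by rewrite -mulrA ler_wpM2l.
have jump n k : psum_bounded (2 * (K * `|y|) / 2 ^+ n) (r n - r (n + k)%N).
  move=> s us; apply: (@le_trans _ _ (2 * (K * `|y|) / 2 ^+ n - 2 * (K * `|y|) / 2 ^+ (n + k))).
    elim: k => [|k IH]; first by rewrite addn0 !subrr psum0 normr0.
    rewrite addnS (_ : psum s (r n - r (n + k).+1) =
      psum s (r n - r (n + k)%N) + psum s (r (n + k)%N - r (n + k).+1)); last first.
      by rewrite !psumB subrKA.
    rewrite (le_trans (ler_normD _ _))// (le_trans (lerD IH (step _ s us)))//.
    rewrite le_eqVlt; apply/orP; left; apply/eqP.
    by rewrite exprS; field; rewrite !expf_neq0.
  by rewrite gerBl divr_ge0// ?mulr_ge0// exprn_ge0.
pose u n := y - r n; pose B := 2 * (K * `|y|).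
have B0 : 0 <= B by rewrite !mulr_ge0.
have uJ J n : (J <= n)%N -> psum_bounded (B / 2 ^+ J) (u n - u J).
  move=> Jn; rewrite /u opprB addrC addrA subrK.
  by have := jump J (n - J)%N; rewrite subnKC.
have small d : 0 < d -> exists J, B / 2 ^+ J <= d /\ `|y| / 2 ^+ J <= d.
  move=> d0; pose J := Num.bound ((B + `|y|) / d).
  have : (B + `|y|) / d <= 2 ^+ J.
    have /archi_boundP/ltW/le_trans : 0 <= (B + `|y|) / d.
      by rewrite divr_ge0 ?addr_ge0// ltW.
    by apply; rewrite -natrX ler_nat ltnW// ltn_expl.
  rewrite ler_pdivrMr// mulrC => h; have p0 : 0 < 2 ^+ J :> R by rewrite exprn_gt0.
  by exists J; rewrite !ler_pdivrMr//; split; apply: le_trans h; rewrite ?lerDl ?lerDr.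
have ucoef i : cvgn (fun n => coef (u n) i).
  apply/cauchy_cvgP/cauchyP => d d0.
  have ei : 0 < `|e i| by rewrite normr_gt0 basis_neq0.
  have [J [hJ _]] := small (d / 2 * `|e i|) ltac:(by rewrite mulr_gt0// divr_gt0).
  exists (coef (u J) i); exists J => // n /= Jn; rewrite -ball_normE/= distrC.
  have := uJ J n Jn [:: i] isT; rewrite psumB /psum !big_seq1 -scalerBl normrZ.
  move=> /le_trans/(_ hJ); rewrite ler_pM2r// => /le_lt_trans; apply.
  by rewrite ltr_pdivrMr// ltr_pMr// ltr1n.
pose c i := limn (fun n => coef (u n) i).
pose Pc s := \sum_(i <- s) c i *: e i.
have Pcu s : psum s (u n) @[n --> \oo] --> Pc s.
  apply: cvg_big => [|i _]; first exact: add_continuous.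
  by apply: cvgZl; exact: ucoef.
have PcJ J s : uniq s -> `|Pc s - psum s (u J)| <= B / 2 ^+ J.
  move=> us; have lim : (fun n => `|psum s (u n) - psum s (u J)|) @ \oo -->
      `|Pc s - psum s (u J)|.
    by apply: cvg_norm; apply: cvgB; [exact: Pcu|exact: cvg_cst].
  rewrite -(cvg_lim _ lim)//; apply: limr_le; first exact: cvgP lim.
  by exists J => // n /= Jn; rewrite -psumB; exact: uJ.
have cE : coef y = c.
  apply: coef_unique; apply/cvgrPdist_le => d d0.
  have d3 : 0 < d / 3 by rewrite divr_gt0.
  have [J [BJ yJ]] := small _ d3.
  have /cvgrPdist_le/(_ _ d3)[M0 _ hM] := @coef_cvg (u J).
  exists M0 => // M /= MM.
  have -> : y - series (fun n => c n *: e n) M =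
      (y - u J) + ((u J - series (fun n => coef (u J) n *: e n) M) -
        (Pc (index_iota 0 M) - psum (index_iota 0 M) (u J))).
    have E (a b s t : X) : a - s = (a - b) + ((b - t) - (s - t)).
      by rewrite opprB !subrKA.
    exact: E.
  rewrite (le_trans (ler_normD _ _))// (_ : d = d / 3 + (d / 3 + d / 3)); last by field.
  rewrite lerD//.
    by rewrite /u subKr (le_trans (rle J)).
  rewrite (le_trans (ler_normB _ _))// lerD//; first exact: hM.
  by rewrite (le_trans (PcJ J _ (iota_uniq _ _))).
move=> s us; rewrite /psum cE -/(Pc s).
have := PcJ 0%N s us; rewrite expr0 divr1 {1}/u /= subrr psum0 subr0.
by rewrite /B mulrA.
Qed.

End UnconditionalConstant.

(** * Unconditional bases and type *)

(** A spread vector is a sum of disjoint pieces, so changing the signs of the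
   pieces does not change the moduli of its coordinates. *)
Lemma spread_signs (R : realType) (N0 : c00 R -> R) r s x : spread N0 r s x ->
  exists n (y : 'I_n -> c00 R), s = \sum_(i < n) N0 (y i) `^ r /\
    forall (f : 'I_n -> bool) k, `|(\sum_(i < n) (-1) ^+ f i *: y i) k| = `|x k|.
Proof.
elim=> [y|{}s t {}x y xy _ [n [u [su xu]]] _ [m [v [tv yv]]]].
  exists 1%N, (fun=> y); split; first by rewrite big_ord1.
  by move=> f k; rewrite big_ord1 c00Z normrM normrX normrN1 expr1n mul1r.
exists (n + m)%N, (fun i => match fintype.split i with inl j => u j | inr j => v j end).
have spl j : fintype.split (lshift m j) = inl j :> 'I_n + 'I_m by exact: (unsplitK (inl j)).
have spr j : fintype.split (rshift n j) = inr j :> 'I_n + 'I_m by exact: (unsplitK (inr j)).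
split=> [|f k].
  rewrite su tv big_split_ord; congr (_ + _); apply: eq_bigr => i _.
    by rewrite spl.
  by rewrite spr.
have -> : \sum_(i < n + m) (-1) ^+ f i *:
    match fintype.split i with inl j => u j | inr j => v j end =
    \sum_(j < n) (-1) ^+ f (lshift m j) *: u j +
    \sum_(j < m) (-1) ^+ f (rshift n j) *: v j.
  rewrite big_split_ord; congr (_ + _); apply: eq_bigr => j _.
    by rewrite spl.
  by rewrite spr.
have hx := xu (fun j => f (lshift m j)) k; have hy := yv (fun j => f (rshift n j)) k.
rewrite !c00D; case: (xy k) => h0.
  move: hx; rewrite h0 normr0 => /eqP; rewrite normr_eq0 => /eqP ->.
  by rewrite !add0r.
move: hy; rewrite h0 normr0 => /eqP; rewrite normr_eq0 => /eqP ->.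
by rewrite !addr0.
Qed.

Section UnconditionalNorm.
Variables (R : realType) (Z : completeNormedModType R) (e : nat -> Z) (C : R).
Local Notation S := (synth e).
Hypothesis e1 : forall n, `|e n| = 1.
Hypothesis C0 : 0 < C.
Hypothesis eC : forall t a, (forall n, `|t n| <= 1) -> `|S (cmul t a)| <= C * `|S a|.

Definition unconditional_norm (a : c00 R) : R :=
  sup [set `|S (cmul t a)| | t in [set t | forall n, `|t n| <= 1]].
Local Notation N0 := unconditional_norm.

Let N0_has_sup a :
  has_sup [set `|S (cmul t a)| | t in [set t | forall n, `|t n| <= 1]].
Proof.
split; first by eexists; exists (fun=> 1) => //= n; rewrite normr1.
by exists (C * `|S a|) => _ [t t1 <-]; exact: eC.
Qed.

Let N0_ub t a : (forall n, `|t n| <= 1) -> `|S (cmul t a)| <= N0 a.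
Proof. by move=> t1; apply: (sup_upper_bound (N0_has_sup a)); exists t. Qed.

Let N0_lub a B : (forall t, (forall n, `|t n| <= 1) -> `|S (cmul t a)| <= B) ->
  N0 a <= B.
Proof.
move=> h; apply: ge_sup; first by case: (N0_has_sup a).
by move=> _ [t t1 <-]; exact: h.
Qed.

Let cmul1 (a : c00 R) : cmul (fun=> 1) a = a.
Proof. by apply: c00_eqP => n; rewrite cmulE mul1r. Qed.

Lemma unconditional_norm_ge a : `|S a| <= N0 a.
Proof. by rewrite -{1}[a]cmul1 N0_ub// => n; rewrite normr1. Qed.

Lemma unconditional_norm_le a : N0 a <= C * `|S a|.
Proof. by apply: N0_lub => t; exact: eC. Qed.

Lemma unconditional_norm_lattice : lattice_norm N0.
Proof.
have N0Z s a : N0 (s *: a) <= `|s| * N0 a.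
  apply: N0_lub => t t1.
  have -> : cmul t (s *: a) = s *: cmul t a.
    by apply: c00_eqP => n; rewrite !(cmulE, c00Z) mulrCA.
  by rewrite linearZ normrZ ler_wpM2l// N0_ub.
split=> [x y xy|x y|s a|n].
- apply: N0_lub => t t1.
  have -> : cmul t x = cmul (fun n => t n * (x n / y n)) y.
    apply: c00_eqP => n; rewrite !cmulE.
    have [y0|y0] := eqVneq (y n) 0; last by rewrite -!mulrA mulVf ?mulr1.
    have := xy n; rewrite y0 normr0 normr_le0 => /eqP ->.
    by rewrite !mulr0.
  apply: N0_ub => n; rewrite normrM mulr_ile1//.
  have [y0|y0] := eqVneq (y n) 0; first by rewrite y0 invr0 mulr0 normr0.
  by rewrite normrM normfV ler_pdivrMr ?normr_gt0// mul1r.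
- apply: N0_lub => t t1.
  have -> : cmul t (x + y) = cmul t x + cmul t y.
    by apply: c00_eqP => n; rewrite c00D !cmulE c00D mulrDr.
  by rewrite linearD (le_trans (ler_normD _ _))// lerD// N0_ub.
- apply/le_anti; rewrite N0Z/=.
  have [->|s0] := eqVneq s 0.
    by rewrite normr0 mul0r (le_trans _ (unconditional_norm_ge _)).
  rewrite mulrC -ler_pdivlMr ?normr_gt0// mulrC -normfV.
  by rewrite -[in leLHS](scalerK s0 a) N0Z.
- apply/le_anti/andP; split.
    apply: N0_lub => t t1; have -> : cmul t (cdelta R n) = t n *: cdelta R n.
      apply: c00_eqP => k; rewrite c00Z cmulE cdeltaE.
      by case: eqP => [->|]; rewrite ?mulr0.
    by rewrite linearZ normrZ/= synth_delta e1 mulr1.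
  by rewrite -(e1 n) -synth_delta unconditional_norm_ge.
Qed.

(** Averaging over the signs of the pieces of a spread vector, type [r] is an
    upper [r]-estimate. *)
Lemma type_spread r : 1 < r -> has_type Z r ->
  exists K, forall s x, spread N0 r s x -> s <= 1 -> N0 x <= K.
Proof.
move=> r1 [D tD]; have r0 : 0 < r by exact: lt_trans r1.
have latN := unconditional_norm_lattice.
exists (C * `|D|) => s x sx s1; have [n [y [sy xy]]] := spread_signs sx.
rewrite -ler_pdivrMl//; set q := C^-1 * N0 x.
have q0 : 0 <= q by rewrite mulr_ge0 ?ln_ge0// invr_ge0 ltW.
have qle (f : {ffun 'I_n -> bool}) : q <= `|\sum_(i < n) (-1) ^+ f i *: S (y i)|.
  rewrite ler_pdivrMl//; have <- : N0 (\sum_(i < n) (-1) ^+ f i *: y i) = N0 x.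
    by apply: ln_eq latN _ _ _ => k; exact: xy.
  rewrite (le_trans (unconditional_norm_le _))// linear_sum.
  by under eq_bigr do rewrite linearZ/=.
apply: (@le_trans _ _ (D * (\sum_(i < n) `|S (y i)| `^ r) `^ r^-1)); last first.
  apply: (@le_trans _ _ (`|D| * 1)); last by rewrite mulr1.
  apply: (le_trans (ler_wpM2r (powR_ge0 _ _) (ler_norm D))).
  rewrite ler_wpM2l//; apply: (powR_le_inv r0) => //; rewrite ?powR_ge0//.
  rewrite powR1 powRK//; last by apply: sumr_ge0 => i _; exact: powR_ge0.
  rewrite (le_trans _ s1)// sy; apply: ler_sum => i _.
  by apply: powR_le; rewrite ?(ln_ge0 latN)// unconditional_norm_ge.
apply: le_trans (tD n (fun i => S (y i))).
rewrite -[leLHS](powRVK r0 q0); apply: powR_le; rewrite ?invr_gt0 ?powR_ge0//.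
  rewrite mulr_ge0 ?invr_ge0 ?exprn_ge0// sumr_ge0// => f _; exact: powR_ge0.
rewrite -ler_pdivrMl ?invr_gt0 ?exprn_gt0// invrK.
apply: (@le_trans _ _ (\sum_(f : {ffun 'I_n -> bool}) q `^ r)).
  by rewrite sumr_const card_ffun card_bool card_ord -[leRHS]mulr_natl natrX.
by apply: ler_sum => f _; exact: powR_le.
Qed.

End UnconditionalNorm.

Section UnconditionalBasis.
Variables (R : realType) (X : completeNormedModType R) (e : nat -> X).
Hypothesis unc : unconditional_basis e.

Let coef_synth (a : c00 R) : coef unc (synth e a) = a.
Proof.
apply: coef_unique; apply: cvg_near_cst; exists (bnd a) => // M /= aM.
rewrite (@synthE _ _ _ _ M)/series/= ?big_mkord// => n Mn.
by apply: bndP; exact: leq_trans Mn.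
Qed.

(** The difference of two coordinate projections is a change of signs, and the
    remaining multipliers follow by convexity. *)
Lemma unconditional_multiplier : exists2 K, 0 < K & forall t a,
  (forall n, `|t n| <= 1) -> `|synth e (cmul t a)| <= K * `|synth e a|.
Proof.
have [K K0 hK] := unconditional_constant unc.
exists (K + K + 1); first by rewrite ltr_wpDl// addr_ge0.
have restr A a : `|synth e (crestr A a)| <= K * `|synth e a|.
  have := hK (synth e a) [seq n <- iota 0 (bnd a) | n \in A].
  rewrite filter_uniq ?iota_uniq// => /(_ isT); apply: le_trans.
  rewrite /psum coef_synth big_filter (@synthE _ _ _ _ (bnd a)); last first.
    by move=> n an; rewrite crestrE bndP// if_same.
  rewrite -(big_mkord xpredT (fun n => crestr A a n *: e n)) /index_iota subn0.
  rewrite le_eqVlt; apply/orP; left; apply/eqP; congr `|_|.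
  rewrite [RHS]big_mkcond/=; apply: eq_bigr => n _.
  by case: ifP => _; rewrite ?mul1r// mul0r scale0r.
have sgn t a : (forall n, t n = 1 \/ t n = -1) ->
    `|synth e (cmul t a)| <= (K + K + 1) * `|synth e a|.
  move=> t1; pose A := [set n | t n = 1].
  have -> : cmul t a = crestr A a - crestr (~` A) a.
    apply: c00_eqP => n; rewrite c00D c00N !crestrE cmulE in_setC.
    have [/set_mem ->|/negP nA] := boolP (n \in A); first by rewrite mul1r subr0.
    case: (t1 n) => tn; first by case: nA; exact: mem_set.
    by rewrite tn mulN1r add0r.
  rewrite linearB (le_trans (ler_normB _ _))// mulrDl (le_trans (lerD (restr _ _) (restr _ _)))//.
  by rewrite mulrDl lerDl mul1r.
(* A multiplier in the unit ball is an average of sign changes, one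
   coordinate at a time. *)
have conv M : forall t a, (forall n, `|t n| <= 1) ->
    (forall n, (M <= n)%N -> t n = 1 \/ t n = -1) ->
    `|synth e (cmul t a)| <= (K + K + 1) * `|synth e a|.
  elim: M => [|M IH] t a t1 tM; first by apply: sgn => n; exact: tM.
  pose u s n : R := if n == M then s else t n.
  have uK s : s = 1 \/ s = -1 -> `|synth e (cmul (u s) a)| <= (K + K + 1) * `|synth e a|.
    move=> s1; apply: IH => n; rewrite /u.
      by case: eqP => // _; case: s1 => ->; rewrite ?normrN normr1.
    by case: eqP => // /eqP nM; rewrite leq_eqVlt eq_sym (negbTE nM) => /tM.
  have -> : cmul t a = ((1 + t M) / 2) *: cmul (u 1) a + ((1 - t M) / 2) *: cmul (u (-1)) a.
    apply: c00_eqP => n; rewrite c00D !c00Z !cmulE /u.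
    by case: eqP => [->|_]; field.
  have := t1 M; rewrite ler_norml => /andP[tl tr].
  rewrite linearD !linearZ/= (le_trans (ler_normD _ _))// !normrZ !ger0_norm; [|lra..].
  apply: (le_trans (lerD (ler_wpM2l _ (uK 1 (or_introl erefl)))
                         (ler_wpM2l _ (uK (-1) (or_intror erefl))))); [lra..|].
  by rewrite -mulrDl ler_piMl ?mulr_ge0 ?addr_ge0//; lra.
move=> t a t1; pose t' n := if (n < bnd a)%N then t n else 1.
have -> : cmul t a = cmul t' a.
  by apply: c00_eqP => n; rewrite !cmulE /t'; case: ltnP => // /bndP ->; rewrite !mulr0.
apply: (conv (bnd a)) => n; rewrite /t'; first by case: ifP; rewrite ?normr1.
by rewrite leqNgt => /negbTE ->; left.
Qed.

Lemma unconditional_type_quotient : nontrivial_type X -> quotient_of_polyhedral X.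
Proof.
move=> [r r1 tX]; have [K K0 hK] := unconditional_multiplier.
pose w n := `|e n|^-1; pose e' n := w n *: e n.
have en n : `|e n| != 0 by rewrite normr_eq0 (basis_neq0 unc).
have e'1 n : `|e' n| = 1 by rewrite normrZ normfV normr_id mulVf.
have e'E a : synth e' a = synth e (cmul w a).
  rewrite (@synthE _ _ _ (cmul w a) (bnd a)); last first.
    by move=> n /bndP an; rewrite cmulE an mulr0.
  by apply: eq_bigr => n _; rewrite /e' scalerA mulrC.
have hK' t a : (forall n, `|t n| <= 1) -> `|synth e' (cmul t a)| <= K * `|synth e' a|.
  move=> t1; rewrite !e'E (_ : cmul w (cmul t a) = cmul t (cmul w a)); first exact: hK.
  by apply: c00_eqP => n; rewrite !cmulE mulrCA.
have [K' sp] := type_spread e'1 K0 hK' r1 tX.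
apply: (spread_lattice_quotient (unconditional_norm_lattice e'1 hK') r1 sp ler01
  _ (unconditional_norm_le hK')).
  by move=> a; rewrite mul1r (unconditional_norm_ge hK').
move=> z d d0; have /cvgrPdist_le/(_ _ d0)[M _ hM] := @coef_cvg _ _ _ unc z.
have aP : (fun n => if (n < M)%N then coef unc z n * `|e n| else 0) \in @finitely_supported R.
  by apply/asboolP; exists M => // n /= Mn; rewrite ltnNge Mn.
exists (C00 aP); have := hM M (leqnn M).
rewrite (@synthE _ _ _ _ M) => [|n Mn]; last by rewrite /= ltnNge Mn.
rewrite /series/= big_mkord; congr (`|_ - _| <= d); apply: eq_bigr => n _ /=.
by rewrite ltn_ord scalerA mulfK.
Qed.

End UnconditionalBasis.

(** * Norming functionals of the Tsirelson norm *)

Section Norming.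
Variable R : realType.
Local Notation C := (c00 R).
Local Notation tau := (@tsirelson_norm R).
Implicit Types x y f : C.

Lemma restr_crestr (E : set nat) x : restr E x = crestr E x.
Proof. by apply: c00_eqP => n; rewrite crestrE. Qed.

Lemma crestrD (A : set nat) x y : crestr A (x + y) = crestr A x + crestr A y.
Proof. by apply: c00_eqP => n; rewrite c00D !cmulE c00D mulrDr. Qed.

Lemma crestrZ (A : set nat) (s : R) x : crestr A (s *: x) = s *: crestr A x.
Proof. by apply: c00_eqP => n; rewrite c00Z !crestrE; case: ifP; rewrite ?mulr0. Qed.

Lemma crestr_sum (A : set nat) k (g : nat -> C) :
  crestr A (\sum_(i < k) g i) = \sum_(i < k) crestr A (g i).
Proof.
by apply: c00_eqP => n; rewrite cmulE !c00sum mulr_sumr.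
Qed.

Lemma crestr0 (A : set nat) : crestr A 0 = 0 :> C.
Proof. by apply: c00_eqP => n; rewrite cmulE mulr0. Qed.

Lemma pair_sum_fun (I : Type) (r : seq I) (F : I -> C) x :
  pair (\sum_(i <- r) F i) x = \sum_(i <- r) pair (F i) x.
Proof.
rewrite /pair exchange_big/=; apply: eq_bigr => n _.
by rewrite c00sum mulr_suml.
Qed.

Lemma pairZ_fun (s : R) f x : pair (s *: f) x = s * pair f x.
Proof. by rewrite /pair mulr_sumr; apply: eq_bigr => n _; rewrite c00Z mulrA. Qed.

Lemma pair_delta_fun n x : pair (cdelta R n) x = x n.
Proof.
rewrite -(pair_delta x n) (@pairE _ _ _ (maxn (bnd x) n.+1)); last first.
  by move=> k; rewrite geq_max => /andP[/bndP].
rewrite [RHS](@pairE _ _ _ (maxn (bnd x) n.+1)); last first.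
  by move=> k; rewrite geq_max cdeltaE => /andP[_ /gtn_eqF ->].
by apply: eq_bigr => k _; rewrite mulrC.
Qed.

Lemma tau_coord x n : `|x n| <= tau x.
Proof.
have [_ eq] := tsirelson_normP R; rewrite -lee_fin (eq x) le_max lee_fin.
by rewrite supnorm_ub//; exact: c00_bounded.
Qed.

Lemma tau_admissible x k E : admissible k E ->
  \sum_(i < k) tau (crestr (E i) x) <= 2 * tau x.
Proof.
move=> aE; have [_ eq] := tsirelson_normP R; rewrite -ler_pdivrMl// -lee_fin.
rewrite (eq x) EFinM le_max; apply/orP; right; rewrite lee_pmul2l//.
apply: ereal_sup_ubound; exists (\sum_(i < k) tau (crestr (E i) x)) => //.
by exists k, E; split=> //; apply: eq_bigr => i _; rewrite restr_crestr.
Qed.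

Lemma tau_le x (B : R) : (forall n, `|x n| <= B) ->
  (forall k E, admissible k E -> \sum_(i < k) tau (crestr (E i) x) <= 2 * B) ->
  tau x <= B.
Proof.
move=> xB EB; have [_ eq] := tsirelson_normP R; rewrite -lee_fin (eq x) ge_max.
rewrite lee_fin supnorm_le//= -[X in (_ <= X%:E)%E](@mulKf _ 2)// EFinM.
rewrite lee_pmul2l//; apply: ge_ereal_sup => _ [_ [k [E [aE ->]] <-]].
by rewrite lee_fin (le_trans _ (EB k E aE))//; apply: ler_sum => i _; rewrite restr_crestr.
Qed.

(** The functionals obtained from the coordinates by iterating the right-hand
    side of the Tsirelson equation [d] times. *)
Inductive norming : nat -> C -> Prop :=
| norming_zero d : norming d 0
| norming_delta d n : norming d.+1 (cdelta R n)
| norming_node d k E (g : nat -> C) : admissible k E ->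
    (forall i, (i < k)%N -> norming d (g i)) ->
    (forall i n, (i < k)%N -> g i n != 0 -> E i n) ->
    norming d.+1 (2^-1 *: \sum_(i < k) g i).

Lemma norming_ge0 d f n : norming d f -> 0 <= f n.
Proof.
elim=> [//|{}d m|{}d k E g _ _ IH _]; first by rewrite cdeltaE.
by rewrite c00Z c00sum mulr_ge0// sumr_ge0// => i _; exact: IH.
Qed.

Lemma norming_restr d f A : norming d f -> norming d (crestr A f).
Proof.
elim=> [{}d|{}d m|{}d k E g aE _ IH gE].
- by rewrite crestr0; exact: norming_zero.
- have [mA|mA] := boolP (m \in A).
    rewrite (_ : crestr A _ = cdelta R m); first exact: norming_delta.
    by apply: c00_eqP => n; rewrite crestrE cdeltaE; case: eqP => [->|]; rewrite ?mA ?if_same.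
  rewrite (_ : crestr A _ = 0); first exact: norming_zero.
  apply: c00_eqP => n; rewrite crestrE cdeltaE.
  by case: eqP => [->|]; rewrite ?(negbTE mA) ?if_same.
- rewrite crestrZ crestr_sum; apply: (norming_node (g := fun i => crestr A (g i)) aE) => [|i n ik]; first exact: IH.
  by rewrite crestrE; case: ifP => [_|]; [exact: gE|rewrite eqxx].
Qed.

Lemma norming_mono d d' f : norming d f -> (d <= d')%N -> norming d' f.
Proof.
move=> nf; elim: nf d' => [{}d|{}d m|{}d k E g aE _ IH gE] d' dd'.
- exact: norming_zero.
- by case: d' dd' => // d' _; exact: norming_delta.
- case: d' dd' => // d' dd'; apply: (norming_node aE) => // i ik; exact: IH.
Qed.

Lemma norming_le d f x : norming d f -> pair f (cabs x) <= tau x.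
Proof.
move=> nf; elim: nf x => [{}d|{}d m|{}d k E g aE _ IH gE] x.
- rewrite /pair big1 => [|n _]; last by rewrite mul0r.
  by have [h _] := tsirelson_normP R; exact: is_norm_ge0.
- rewrite (_ : pair _ _ = `|x m|); first exact: tau_coord.
  by rewrite pair_delta_fun cabsE.
- rewrite pairZ_fun pair_sum_fun ler_pdivrMl// (le_trans _ (tau_admissible x aE))//.
  apply: ler_sum => i _; rewrite (le_trans _ (IH i (ltn_ord i) _))// le_eqVlt.
  apply/orP; left; apply/eqP; apply: pair_eq => n; rewrite !cabsE crestrE.
  have [->|gn] := eqVneq (g i n) 0; first by rewrite !mul0r.
  by rewrite mem_set//; exact: gE.
Qed.

Definition norming_sup x : R :=
  sup [set pair f (cabs x) | f in [set f | exists d, norming d f]].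
Local Notation nu := norming_sup.

Let nu_has_sup x :
  has_sup [set pair f (cabs x) | f in [set f | exists d, norming d f]].
Proof.
split; first by eexists; exists 0 => //; exists 0%N; exact: norming_zero.
by exists (tau x) => _ [f [d nf] <-]; exact: norming_le nf.
Qed.

Let nu_ub d f x : norming d f -> pair f (cabs x) <= nu x.
Proof.
by move=> nf; apply: (sup_upper_bound (nu_has_sup x)); exists f => //; exists d.
Qed.

Let nu_lub x B : (forall d f, norming d f -> pair f (cabs x) <= B) -> nu x <= B.
Proof.
move=> h; apply: ge_sup; first by case: (nu_has_sup x).
by move=> _ [f [d nf] <-]; exact: h nf.
Qed.

Let nu_coord x n : `|x n| <= nu x.
Proof. by rewrite -cabsE -pair_delta_fun; exact: nu_ub (norming_delta 0 n). Qed.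

Let nu_admissible x k E : admissible k E ->
  \sum_(i < k) nu (crestr (E i) x) <= 2 * nu x.
Proof.
move=> aE; apply/ler_addgt0Pr => e e0.
have ek : 0 < e / k.+1%:R by rewrite divr_gt0.
have /choice[f hf] i : exists f, (exists d, norming d f) /\
    nu (crestr (E i) x) - e / k.+1%:R <= pair f (cabs (crestr (E i) x)).
  have [_ [f nf <-] h] := sup_adherent ek (nu_has_sup (crestr (E i) x)).
  by exists f; split=> //; exact: ltW.
have /choice[d hd] i := (hf i).1.
pose D := (\max_(i < k) d i)%N.
have nn : norming D.+1 (2^-1 *: \sum_(i < k) crestr (E i) (f i)).
  apply: (norming_node (g := fun i => crestr (E i) (f i)) aE) => [i ik|i n ik].
    apply: norming_restr; apply: norming_mono (hd i) _.
    exact: (leq_bigmax (Ordinal ik)).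
  by rewrite crestrE; case: ifP => [/set_mem//|]; rewrite eqxx.
have := nu_ub x nn; rewrite pairZ_fun ler_pdivrMl// pair_sum_fun => h.
rewrite (@le_trans _ _ (\sum_(i < k) (pair (crestr (E i) (f i)) (cabs x) + e / k.+1%:R)))//.
  apply: ler_sum => i _; rewrite -lerBlDr (le_trans (hf i).2)// le_eqVlt.
  by apply/orP; left; apply/eqP; apply: pair_eq => n; rewrite !cabsE !crestrE;
     case: ifP; rewrite ?normr0 ?mulr0 ?mul0r.
rewrite big_split/= sumr_const card_ord lerD// -[leLHS]mulr_natl mulrCA ger_pMr//.
by rewrite ler_pdivrMr// mul1r ler_nat.
Qed.

(** The supremum of the norming functionals solves the Tsirelson equation, and by
    uniqueness it is the Tsirelson norm. *)
Let nu_eq : is_norm nu /\ tsirelson_equation nu.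
Proof.
have nu0 x : 0 <= nu x by exact: le_trans (nu_coord x 0).
have nuZ s x : nu (s *: x) <= `|s| * nu x.
  apply: nu_lub => d f nf; rewrite (_ : cabs (s *: x) = `|s| *: cabs x).
    by rewrite pairZ ler_wpM2l// (nu_ub _ nf).
  by apply: c00_eqP => n; rewrite c00Z !cabsE c00Z normrM.
split; first split.
- by move=> x x0; apply: c00_eqP => n; apply/eqP; rewrite -normr_le0 -x0.
- move=> s x; apply/le_anti; rewrite nuZ/=.
  have [->|s0] := eqVneq s 0; first by rewrite normr0 mul0r.
  rewrite mulrC -ler_pdivlMr ?normr_gt0// mulrC -normfV.
  by rewrite -[in leLHS](scalerK s0 x).
- move=> x y; apply: nu_lub => d f nf.
  apply: (@le_trans _ _ (pair f (cabs x + cabs y))).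
    by apply: pair_le => n; rewrite c00D !cabsE ler_wpM2l ?ler_normD// (norming_ge0 _ nf).
  by rewrite pairD lerD// (nu_ub _ nf).
move=> x; have hs : has_sup (admissible_sums nu x).
  split; first by eexists; exists 1%N, (fun=> [set 0%N]); split; [exact: admissible1|].
  exists (2 * nu x) => _ [k [E [aE ->]]]; apply: le_trans (nu_admissible x aE).
  by apply: ler_sum => i _; rewrite restr_crestr.
rewrite ereal_sup_EFin; [|by case: hs..]; rewrite -EFinM -EFin_max; congr _%:E.
have sub k E : admissible k E ->
    \sum_(i < k) nu (restr (E i) x) <= sup (admissible_sums nu x).
  by move=> aE; apply: (sup_upper_bound hs); exists k, E.
have S0 : 0 <= sup (admissible_sums nu x).
  by apply: le_trans (sub _ _ admissible1); apply: sumr_ge0.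
apply/le_anti/andP; split; last first.
  rewrite ge_max supnorm_le//= ler_pdivrMl//; apply: ge_sup; first by case: hs.
  move=> _ [k [E [aE ->]]]; apply: le_trans (nu_admissible x aE).
  by apply: ler_sum => i _; rewrite restr_crestr.
apply: nu_lub => d f [{}d|{}d n|{}d k E g aE ng gE].
- by rewrite /pair big1 ?le_max ?mulr_ge0 ?orbT// => n _; rewrite mul0r.
- by rewrite pair_delta_fun cabsE le_max supnorm_ub//; exact: c00_bounded.
- rewrite le_max; apply/orP; right; rewrite pairZ_fun ler_pM2l// pair_sum_fun.
  apply: le_trans (sub _ _ aE).
  apply: ler_sum => i _; rewrite restr_crestr (le_trans _ (nu_ub _ (ng i (ltn_ord i))))//.
  rewrite le_eqVlt; apply/orP; left; apply/eqP; apply: pair_eq => n.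
  rewrite !cabsE crestrE; have [->|gn] := eqVneq (g i n) 0; first by rewrite !mul0r.
  by rewrite mem_set//; exact: gE.
Qed.

Let tauE x : tau x = nu x.
Proof.
have [n1 e1] := tsirelson_normP R; have [n2 e2] := nu_eq.
by rewrite (tsirelson_norm_unique n1 e1 n2 e2).
Qed.

Lemma norming_approx x (e : R) : 0 < e ->
  exists d f, norming d f /\ tau x - e <= pair f (cabs x).
Proof.
move=> e0; have [_ [f [d nf] <-] h] := sup_adherent e0 (nu_has_sup x).
by exists d, f; split=> //; rewrite tauE ltW.
Qed.

Lemma tau_lattice : lattice_norm tau.
Proof.
have [[_ tZ tD] _] := tsirelson_normP R.
split=> [x y xy|//|//|n].
- rewrite !tauE; apply: nu_lub => d f nf; apply: le_trans (nu_ub y nf).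
  by apply: pair_le => n; rewrite !cabsE ler_wpM2l// (norming_ge0 _ nf).
- rewrite tauE; apply/le_anti/andP; split; last first.
    by rewrite (le_trans _ (nu_coord _ n))// cdeltaE eqxx normr1.
  apply: nu_lub => d f nf.
  rewrite (_ : cabs _ = cdelta R n); last first.
    by apply: c00_eqP => k; rewrite cabsE cdeltaE normr_nat.
  rewrite pair_delta; elim: nf => [{}d|{}d m|{}d k E g aE _ IH gE].
  + exact: ler01.
  + by rewrite cdeltaE lern1 leq_b1.
  + rewrite c00Z c00sum; have [[i gi]|H] := pselect (exists i : 'I_k, g i n != 0).
      rewrite (bigD1 i)//= big1 ?addr0 => [|j ji].
        by have := IH i (ltn_ord i); have := norming_ge0; lra.
      apply/eqP; apply: contrapT => /negP gj; move: ji; rewrite -val_eqE/= neq_ltn.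
      have Ei := gE i n (ltn_ord i) gi; have Ej := gE j n (ltn_ord j) gj.
      case/orP=> h.
        by have := admissible_disj aE _ Ej Ei; rewrite h ltn_ord ltnn => /(_ isT).
      by have := admissible_disj aE _ Ei Ej; rewrite h ltn_ord ltnn => /(_ isT).
    rewrite big1 ?mulr0// => i _; apply/eqP; apply: contrapT => /negP gi.
    by apply: H; exists i.
Qed.

End Norming.

(** * Disjoint vectors in the Tsirelson space *)

Lemma sum_pred_le1 (p : pred nat) u v : (forall n n', p n -> p n' -> n = n') ->
  (\sum_(u <= n < v) p n <= 1)%N.
Proof.
move=> pi; have -> : (\sum_(u <= n < v) p n = count p (index_iota u v))%N.
  by rewrite -sum1_count [RHS]big_mkcond; apply: eq_bigr => n _; case: (p n).
have [/hasP[n _ pn]|] := boolP (has p (index_iota u v)); last first.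
  by rewrite has_count -leqNgt => /leq_trans; apply.
rewrite (@eq_count _ p (pred1 n)) ?count_uniq_mem ?iota_uniq ?leq_b1// => k /=.
by apply/idP/eqP => [pk|->//]; exact: pi.
Qed.

Section Segments.
Variable R : realType.
Local Notation C := (c00 R).
Local Notation tau := (@tsirelson_norm R).
Implicit Types f g : C.

Definition seg u v (x : C) : C := crestr [set n | (u <= n < v)%N] x.

#[global] Arguments seg : simpl never.

Lemma segE u v x n : seg u v x n = if (u <= n < v)%N then x n else 0.
Proof. by rewrite crestrE; congr (if _ then _ else _); apply/idP/idP; rewrite inE. Qed.

Lemma seg_empty u x : seg u u x = 0.
Proof.
by apply: c00_eqP => n; rewrite segE; case: ifP => // /andP[/leq_ltn_trans h /h]; rewrite ltnn.
Qed.

Lemma seg_cat u v w x : (u <= v <= w)%N -> seg u w x = seg u v x + seg v w x.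
Proof.
move=> /andP[uv vw]; apply: c00_eqP => n; rewrite c00D !segE.
have [nv|vn] := ltnP n v; rewrite ?(leq_trans nv vw) ?andbT ?andbF /= ?addr0//.
by rewrite (leq_trans uv vn) add0r.
Qed.

Lemma pair_seg (f : nat -> R) u v x : (u <= v)%N ->
  pair f (seg u v x) = \sum_(u <= n < v) f n * x n.
Proof.
move=> uv; rewrite (@pairE _ _ _ v) => [|n vn]; last by rewrite segE ltnNge vn andbF.
rewrite (eq_bigr (fun n : 'I_v => if (u <= n)%N then f n * x n else 0)).
  by rewrite -(big_mkord xpredT (fun n => if (u <= n)%N then f n * x n else 0))
    -big_mkcond/= [RHS](big_nat_widenl _ 0%N) //; apply: eq_bigl => n; rewrite andbT.
by move=> n _; rewrite segE ltn_ord andbT; case: ifP; rewrite ?mulr0.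
Qed.

Lemma norming_le1 d f n : norming d f -> f n <= 1.
Proof.
move=> nf; rewrite -(ln_delta (tau_lattice R) n) -(pair_delta f).
apply: le_trans (norming_le (cdelta R n) nf); rewrite le_eqVlt; apply/orP; left; apply/eqP.
by apply: pair_eq => k; rewrite cabsE cdeltaE normr_nat.
Qed.

(** A functional of depth [d.+1] is a coordinate or half a sum of successive
    functionals of depth [d].  The positions [Q] mark the beginnings of these
    summands and [P] marks the coordinate.  There are at most [a.+1] summands,
    and they begin at [a] or later.  The weight is what a block of positions may
    charge to the functional: the summands together weigh at most one, the
    position [a] and the coordinate weigh one each. *)
Definition weight (a : nat) (Q P : pred nat) (n : nat) : R :=
  (Q n)%:R / a.+1%:R + (n == a)%:R + (P n)%:R.

Definition splits d f a (Q P : pred nat) : Prop :=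
  [/\ forall n, Q n -> (f n != 0) && (a <= n)%N,
      forall u v, \sum_(u <= n < v) weight a Q P n <= 2 &
      forall x y, (x <= y)%N -> (forall n, (x <= n < y)%N -> ~~ P n) ->
        exists L : seq C, [/\ forall g, g \in L -> norming d g,
          (size L <= 1 + \sum_(x <= n < y) Q n)%N,
          \sum_(g <- L) g = 2 *: seg x y f &
          forall n, (count (fun g : C => g n != 0%R) L <= (f n != 0%R))%N]].

(** An interval is cut at marked positions until none is left in its interior. *)
Lemma pieces d f (Q : pred nat) :
  (forall x y, (forall n, (x < n < y)%N -> ~~ Q n) -> norming d (2 *: seg x y f)) ->
  forall x y, (x <= y)%N ->
  exists L : seq C, [/\ forall g, g \in L -> norming d g,
    (size L <= 1 + \sum_(x.+1 <= n < y) Q n)%N,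
    \sum_(g <- L) g = 2 *: seg x y f &
    forall n, (count (fun g : C => g n != 0%R) L <= (f n != 0%R) && (x <= n < y))%N].
Proof.
move=> Qf x y; move: {2}(y - x).+1 (ltnSn (y - x)) => N.
elim: N x y => // N IH x y yxN xy.
have [[n /andP[/andP[xn ny] Qn]]|noQ] := pselect (exists n, (x < n < y)%N && Q n); last first.
  exists [:: 2 *: seg x y f]; split=> [g|//||n].
  - rewrite inE => /eqP ->; apply: Qf => n xny; apply/negP => Qn; apply: noQ.
    by exists n; rewrite xny.
  - by rewrite big_seq1.
  - rewrite -[count _ _]/(((2 *: seg x y f) n != 0%R) + 0)%N addn0 c00Z segE.
    rewrite mulf_eq0 pnatr_eq0/=.
    by case: ifP => _; rewrite ?andbT ?eqxx// andbF.
have [||L1 [n1 s1 e1 c1]] := IH x n _ _; [lia|lia|].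
have [||L2 [n2 s2 e2 c2]] := IH n y _ _; [lia|lia|].
exists (L1 ++ L2); split=> [g||| k].
- by rewrite mem_cat => /orP[/n1|/n2].
- have -> : (\sum_(x.+1 <= n < y) Q n =
    \sum_(x.+1 <= n < n) Q n + (1 + \sum_(n.+1 <= n < y) Q n))%N.
    by rewrite (@big_cat_nat _ _ _ n _ _ _ _ xn (ltnW ny))/= (big_ltn ny) Qn.
  rewrite size_cat; lia.
- by rewrite big_cat/= e1 e2 -scalerDr -seg_cat// (ltnW xn) (ltnW ny).
- rewrite count_cat; have := c1 k; have := c2 k; lia.
Qed.

(** An admissible family of [k] sets begins at [k.-1] or later, so [a := k.-1] is
    a lower bound for the beginnings and [a.+1] the number of summands. *)
Lemma norming_split d f : norming d.+1 f -> exists a Q P, splits d f a Q P.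
Proof.
move=> nf; suff H D : norming D f -> D = d.+1 -> exists a Q P, splits d f a Q P by exact: H nf _.
have split1 a (P : pred nat) : (forall n n', P n -> P n' -> n = n') ->
    forall u v, \sum_(u <= n < v) weight a pred0 P n <= 2.
  move=> P1 u v; rewrite big_split big_split/= big1 ?add0r; last first.
    by move=> n _; rewrite mul0r.
  rewrite -!natr_sum -natrD ler_nat (leq_add (n1 := 1) (n2 := 1))// sum_pred_le1//.
  by move=> n n' /eqP -> /eqP ->.
case=> [{}D|{}D n|{}D k E g aE ng gE].
- move=> _; exists 0%N, pred0, pred0; split=> // [|x y xy _]; first exact: split1.
  exists [::]; split=> //; rewrite big_nil (_ : seg x y 0 = 0) ?scaler0//.
  exact: crestr0.
- move=> _; exists n, pred0, (pred1 n); split=> // [|x y xy nP].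
    by apply: split1 => i i' /eqP -> /eqP ->.
  exists [::]; split=> //; rewrite big_nil (_ : seg x y _ = 0) ?scaler0//.
  apply: c00_eqP => i; rewrite segE cdeltaE; case: ifP => // xiy.
  by have := nP i xiy => /= /negbTE ->.
case=> Dd; subst D.
pose st i n := (g i n != 0) && [forall m : 'I_n, g i m == 0].
have stP i n : st i n -> g i n != 0 /\ forall m, (m < n)%N -> g i m = 0.
  move=> /andP[gn /forallP h]; split=> // m mn.
  exact/eqP/(h (Ordinal mn)).
have st1 i n n' : st i n -> st i n' -> n = n'.
  move=> /stP[g1 h1] /stP[g2 h2]; have [n'n|nn'|//] := ltngtP n n'.
    by move: g1; rewrite h2 ?eqxx.
  by move: g2; rewrite h1 ?eqxx.
have stex i m : g i m != 0 -> exists n, st i n /\ (n <= m)%N.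
  move=> gm; have ex : exists n, g i n != 0 by exists m.
  case: (ex_minnP ex) => n gn nmin; exists n; split; last exact: nmin.
  rewrite /st gn; apply/forallP => j; apply: contraTT (ltn_ord j) => /nmin.
  by rewrite -leqNgt.
have before i j m n : (i < j < k)%N -> g i m != 0 -> g j n != 0 -> (m < n)%N.
  move=> ijk gm gn; have /andP[ij jk] := ijk.
  by apply: (admissible_disj aE ijk); apply: gE => //; exact: ltn_trans ij jk.
pose Q : pred nat := fun n => [exists i : 'I_k, st i n].
have g0 i n : (i < k)%N -> 0 <= g i n by move=> ik; exact: norming_ge0 (ng i ik).
have fE n : (2^-1 *: \sum_(i < k) g i) n = 2^-1 * \sum_(i < k) g i n by rewrite c00Z c00sum.
have [k0 Efin Emin _] := aE.
exists k.-1, Q, pred0; split.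
- move=> n /existsP[i /stP[gn _]]; rewrite fE mulf_neq0 ?invr_eq0 ?pnatr_eq0//=; last first.
    rewrite gt_eqF// (bigD1 i)//= ltr_pwDl ?sumr_ge0// => [|j _]; last exact: g0.
    by rewrite lt_neqAle eq_sym gn g0.
  have Ei := gE i n (ltn_ord i) gn; have [i0|i0] := posnP i.
    by have := Emin n; rewrite -{1}i0 => /(_ Ei); lia.
  have [_ [c Ec]] := Efin 0%N k0; have := Emin c Ec.
  have := admissible_disj aE (i := 0) (j := i); rewrite i0 ltn_ord => /(_ isT c n Ec Ei).
  lia.
- move=> u v; rewrite big_split big_split/= [X in _ + X]big1 ?addr0// -mulr_suml prednK//.
  rewrite -!natr_sum (_ : 2 = 1 + 1)// lerD//; last first.
    by rewrite lern1 sum_pred_le1// => n n' /eqP -> /eqP ->.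
  rewrite ler_pdivrMr ?ltr0n// mul1r ler_nat.
  apply: (@leq_trans (\sum_(u <= n < v) \sum_(i < k) st i n)).
    apply: leq_sum => n _; rewrite /Q; case: existsP => // -[i sti].
    by rewrite (bigD1 i)//= sti.
  rewrite exchange_big/=; apply: (@leq_trans (\sum_(i < k) 1)).
    by apply: leq_sum => i _; apply: sum_pred_le1; exact: st1.
  by rewrite sum1_card card_ord.
move=> x y xy _; have [|L [L1 L2 L3 L4]] := @pieces d (2^-1 *: \sum_(i < k) g i) Q _ x y xy.
  move=> {xy}{}x {}y noQ; rewrite (_ : 2 *: _ = \sum_(i < k) seg x y (g i)); last first.
    by rewrite -crestr_sum -crestrZ scalerA divff ?scale1r// pnatr_eq0.
  have [[i [n [gn xny]]]|none] := pselect (exists i : 'I_k, exists n, g i n != 0 /\ (x <= n < y)%N); last first.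
    rewrite big1; first exact: norming_zero.
    move=> i _; apply: c00_eqP => n; rewrite segE; case: ifP => // xny; apply/eqP.
    by apply: contrapT => /negP gn; apply: none; exists i, n.
  have meet1 i1 i2 m1 m2 : (i1 < i2 < k)%N -> g i1 m1 != 0 -> g i2 m2 != 0 ->
      (x <= m1)%N -> (m2 < y)%N -> False.
    move=> i12 h1 h2 xm1 m2y; have /andP[_ i2k] := i12.
    have [m [sm mm2]] := stex _ _ h2; have [gm _] := stP _ _ sm.
    have := before _ _ _ _ i12 h1 gm => m1m.
    have := noQ m; rewrite (leq_ltn_trans xm1 m1m) (leq_ltn_trans mm2 m2y) => /(_ isT).
    by move=> /existsP; apply; exists (Ordinal i2k).
  have /andP[xn ny] := xny.
  rewrite (bigD1 i)//= big1 ?addr0; first by apply: norming_restr; exact: ng.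
  move=> j ji; apply: c00_eqP => m; rewrite segE; case: ifP => // /andP[xm my].
  apply/eqP; apply: contrapT => /negP gm; move: ji; rewrite -val_eqE neq_ltn => /orP[h|h].
    by apply: (meet1 j i m n); rewrite ?h ?ltn_ord.
  by apply: (meet1 i j n m); rewrite ?h ?ltn_ord.
exists L; split=> // [|n]; last by rewrite (leq_trans (L4 n))//; case: (_ != 0%R) => /=; case: (x <= n < y)%N.
rewrite (leq_trans L2)// leq_add2l; move: xy; rewrite leq_eqVlt => /predU1P[->|xy].
  by rewrite big_geq.
by rewrite [leqRHS]big_ltn// leq_addl.
Qed.

End Segments.

(** * Partitions into intervals *)

Section Chop.
Variable R : realType.
Local Notation C := (c00 R).
Local Notation tau := (@tsirelson_norm R).
Variable b : C.
Hypothesis b0 : forall n, 0 <= b n.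

(** [chop M u v s] bounds [s] by the norms of the pieces into which [b] is cut
    along a partition of [u, v) into [M] consecutive intervals. *)
Inductive chop : nat -> nat -> nat -> R -> Prop :=
| chop_nil u s : s <= 0 -> chop 0 u u s
| chop_step M u v w s s' : chop M u v s -> (v <= w)%N ->
    s' <= s + tau (seg v w b) -> chop M.+1 u w s'.

Let tau0 : tau 0 = 0. Proof. exact: ln0 (tau_lattice R). Qed.
Let tau_ge0 x : 0 <= tau x. Proof. exact: ln_ge0 (tau_lattice R) x. Qed.

Lemma chop_le M u v s s' : chop M u v s -> s' <= s -> chop M u v s'.
Proof.
case=> [{}u {}s s0 ss|{}M {}u {}v w s1 s2 h vw s21 ss].
  exact: chop_nil (le_trans ss s0).
exact: chop_step h vw (le_trans ss s21).
Qed.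

Lemma chop_widen M M' u v s : chop M u v s -> (M <= M')%N -> chop M' u v s.
Proof.
move=> h /subnK <-; elim: (_ - _)%N => // k IH; rewrite addSn.
by apply: chop_step IH (leqnn v) _; rewrite lerDl.
Qed.

Lemma chop_cat M M' u v w s s' : chop M u v s -> chop M' v w s' ->
  chop (M' + M) u w (s + s').
Proof.
move=> h h'; elim: h' h => [{}v {}s' s0|{}M' {}v x {}w s1 s2 _ IH xw s21] h.
  by apply: chop_le h _; rewrite gerDl.
rewrite addSn; apply: chop_step (IH h) xw _.
by rewrite -addrA lerD2l.
Qed.

Lemma chop1 u v s : (u <= v)%N -> s <= tau (seg u v b) -> chop 1 u v s.
Proof.
move=> uv h; apply: (@chop_step 0 u u v 0) => //; last by rewrite add0r.
exact: chop_nil.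
Qed.

Let chop_cuts M u v s : chop M u v s -> exists N (c : nat -> nat),
  [/\ (N <= M)%N, c 0%N = u, c N = v, forall j, (j < N)%N -> (c j < c j.+1)%N &
      s <= \sum_(j < N) tau (seg (c j) (c j.+1) b)].
Proof.
elim=> [{}u {}s s0|{}M {}u {}v w s1 s2 _ [N [c [NM c0 cN cS sc]]] vw s21].
  by exists 0%N, (fun=> u); split=> //; rewrite big_ord0.
move: vw; rewrite leq_eqVlt => /predU1P[vw|vw].
  exists N, c; split=> //; [exact: leqW|by rewrite -vw|].
  by move: s21; rewrite vw seg_empty tau0 addr0 => /le_trans; apply.
exists N.+1, (fun j => if (j <= N)%N then c j else w); split=> // [|j|].
- by rewrite ltnn.
- rewrite ltnS => jN; rewrite jN; case: ifP => [|/negbT]; first exact: cS.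
  by rewrite -ltnNge ltnS => Nj; rewrite (_ : j = N) ?cN//; apply/eqP; rewrite eqn_leq jN.
- rewrite big_ord_recr/= leqnn ltnn cN (le_trans s21)// lerD2r (le_trans sc)//.
  by apply: ler_sum => j _; rewrite (ltn_ord j) (ltnW (ltn_ord j)).
Qed.

(** The nonempty ones among the intervals form an admissible family. *)
Lemma chop_tau M u v s : chop M u v s -> (M <= u.+1)%N -> s <= 2 * tau (seg u v b).
Proof.
move=> /chop_cuts[N [c [NM c0 cN cS sc]]] Mu.
have [N0|N0] := posnP N.
  by rewrite (le_trans sc)// N0 big_ord0 mulr_ge0.
have mono i j : (i <= j <= N)%N -> (c i <= c j)%N.
  elim: j => [|j IH]; first by rewrite leqn0 => /andP[/eqP ->].
  move=> /andP[]; rewrite leq_eqVlt => /predU1P[->//|ij] jN.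
  by rewrite (leq_trans (IH _)) ?(ltnW (cS _ _))// -ltnS ij/= ltnW.
have adm : admissible N (fun j => [set n | (c j <= n < c j.+1)%N]).
  split=> // [i iN|j /= /andP[h _]|i iN x y /= /andP[_ xi] /andP[iy _]].
  - split; last by exists (c i) => /=; rewrite leqnn cS.
    apply: (@sub_finite_set _ _ `I_(c i.+1)) => [n /andP[]//|].
    exact: finite_II.
  - by rewrite (leq_trans NM)// (leq_trans Mu)// ltnS -c0.
  - exact: leq_trans xi iy.
apply: (le_trans sc); apply: le_trans (tau_admissible (seg u v b) adm).
apply: ler_sum => j _; rewrite le_eqVlt; apply/orP; left; apply/eqP; congr tau.
apply: c00_eqP => n; rewrite -[crestr _ (seg u v b)]/(seg (c j) (c j.+1) (seg u v b)) !segE.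
case: ifP => // /andP[cn nc].
have uj : (u <= c j)%N by rewrite -c0 mono//= ltnW.
have jv : (c j.+1 <= v)%N by rewrite -cN mono// leqnn andbT.
by rewrite (leq_trans uj cn) (leq_trans nc jv).
Qed.

(** The singletons of a dyadic block form an admissible family. *)
Lemma tau_dyadic x y : (x <= y)%N -> (y <= 2 * x + 1)%N ->
  \sum_(x <= n < y) b n <= 2 * tau (seg x y b).
Proof.
rewrite leq_eqVlt => /predU1P[<- _|xy yx].
  by rewrite big_geq// mulr_ge0.
have adm : admissible (y - x) (fun j => [set (x + j)%N]).
  split=> [|i _|j /= ->|i _ p q /= -> ->]; [lia| |lia|lia].
  by split; [exact: finite_set1|exists (x + i)%N].
apply: le_trans (tau_admissible (seg x y b) adm).
rewrite -{1}[x]add0n big_addn big_mkord; apply: ler_sum => i _.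
rewrite (le_trans _ (tau_coord _ (x + i)))// crestrE mem_set// segE.
rewrite leq_addr/= (_ : (x + i < y)%N) ?ger0_norm 1?addnC//.
by have := ltn_ord i; lia.
Qed.

Lemma chop_dyadic t u y : (u <= y)%N -> (y.+1 <= 2 ^ t * u.+1)%N ->
  chop t u y (2^-1 * \sum_(u <= n < y) b n).
Proof.
elim: t y => [|t IH] y uy yt.
  have -> : y = u by move: yt; rewrite expn0; lia.
  by apply: chop_nil; rewrite big_geq// mulr0.
have p0 : (0 < 2 ^ t)%N by rewrite expn_gt0.
pose z := minn y (2 ^ t * u.+1).-1.
have uz : (u <= z)%N.
  rewrite leq_min uy/= -ltnS prednK ?muln_gt0 ?p0//.
  by rewrite leq_pmull.
have zy : (z <= y)%N by exact: geq_minl.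
have h := IH z uz ltac:(by rewrite /z; lia).
apply: (chop_step h zy).
have -> : \sum_(u <= n < y) b n = \sum_(u <= n < z) b n + \sum_(z <= n < y) b n.
  by rewrite (@big_cat_nat _ _ _ z).
rewrite mulrDr lerD2l ler_pdivrMl//.
by apply: tau_dyadic => //; move: yt; rewrite /z expnS; lia.
Qed.

(** The supports are pairwise disjoint. *)
Definition packed (F : seq C) : Prop :=
  forall n, (count (fun f : C => f n != 0%R) F <= 1)%N.

Definition total (F : seq C) u v : R := \sum_(f <- F) pair f (seg u v b).

Lemma total_cat F u v w : (u <= v <= w)%N ->
  total F u w = total F u v + total F v w.
Proof.
move=> uvw; rewrite /total -big_split/=; apply: eq_bigr => f _.
by rewrite (seg_cat _ uvw) pairD.
Qed.

Lemma total_le d F u v : (u <= v)%N -> (forall f, f \in F -> norming d f) ->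
  packed F -> total F u v <= \sum_(u <= n < v) b n.
Proof.
move=> uv nF pF; rewrite /total; under eq_bigr do rewrite pair_seg//.
rewrite exchange_big/=; apply: ler_sum => n _; rewrite -mulr_suml ler_piMl//.
apply: (@le_trans _ _ (count (fun f : C => f n != 0%R) F)%:R); last first.
  by rewrite (ler_nat R _ 1%N).
rewrite -sum1_count natr_sum [leRHS]big_mkcond/= big_seq [leRHS]big_seq; apply: ler_sum => f fF.
by have := norming_le1 n (nF f fF); case: eqP => [->|].
Qed.

(** A greedy partition: every step uses 8 intervals and either reaches the end or
    consumes weight at least one. *)
Lemma chop_greedy (w : nat -> R) (val : nat -> nat -> R) u0 v :
  (forall n, 0 <= w n) ->
  (forall x y z, (x <= y <= z)%N -> val x z = val x y + val y z) ->
  (forall u, (u0 <= u < v)%N -> exists y, [/\ (u < y <= v)%N, chop 8 u y (val u y) &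
     y = v \/ 1 <= \sum_(u <= n < y) w n]) ->
  forall u, (u0 <= u <= v)%N -> exists M, chop M u v (val u v) /\
    M%:R <= 8 * (1 + \sum_(u <= n < v) w n).
Proof.
move=> w0 vD step u; move: {2}(v - u).+1 (ltnSn (v - u)) => k.
elim: k u => // k IH u uk /andP[u0u].
have v0 x : val x x = 0.
  by apply: (@addrI _ (val x x)); rewrite addr0 -vD// !leqnn.
rewrite leq_eqVlt => /predU1P[->|uv].
  exists 0%N; split; first by apply: chop_nil; rewrite v0.
  by rewrite big_geq// addr0 mulr1 ler0n.
have [|y [/andP[uy yv] hy]] := step u; first by rewrite u0u.
case=> [yE|w1].
  exists 8%N; rewrite -yE; split=> //.
  by rewrite ler_peMr// lerDl sumr_ge0.
have [||M [hM Mw]] := IH y; first lia.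
  by rewrite yv andbT (leq_trans u0u)// ltnW.
exists (M + 8)%N; split.
  by rewrite (vD u y v) ?(ltnW uy)//; apply: chop_cat hy hM.
have -> : \sum_(u <= n < v) w n = \sum_(u <= n < y) w n + \sum_(y <= n < v) w n.
  by rewrite (@big_cat_nat _ _ _ y)// ltnW.
rewrite natrD; lra.
Qed.

End Chop.

(** * Disjoint families of norming functionals *)

Section DisjointFamilies.
Variable R : realType.
Local Notation C := (c00 R).
Local Notation tau := (@tsirelson_norm R).

Lemma weight_ge0 a (Q P : pred nat) n : 0 <= weight R a Q P n.
Proof. by rewrite !addr_ge0 ?divr_ge0. Qed.

Let count_sum (T : Type) (p : pred T) (s : seq T) : count p s = (\sum_(i <- s) p i)%N.
Proof.
by rewrite -sum1_count big_mkcond/=; apply: eq_bigr => i _; case: (p i).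
Qed.

Let norming0 f : norming 0 f -> f = 0 :> C.
Proof. by move: {-1}0%N (erefl 0%N) => d + nf; case: nf. Qed.

Section Step.
Variables (b : C) (d : nat).
Hypothesis b0 : forall n, 0 <= b n.
Hypothesis IH : forall m u v (F : seq C), (forall f, f \in F -> norming d f) ->
  packed F -> (size F <= 2 * m)%N -> (64 * m <= u.+1)%N -> (u <= v)%N ->
  exists M, (M <= 8 * (2 * size F + 1))%N /\ chop b M u v (total b F u v).
Variables (F : seq C) (A : C -> nat) (Q P : C -> pred nat).
Hypothesis spl : forall f, f \in F -> splits d f (A f) (Q f) (P f).
Hypothesis nF : forall f, f \in F -> norming d.+1 f.
Hypothesis pF : packed F.

Let q n := (\sum_(f <- F) Q f n)%N.

Lemma starts_le1 n : (q n <= 1)%N.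
Proof.
apply: leq_trans (pF n); rewrite count_sum /q !big_seq; apply: leq_sum => f fF.
by have [Qf _ _] := spl fF; case: (boolP (Q f n)) => // /Qf /andP[->].
Qed.

(** At most [2 * u.+1] summands meet the block.  Up to the index [64 * u.+1] they
    are dominated by the sum of the coordinates, hence by six dyadic blocks, and
    beyond it the induction hypothesis applies to them. *)
Lemma chop_block u y : (size F <= u.+1)%N -> (u <= y)%N ->
  (\sum_(u <= n < y) q n <= u.+1)%N ->
  (forall f, f \in F -> forall n, (u <= n < y)%N -> ~~ P f n) ->
  chop b 7 u y (total b F u y).
Proof.
move=> Fu uy cnt nP.
have /choice[K hK] : forall f, exists L : seq C, f \in F ->
    [/\ forall g, g \in L -> norming d g,
        (size L <= 1 + \sum_(u <= n < y) Q f n)%N,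
        \sum_(g <- L) g = 2 *: seg u y f &
        forall n, (count (fun g : C => g n != 0%R) L <= (f n != 0%R))%N].
  move=> f; have [fF|_] := boolP (f \in F); last by exists [::].
  have [_ _ /(_ u y uy (nP f fF))[L hL]] := spl fF; by exists L.
pose L := flatten [seq K f | f <- F].
have nL g : g \in L -> norming d g.
  by move=> /flatten_mapP[f fF]; have [h _ _ _] := hK f fF; exact: h.
have sL : (size L <= 2 * u.+1)%N.
  rewrite size_flatten sumnE /shape !big_map.
  apply: (@leq_trans (\sum_(f <- F) (1 + \sum_(u <= n < y) Q f n))).
    by rewrite !big_seq; apply: leq_sum => f fF; have [] := hK f fF.
  rewrite big_split/= sum1_size exchange_big/= mul2n -addnn leq_add//.
have pL : packed L.
  move=> n; apply: leq_trans (pF n); rewrite count_flatten sumnE !big_map count_sum.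
  by rewrite !big_seq; apply: leq_sum => f fF; have [] := hK f fF.
have FL : total b F u y = 2^-1 * total b L u y.
  rewrite /total big_flatten big_map mulr_sumr !big_seq; apply: eq_bigr => f fF.
  have [_ _ LE _] := hK f fF.
  rewrite -pair_sum_fun LE pairZ_fun mulKf ?pnatr_eq0//.
  by apply: pair_eq => n; rewrite !segE; case: ifP; rewrite ?mulr0.
pose z := minn y (64 * u.+1).-1.
have uz : (u <= z)%N by rewrite /z; lia.
have zy : (z <= y)%N by exact: geq_minl.
have c6 : chop b 6 u z (2^-1 * total b L u z).
  apply: (@chop_le _ _ _ _ _ (2^-1 * \sum_(u <= n < z) b n)).
    by apply: chop_dyadic => //; rewrite /z (_ : 2 ^ 6 = 64)%N//; lia.
  by rewrite ler_pM2l// (total_le b0 uz nL pL).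
rewrite FL (@total_cat _ _ _ _ z) ?uz// mulrDr.
apply: (@chop_cat _ _ _ 1 _ _ _ _ _ c6).
apply: chop1 => //; rewrite ler_pdivrMl//.
move: zy; rewrite leq_eqVlt => /predU1P[->|zy].
  rewrite /total big1 ?mulr_ge0 ?(ln_ge0 (tau_lattice R))// => g _.
  by rewrite seg_empty pair0.
have zE : z.+1 = (64 * u.+1)%N by move: zy; rewrite /z; lia.
have [|M [ML cM]] := IH nL pL sL _ (ltnW zy); first by rewrite zE.
by apply: (chop_tau cM); rewrite zE (leq_trans ML)//; lia.
Qed.

Let w n : R := \sum_(f <- F) weight R (A f) (Q f) (P f) n.

Let w0 n : 0 <= w n.
Proof. by rewrite /w sumr_ge0// => f _; exact: weight_ge0. Qed.

Let wle f n u y : f \in F -> (u <= n < y)%N ->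
  1 <= weight R (A f) (Q f) (P f) n -> 1 <= \sum_(u <= n < y) w n.
Proof.
move=> fF nuy h; rewrite (le_trans h)//.
apply: (@le_trans _ _ (w n)).
  by rewrite /w (big_rem f)//= lerDl sumr_ge0// => g _; exact: weight_ge0.
rewrite (bigD1_seq n)/= ?mem_index_iota ?iota_uniq//.
by rewrite lerDl sumr_ge0.
Qed.

(** Either some [A f] lies inside the block, or all summands that begin there
    belong to functionals with at most [u] summands and weigh at least
    [1 / u.+1] each. *)
Lemma block_weight u y : (u <= y)%N -> (u.+1 <= \sum_(u <= n < y) q n)%N ->
  1 <= \sum_(u <= n < y) w n.
Proof.
move=> uy cnt.
have [[f [fF Af]]|none] := pselect (exists f, f \in F /\ (u <= A f < y)%N).
  apply: (wle (f := f) (n := A f)) => //; rewrite /weight eqxx addrAC lerDr.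
  by rewrite addr_ge0 ?divr_ge0.
apply: (@le_trans _ _ ((\sum_(u <= n < y) q n)%:R / u.+1%:R)).
  by rewrite ler_pdivlMr ?ltr0n// mul1r ler_nat.
rewrite natr_sum mulr_suml big_nat [leRHS]big_nat; apply: ler_sum => n nuy.
rewrite /q natr_sum mulr_suml /w big_seq [leRHS]big_seq; apply: ler_sum => f fF.
rewrite /weight -addrA; case: (boolP (Q f n)) => [Qn|_]; last first.
  by rewrite !mul0r add0r addr_ge0.
apply: (@le_trans _ _ (1 / (A f).+1%:R)); last by rewrite lerDl addr_ge0.
rewrite !mul1r lef_pV2 ?posrE ?ltr0n// ler_nat ltnS leqNgt; apply/negP => uA.
apply: none; exists f; split=> //; rewrite (ltnW uA)/=.
have [Qf _ _] := spl fF; have /andP[_ An] := Qf n Qn.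
by have /andP[_ ny] := nuy; exact: leq_ltn_trans An ny.
Qed.

(** A greedy block ends after [u.+1] beginnings of summands or just after a
    coordinate functional, and each functional has total weight at most two. *)
Lemma chop_family u0 v : (size F <= u0.+1)%N -> (u0 <= v)%N ->
  exists M, (M <= 8 * (2 * size F + 1))%N /\ chop b M u0 v (total b F u0 v).
Proof.
move=> Fu uv.
have [|u /andP[u0u uv']||M [hM Mw]] := @chop_greedy R b w (total b F) u0 v w0 _ _ u0.
- by move=> x y z xyz; exact: total_cat.
- pose lf n := has (fun f => P f n) F.
  pose stop y := (u < y)%N && ((u.+1 <= \sum_(u <= n < y) q n)%N || lf y.-1).
  have noleaf y : (forall k, (u < k < y)%N -> ~~ stop k) ->
      forall f, f \in F -> forall n, (u <= n < y.-1)%N -> ~~ P f n.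
    move=> ns f fF n nuy; apply/negP => Pn.
    have := ns n.+1 ltac:(lia); rewrite /stop negb_and negb_or => /orP[|/andP[_]].
      by rewrite ltnS; case/andP: nuy => ->.
    by move=> /hasPn/(_ f fF); rewrite /= Pn.
  have few y : (u < y)%N -> (forall k, (u < k < y)%N -> ~~ stop k) ->
      (\sum_(u <= n < y.-1) q n <= u)%N.
    move=> uy ns; have [yu|] := leqP y.-1 u; first by rewrite big_geq.
    move=> uy1; have := ns y.-1 ltac:(lia); rewrite /stop uy1/= negb_or -ltnNge.
    by case/andP.
  have Fu' : (size F <= u.+1)%N by exact: leq_trans Fu _.
  have [[y0 [sy0 y0v]]|none] := pselect (exists y, stop y /\ (y <= v)%N); last first.
    have ns k : (u < k < v.+1)%N -> ~~ stop k.
      by move=> /andP[uk kv]; apply/negP => sk; apply: none; exists k.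
    exists v; split; [by rewrite uv' leqnn| |by left].
    apply: (@chop_widen _ _ 7) => //; apply: chop_block => //; first exact: ltnW.
      exact: leqW (few v.+1 (leqW uv') ns).
    exact: noleaf ns.
  have ex : exists y, stop y by exists y0.
  case: (ex_minnP ex) => y sy ymin.
  have ns k : (u < k < y)%N -> ~~ stop k.
    by move=> /andP[_ ky]; apply/negP => /ymin; rewrite leqNgt ky.
  have /andP[uy sy'] := sy.
  have yv : (y <= v)%N by rewrite (leq_trans (ymin _ sy0)).
  have y1 : y = y.-1.+1 by rewrite prednK// (leq_trans _ uy).
  have uy1 : (u <= y.-1)%N by rewrite -ltnS -y1.
  have yy : (y.-1 < y)%N by rewrite prednK// (leq_trans _ uy).
  exists y; split; [by rewrite uy yv| |right].
    have [leaf|nleaf] := boolP (lf y.-1).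
      rewrite (@total_cat _ _ _ u y.-1 y) ?uy1 ?leq_pred//.
      apply: (@chop_cat _ _ 7 1).
        apply: chop_block => //; last exact: noleaf ns.
        exact: leqW (few y uy ns).
      apply: chop1; first exact: leq_pred.
      apply: (le_trans (total_le b0 (leq_pred y) nF pF)).
      rewrite [in leLHS]y1 big_nat1 (le_trans _ (tau_coord _ y.-1))//.
      by rewrite segE leqnn yy ger0_norm.
    apply: (@chop_widen _ _ 7) => //; apply: chop_block => //; first exact: ltnW.
      rewrite y1 big_nat_recr//= -addn1 leq_add ?starts_le1//.
      exact: few uy ns.
    move=> f fF n /andP[un]; rewrite {1}y1 ltnS leq_eqVlt => /predU1P[->|ny].
      by apply/negP => Pn; move/hasP : nleaf; apply; exists f.
    by apply: (noleaf y ns f fF); rewrite un.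
  move: sy' => /orP[cnt|/hasP[f fF /= Pf]]; first exact: block_weight (ltnW uy) cnt.
  apply: (wle (f := f) (n := y.-1)) => //; first by rewrite uy1 yy.
  by rewrite /weight Pf lerDr addr_ge0 ?divr_ge0.
- by rewrite leqnn.
exists M; split=> //; rewrite -(ler_nat R) (le_trans Mw)// natrM ler_pM2l ?ltr0n//.
rewrite natrD addrC lerD2r natrM exchange_big/=.
apply: (@le_trans _ _ (\sum_(f <- F) 2)).
  by rewrite big_seq [leRHS]big_seq; apply: ler_sum => f fF; have [_ h _] := spl fF.
by rewrite big_const_seq count_predT iter_addr_0 mulr_natr.
Qed.

End Step.

(** Since the number of intervals depends only on the size of the family, not on
    the depth, no constant is lost in the induction on the depth. *)
Lemma packed_chop (b : C) d : (forall n, 0 <= b n) ->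
  forall m u v (F : seq C), (forall f, f \in F -> norming d f) ->
  packed F -> (size F <= 2 * m)%N -> (64 * m <= u.+1)%N -> (u <= v)%N ->
  exists M, (M <= 8 * (2 * size F + 1))%N /\ chop b M u v (total b F u v).
Proof.
move=> b0; elim: d => [|d IH] m u v F nF pF Fm mu uv.
  exists 1%N; split; first lia.
  apply: chop1 => //; rewrite /total big_seq big1 ?(ln_ge0 (tau_lattice R))//.
  move=> f /nF /norming0 ->; rewrite /pair big1// => n _; exact: mul0r.
have /choice[t ht] : forall f : C, exists t : (nat * (nat -> bool) * (nat -> bool))%type,
    norming d.+1 f -> splits d f t.1.1 t.1.2 t.2.
  move=> f; have [nf|nf] := pselect (norming d.+1 f); last by exists (0%N, xpred0, xpred0).
  by have [a [Q [P h]]] := norming_split nf; exists (a, Q, P).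
apply: (chop_family (A := fun f => (t f).1.1) (Q := fun f => (t f).1.2)
  (P := fun f => (t f).2) b0 IH _ nF) => // [f fF|]; first by apply: ht; exact: nF.
by lia.
Qed.

(** The functionals norming the parts have disjoint supports, and the
    [8 * (2 * (2 * m) + 1)] intervals of [packed_chop] are few enough to be
    admissible beyond [64 * m]. *)
Lemma tau_disjoint m (x : C) (c : nat -> nat) : (0 < m)%N ->
  (forall n, (n.+1 < 64 * m)%N -> x n = 0) ->
  \sum_(i < 2 * m) tau (crestr [set n | c n = i] x) <= 2 * tau x.
Proof.
move=> m0 x0; apply/ler_addgt0Pr => e e0.
pose N := (2 * m)%N; have N0 : 0 < N%:R :> R by rewrite ltr0n /N; lia.
pose y i := crestr [set n | c n = i] x.
have eN : 0 < e / N%:R by rewrite divr_gt0.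
have /choice[t ht] i : exists t : nat * C, norming t.1 t.2 /\
    tau (y i) - e / N%:R <= pair t.2 (cabs (y i)).
  by have [d [f h]] := norming_approx (y i) eN; exists (d, f).
pose D := (\max_(i < N) (t i).1)%N.
pose G i := crestr [set n | c n = i] (t i).2.
pose F := [seq G i | i <- iota 0 N].
have nF f : f \in F -> norming D f.
  move=> /mapP[i]; rewrite mem_iota add0n => /andP[_ iN] ->.
  apply: norming_restr; apply: norming_mono (ht i).1 _.
  exact: (leq_bigmax (Ordinal iN)).
have pF : packed F.
  move=> n; rewrite count_map (@leq_trans (count (pred1 (c n)) (iota 0 N)))//.
    apply: sub_count => i; rewrite -[is_true _]/(is_true (G i n != 0)) crestrE; case: ifP => [|_]; last by rewrite eqxx.
    by move=> /set_mem/= <- _; exact: eqxx.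
  by rewrite count_uniq_mem ?iota_uniq ?leq_b1.
pose u := (64 * m).-1; pose v := maxn u (bnd x).
have b0 n : 0 <= cabs x n by rewrite cabsE.
have sF : size F = N by rewrite size_map size_iota.
have [|||M [MF hM]] := packed_chop b0 (m := m) (u := u) (v := v) nF pF.
- by rewrite sF.
- by rewrite /u; lia.
- exact: leq_maxl.
have := chop_tau hM; rewrite sF in MF; move=> /(_ ltac:(rewrite /u; lia)) h.
have h2 : total (cabs x) F u v <= 2 * tau x.
  rewrite (le_trans h)// ler_pM2l//; apply: (ln_mono (tau_lattice R)) => n.
  by rewrite segE cabsE; case: ifP; rewrite ?normr_id ?normr0.
suff : \sum_(i < N) tau (y i) - e <= total (cabs x) F u v by rewrite lerBlDr => /le_trans; apply; rewrite lerD2r.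
rewrite /total big_map.
have -> : iota 0 N = index_iota 0 N by rewrite /index_iota subn0.
rewrite big_mkord.
have -> : e = \sum_(i < N) e / N%:R.
  by rewrite sumr_const card_ord -[RHS]mulr_natr divfK// gt_eqF.
rewrite -sumrB; apply: ler_sum => i _; rewrite (le_trans (ht i).2)// le_eqVlt.
apply/orP; left; apply/eqP; apply: pair_eq => n.
rewrite segE !cabsE /y /G !crestrE; case: ifP => [_|]; last by rewrite normr0 mulr0 mul0r.
case: ifP => // /negbT; rewrite negb_and -!ltnNge ltnS => /orP[nu|vn].
  by rewrite x0 ?normr0//; move: nu; rewrite /u; lia.
by rewrite (@bndP _ x n) ?normr0//; move: vn; rewrite geq_max => /andP[].
Qed.

End DisjointFamilies.

(** * A lower estimate far out *)

Section LowerEstimate.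
Variable R : realType.
Local Notation C := (c00 R).
Local Notation tau := (@tsirelson_norm R).
Implicit Types x : C.

Let tau_ge0 x : 0 <= tau x. Proof. exact: ln_ge0 (tau_lattice R) x. Qed.

Lemma tau_restr A x : tau (crestr A x) <= tau x.
Proof.
apply: (ln_mono (tau_lattice R)) => n; rewrite crestrE.
by case: ifP; rewrite ?normr0.
Qed.

(** [tau_disjoint] with [m := 4]: eight parts of norm above a quarter would add up
    to more than twice the norm. *)
Lemma tau_quarter x (c : nat -> nat) : (forall n, (n < 255)%N -> x n = 0) ->
  exists2 i, (i < 8)%N & tau (crestr [set n | c n = i] x) <= tau x / 4.
Proof.
move=> x0; apply: contrapT => H.
have gt i : (i < 8)%N -> tau x / 4 < tau (crestr [set n | c n = i] x).
  by move=> i8; rewrite ltNge; apply/negP => h; apply: H; exists i.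
have := @tau_disjoint R 4 x c isT (fun n n1 => x0 n n1).
rewrite (_ : 2 * 4 = 8)%N// !big_ord_recr big_ord0/=.
have := gt 0%N isT; have := gt 1%N isT; have := gt 2%N isT; have := gt 3%N isT.
have := gt 4%N isT; have := gt 5%N isT; have := gt 6%N isT; have := gt 7%N isT.
lra.
Qed.

(** The colours are grouped into eight classes, and [tau_quarter] is applied
    repeatedly. *)
Lemma tau_quarter_iter k x (c : nat -> nat) : (forall n, (n < 255)%N -> x n = 0) ->
  exists2 i, (i < 8 ^ k)%N & tau (crestr [set n | c n = i] x) <= tau x / 4 ^+ k.
Proof.
elim: k x c => [|k IH] x c x0.
  by exists 0%N => //; rewrite expr0 divr1 tau_restr.
have [j j8 hj] := tau_quarter (fun n => c n %/ 8 ^ k)%N x0.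
set y := crestr _ x in hj.
have [i ik hi] : exists2 i, (i < 8 ^ k)%N &
    tau (crestr [set n | (c n %% 8 ^ k)%N = i] y) <= tau y / 4 ^+ k.
  by apply: (IH y) => n n0; rewrite crestrE x0// if_same.
exists (j * 8 ^ k + i)%N.
  apply: (@leq_trans (j.+1 * 8 ^ k)); first by rewrite mulSn addnC ltn_add2r.
  by rewrite expnS leq_mul2r j8 orbT.
rewrite (_ : crestr _ x = crestr [set n | (c n %% 8 ^ k)%N = i] y); last first.
  apply: c00_eqP => n; rewrite !crestrE; have p0 : (0 < 8 ^ k)%N by rewrite expn_gt0.
  case: ifPn => [/set_mem/= cn|nc]; first by
    rewrite !mem_set//= cn ?divnMDl// ?modnMDl ?divn_small ?modn_small ?addn0.
  case: ifPn => // /set_mem/= cm; case: ifPn => // /set_mem/= cd.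
  by move: nc; rewrite mem_set//= -cm -cd -divn_eq.
by rewrite (le_trans hi)// exprS invfM mulrA ler_wpM2r.
Qed.

Lemma tau_count k x (c : nat -> nat) n : (forall n, (n < 255)%N -> x n = 0) ->
  (count (fun i => (tau x / 4 ^+ k < tau (crestr [set m | c m = i] x))%R) (iota 0 n)
     < 8 ^ k)%N.
Proof.
move=> x0; rewrite -size_filter ltnNge; apply/negP; set s := [seq _ <- _ | _] => ss.
have [i ik hi] := tau_quarter_iter k (fun m => index (c m) s) x0.
have is_ : (i < size s)%N by exact: leq_trans ik ss.
have : nth 0%N s i \in s by exact: mem_nth.
rewrite mem_filter => /andP[+ _]; rewrite ltNge => /negP; apply.
rewrite (_ : [set m | c m = nth 0%N s i] = [set m | index (c m) s = i])//.
apply/seteqP; split=> m /= h.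
  by rewrite h index_uniq// filter_uniq// iota_uniq.
by rewrite -h nth_index// -index_mem h.
Qed.

Let dyadic_square (a : R) K : 0 <= a <= 1 ->
  a ^+ 2 <= \sum_(k < K) (4 ^- k.+1 < a)%R%:R / 16 ^+ k + 16 ^- K.
Proof.
move=> /andP[a0 a1]; have p16 k : 0 < 16 ^- k :> R by rewrite invr_gt0 exprn_gt0.
elim: K => [|K IH]; first by rewrite big_ord0 add0r expr0 invr1 expr_le1.
rewrite big_ord_recr/=; case: ltP => h.
  by rewrite mul1r (le_trans IH)// lerDl ltW.
rewrite mul0r addr0; apply: (@le_trans _ _ (16 ^- K.+1)); last first.
  by rewrite lerDr sumr_ge0// => k _; rewrite mulr_ge0// ltW.
have -> : 16 ^- K.+1 = (4 ^- K.+1) ^+ 2 :> R.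
  have -> : 16 = 4 ^+ 2 :> R by rewrite -natrX.
  by rewrite -!exprVn -!exprM mulnC.
by rewrite lerXn2r// nnegrE invr_ge0 exprn_ge0.
Qed.

(** Fewer than [8 ^ k] parts exceed [4 ^- k], and the series of the
    [8 ^ k.+1 / 16 ^ k] has sum 16; the remaining 1 accounts for truncating it. *)
Lemma tau_lower2 x (c : nat -> nat) n : (forall n, (n < 255)%N -> x n = 0) ->
  tau x <= 1 -> \sum_(i < n) tau (crestr [set m | c m = i] x) ^+ 2 <= 17.
Proof.
move=> x0 x1; pose a i := tau (crestr [set m | c m = i] x).
have a01 i : 0 <= a i <= 1 by rewrite tau_ge0 (le_trans (tau_restr _ _)).
have cnt k : \sum_(i < n) (4 ^- k.+1 < a i)%R%:R <= 8 ^+ k.+1 :> R.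
  rewrite -natr_sum -(natrX _ 8) ler_nat (leq_trans _ (ltnW (tau_count k.+1 c n x0)))//.
  rewrite -sum1_count [leqRHS]big_mkcond/=.
  have -> : iota 0 n = index_iota 0 n by rewrite /index_iota subn0.
  rewrite big_mkord; apply: leq_sum => i _.
  case: ltP => //= h; rewrite (_ : _ < _) ?(le_lt_trans _ h)//.
  by rewrite ler_piMl// invr_ge0 exprn_ge0.
apply: (@le_trans _ _ (\sum_(i < n)
    (\sum_(k < n) (4 ^- k.+1 < a i)%R%:R / 16 ^+ k + 16 ^- n))).
  by apply: ler_sum => i _; exact: (dyadic_square n (a01 i)).
rewrite big_split/= exchange_big/= sumr_const card_ord (_ : 17 = 16 + 1); last by ring.
apply: lerD.
  apply: (@le_trans _ _ (\sum_(k < n) 8 * 2 ^- k)).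
    apply: ler_sum => k _; rewrite -mulr_suml ler_pdivrMr ?exprn_gt0//.
    rewrite (le_trans (cnt k))// exprS -mulrA ler_pM2l//.
    have -> : 16 = 2 * 8 :> R by rewrite -natrM.
    by rewrite exprMn mulKf// expf_neq0.
  by rewrite -mulr_sumr; have := half_geometric R n; lra.
rewrite -[leLHS]mulr_natl ler_pdivrMr ?exprn_gt0// mul1r -natrX ler_nat.
by rewrite ltnW// ltn_expl.
Qed.

End LowerEstimate.

(** Disjoint pieces of a vector are its restrictions to the classes of a colouring
    of the coordinates. *)
Lemma spread_coloring (R : realType) (N0 : c00 R -> R) r s x : spread N0 r s x ->
  exists n (c : nat -> nat), (forall k, c k < n)%N /\
    s = \sum_(i < n) N0 (crestr [set k | c k = i] x) `^ r.
Proof.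
elim=> [y|{}s t {}x y xy _ [n [c [cn sE]]] _ [m [d [dm tE]]]].
  exists 1%N, (fun=> 0%N); split=> //; rewrite big_ord1; congr (N0 _ `^ r).
  by apply: c00_eqP => k; rewrite crestrE mem_set.
pose cd k := if x k != 0 then c k else (n + d k)%N.
exists (n + m)%N, cd; split=> [k|].
  by rewrite /cd; case: ifP => _; [rewrite (leq_trans (cn k)) ?leq_addr|rewrite ltn_add2l].
have yx k : x k != 0 -> y k = 0 by move=> xk; case: (xy k) => // h; rewrite h eqxx in xk.
rewrite big_split_ord sE tE; congr (_ + _); apply: eq_bigr => i _; congr (N0 _ `^ r).
  apply: c00_eqP => k; rewrite !crestrE c00D.
  have [xk|xk] := eqVneq (x k) 0.
    rewrite xk if_same memNset//= /cd xk eqxx/= => h.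
    by have := ltn_ord i; rewrite -h ltnNge leq_addr.
  rewrite yx// addr0; case: ifPn => [/set_mem/= h|h]; first by rewrite mem_set//= /cd xk.
  by rewrite memNset//= /cd xk => h'; move: h; rewrite mem_set.
apply: c00_eqP => k; rewrite !crestrE c00D.
have [xk|xk] := eqVneq (x k) 0.
  rewrite xk add0r; case: ifPn => [/set_mem/= h|h]; first by rewrite mem_set//= /cd xk eqxx/= h.
  by rewrite memNset//= /cd xk eqxx/= => /addnI h'; move: h; rewrite mem_set.
rewrite yx// if_same memNset//= /cd xk => h.
by have := cn k; rewrite h ltnNge leq_addr.
Qed.

(** * The dual of the Tsirelson space *)

(** The extension is the limit along a Cauchy sequence. *)
Lemma completion_functional (R : realType) (V : normedModType R) (phi : V -> R) (B : R) :
  linear phi -> (forall v, `|phi v| <= B * `|v|) ->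
  exists f : dual_space (completion V), forall v, f (to_completion v) = phi v.
Proof.
move=> phil phiB.
pose p : {linear V -> R} := HB.pack phi (GRing.isLinear.Build R V R *%R phi phil).
have pB (x : V) : `|p x| <= `|B| * `|x|.
  by rewrite (le_trans (phiB x))// ler_wpM2r// ler_norm.
have psub (x y : V) : p x - p y = p (x - y) by rewrite raddfB.
have B1 : 0 < `|B| + 1 by rewrite ltr_wpDl.
have pcvg (u : cauchy_seq V) : cvgn (fun n => p (u n)).
  apply/cauchy_cvgP/cauchyP => e e0.
  have /asboolP/cauchy_normP/(_ _ (divr_gt0 e0 B1))[N HN] := cseqP u.
  exists (p (u N)), N => // n /= Nn; rewrite -ball_normE/= psub.
  rewrite (le_lt_trans (pB _))//.
  apply: (@le_lt_trans _ _ (`|B| * (e / (`|B| + 1)))); first by rewrite ler_wpM2l// HN.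
  by rewrite mulrCA gtr_pMr// ltr_pdivrMr// mul1r ltrDl.
have ncvg (u : cauchy_seq V) : cvgn (fun n => `|u n|).
  apply/cauchy_cvgP/cauchyP => e e0.
  have /asboolP/cauchy_normP/(_ (e / 2) ltac:(by rewrite divr_gt0))[N HN] := cseqP u.
  exists `|u N|, N => // n /= Nn; rewrite -ball_normE/=.
  rewrite (le_lt_trans (ler_dist_dist _ _))// (le_lt_trans (HN _ _ _ _))//.
  by rewrite gtr_pMr// invf_lt1// ltr1n.
pose g (x : completion V) : R := limn (fun n => p (repr x n)).
have gE (u : cauchy_seq V) : g (lin_proj (null_seqs V) u) = limn (fun n => p (u n)).
  rewrite /g; set v := repr _.
  have vu : (v - u : cauchy_seq V) @ \oo --> (0 : V).
    by apply: (lin_projP (null_seqs V) v u).1; rewrite /v lin_projK.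
  have h : (fun n => p (v n) - p (u n)) @ \oo --> (0 : R).
    apply/cvgrPdist_le => e e0.
    move/cvgrPdist_le : vu => /(_ _ (divr_gt0 e0 B1)); apply: filterS => n /=.
    rewrite !sub0r !normrN psub => h; rewrite (le_trans (pB _))//.
    apply: (@le_trans _ _ (`|B| * (e / (`|B| + 1)))); first by rewrite ler_wpM2l.
    by rewrite mulrCA ger_pMr// ler_pdivrMr// mul1r lerDl.
  apply/eqP; rewrite -subr_eq0 -limB//; [|exact: pcvg..].
  by apply/eqP; exact: cvg_lim h.
have gl : linear g.
  move=> a x y; rewrite -[x]lin_projK -[y]lin_projK -linearP !gE.
  rewrite (_ : (fun n => p _) = (fun n => a * p (repr x n) + p (repr y n))).
    by apply/cvg_lim => //; apply: cvgD; [apply: cvgZr|]; exact: pcvg.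
  by apply/funext => n; rewrite -[LHS]/(p (a *: repr x n + repr y n)) linearP.
pose gL : {linear completion V -> R} :=
  HB.pack g (GRing.isLinear.Build R (completion V) R *%R g gl).
have gB x : `|gL x| <= `|B| * `|x|.
  rewrite -[`|x|]/(completion_norm x) /completion_norm -[gL x]/(g x) /g.
  have h1 : `|p (repr x n)| @[n --> \oo] --> `|limn (fun n => p (repr x n))|.
    by apply: cvg_norm; exact: pcvg.
  have h2 : (`|B| * `|repr x n|) @[n --> \oo] --> `|B| * limn (fun n => `|repr x n|).
    by apply: cvgZr; exact: ncvg.
  rewrite -(cvg_lim _ h1)// -(cvg_lim _ h2)//.
  apply: ler_lim; [exact: cvgP h1|exact: cvgP h2|].
  by apply: nearW => n; exact: pB.
have gP : g \in @is_functional R (completion V).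
  by apply/asboolP; split=> //; exact: (bounded_linear_cvg gB).
exists (Dual gP) => v; rewrite -[LHS]/(g _) /to_completion gE.
exact: (cvg_lim _ (cvg_cst (p v))).
Qed.

Lemma completion_dual_le (R : realType) (V : normedModType R)
    (f : dual_space (completion V)) (B : R) : 0 <= B ->
  (forall v, `|f (to_completion v)| <= B * `|v|) -> `|f| <= B.
Proof.
move=> B0 fB; apply: opnorm_le => x x1; apply/ler_addgt0Pr => e e0.
have D0 : 0 < B + `|f| + 1 by rewrite ltr_wpDl// addr_ge0.
pose d := e / (B + `|f| + 1); have d0 : 0 < d by rewrite divr_gt0.
have [v xv] := @to_completion_approx R V x d d0.
have -> : f x = f (to_completion v) + f (x - to_completion v).
  by rewrite linearB addrC subrK.
have h1 : `|v| <= 1 + d.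
  rewrite -to_completion_isometry -[to_completion v](subKr x) (le_trans (ler_normB _ _))//.
  exact: lerD.
have h2 : `|f (x - to_completion v)| <= `|f| * d.
  by rewrite (le_trans (opnorm_ub _ _))// ler_wpM2l// opnorm_ge0.
rewrite (le_trans (ler_normD _ _))// (le_trans (lerD (fB v) h2))//.
rewrite (le_trans (lerD (ler_wpM2l B0 h1) (lexx _)))//.
rewrite mulrDr mulr1 -addrA lerD2l -mulrDl.
apply: (@le_trans _ _ ((B + `|f| + 1) * d)); first by rewrite ler_pM2r// lerDl.
by rewrite /d mulrC divfK// gt_eqF.
Qed.

Section TsirelsonDual.
Variable R : realType.
Local Notation C := (c00 R).
Local Notation tau := (@tsirelson_norm R).
Local Notation Z := (dual_space (tsirelson_space R)).
Implicit Types (f : Z) (v w a : C).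

Let iota v : tsirelson_space R := to_completion (v : tsirelson_c00 R).

Let iota_linear : linear iota.
Proof. by move=> s v w; exact: (@to_completion_linear R (tsirelson_c00 R) s v w). Qed.

Let iotaD v w : iota (v + w) = iota v + iota w.
Proof. by rewrite -[v in LHS]scale1r iota_linear scale1r. Qed.

Let iota0 : iota 0 = 0.
Proof. by apply: (@addrI _ (iota 0)); rewrite -iotaD !addr0. Qed.

Let iotaZ (s : R) v : iota (s *: v) = s *: iota v.
Proof. by rewrite -[s *: v]addr0 iota_linear iota0 addr0. Qed.

Let iota_norm v : `|iota v| = tau v.
Proof. exact: to_completion_isometry. Qed.

Lemma coordinate_functional n : exists e : Z, forall v, e (iota v) = v n.
Proof.
have lin : linear (fun v : tsirelson_c00 R => (v : C) n) by [].
apply: (completion_functional (B := 1) lin) => v.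
by rewrite mul1r; exact: tau_coord.
Qed.

Let e n : Z := projT1 (cid (coordinate_functional n)).

Let eE n v : e n (iota v) = v n.
Proof. by rewrite /e; case: cid. Qed.

Let dual_sum (I : Type) (r : seq I) (F : I -> Z) x :
  (\sum_(i <- r) F i) x = \sum_(i <- r) F i x.
Proof. by elim/big_rec2 : _ => // i y1 y2 _ <-. Qed.

Let synthE' a v : synth e a (iota v) = pair a v.
Proof.
rewrite /synth dual_sum; pose M := maxn (bnd a) (bnd v).
have aM n : (M <= n)%N -> a n = 0 by rewrite geq_max => /andP[/bndP].
have vM n : (M <= n)%N -> v n = 0 by rewrite geq_max => /andP[_ /bndP].
rewrite (@pairE _ _ _ _ vM); transitivity (\sum_(n < bnd a) a n * v n).
  by apply: eq_bigr => n _; rewrite -(eE n v).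
apply: (@sum_ord_eq _ (fun n => a n * v n)) => n; last by move=> /aM ->; rewrite mul0r.
by move=> /bndP ->; rewrite mul0r.
Qed.

Let dual_ub f v : `|f (iota v)| <= `|f| * tau v.
Proof. by rewrite -iota_norm; exact: opnorm_ub. Qed.

Let dual_le f (B : R) : 0 <= B -> (forall v, `|f (iota v)| <= B * tau v) -> `|f| <= B.
Proof. by move=> B0 h; apply: completion_dual_le. Qed.

Let N0 a := `|synth e a|.

Let pair_N0 a v : `|pair a v| <= N0 a * tau v.
Proof. by rewrite -synthE'; exact: dual_ub. Qed.

Let N0_le a (B : R) : 0 <= B -> (forall v, `|pair a v| <= B * tau v) -> N0 a <= B.
Proof. by move=> B0 h; apply: dual_le => // v; rewrite synthE'. Qed.

Lemma tsirelson_dual_lattice : lattice_norm N0.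
Proof.
split=> [x y xy|x y|s x|n].
- apply: N0_le => [|v]; first exact: normr_ge0.
  pose t n := x n / y n.
  have -> : pair x v = pair y (cmul t v).
    apply: pair_eq => n; rewrite cmulE /t mulrA.
    have [y0|y0] := eqVneq (y n) 0; last by rewrite mulrCA divff ?mulr1.
    have := xy n; rewrite y0 normr0 normr_le0 => /eqP ->.
    by rewrite !mul0r.
  rewrite (le_trans (pair_N0 _ _))// ler_wpM2l ?normr_ge0//.
  apply: (ln_mono (tau_lattice R)) => n; rewrite cmulE normrM ler_piMl//.
  rewrite /t normrM normfV; have [->|y0] := eqVneq (y n) 0.
    by rewrite normr0 invr0 mulr0.
  by rewrite ler_pdivrMr ?normr_gt0// mul1r.
- by rewrite /N0 linearD ler_normD.
- by rewrite /N0 linearZ normrZ.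
- rewrite /N0 synth_delta; apply/le_anti/andP; split.
    by apply: dual_le => // v; rewrite mul1r eE tau_coord.
  have := dual_ub (e n) (cdelta R n).
  by rewrite eE cdeltaE eqxx normr1 (ln_delta (tau_lattice R)) mulr1.
Qed.

(** The lower 2-estimate in the predual is an upper 2-estimate in the dual; the
    finitely many coordinates to which it does not apply are bounded
    separately. *)
Lemma tsirelson_dual_spread s x : spread N0 2 s x -> s <= 1 -> N0 x <= 255 + 9.
Proof.
move=> sx s1; apply: (@N0_le x (255 + 9)) => [|v].
  exact: addr_ge0 (ler0n _ _) (ler0n _ _).
have latN := tsirelson_dual_lattice.
suff H w : tau w <= 1 -> `|pair x w| <= 255 + 9.
  have [v0|v0] := eqVneq (tau v) 0.
    by have := pair_N0 x v; rewrite v0 !mulr0.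
  have vp : 0 < tau v by rewrite lt_neqAle eq_sym v0 (ln_ge0 (tau_lattice R)).
  have := H ((tau v)^-1 *: v).
  rewrite (lnZ (tau_lattice R)) normfV gtr0_norm// mulVf// => /(_ (lexx _)).
  by rewrite pairZ normrM normfV (gtr0_norm vp) ler_pdivrMl// mulrC.
move=> w1; pose A := [set n | (n < 255)%N].
have -> : w = crestr A w + crestr (~` A) w.
  apply: c00_eqP => n; rewrite c00D !crestrE in_setC.
  by case: (n \in A); rewrite ?addr0 ?add0r.
rewrite pairD (le_trans (ler_normD _ _))// lerD//.
  rewrite (@pairE _ _ _ 255) => [|n n255]; last by rewrite crestrE memNset// /A /= ltnNge n255.
  rewrite (le_trans (ler_norm_sum _ _ _))//.
  apply: (@le_trans _ _ (\sum_(n < 255) 1)); last by rewrite sumr_const card_ord.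
  apply: ler_sum => n _; rewrite normrM mulr_ile1//.
    have h := spread_coord latN (ltr1n R 2 : 1 < 2) n sx.
    have r2 : 0 < 2 :> R by [].
    apply: (powR_le_inv r2) => //; rewrite powR1.
    by rewrite (le_trans _ s1)// h.
  rewrite (le_trans (tau_coord _ _))// (le_trans (tau_restr _ _))//.
set u := crestr (~` A) w.
have u0 n : (n < 255)%N -> u n = 0.
  by move=> n255; rewrite crestrE memNset//=; apply.
have u1 : tau u <= 1 by exact: le_trans (tau_restr _ _) w1.
have [n [c [cn sE]]] := spread_coloring sx.
pose X i := crestr [set k | c k = i] x; pose U i := crestr [set k | c k = i] u.
have uE : u = \sum_(i < n) U i.
  apply: c00_eqP => k; rewrite c00sum (bigD1 (Ordinal (cn k)))// {1}/U crestrE mem_set//.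
  rewrite big1; first exact: (esym (addr0 _)).
  move=> i ik; rewrite crestrE memNset//= => h.
  by move: ik; rewrite -val_eqE/= h eqxx.
have -> : pair x u = \sum_(i < n) pair (X i) (U i).
  rewrite {1}uE pair_sum; apply: eq_bigr => i _; apply: pair_eq => k.
  by rewrite !crestrE; case: ifP; rewrite ?mulr0.
rewrite (le_trans (ler_norm_sum _ _ _))//.
apply: (@le_trans _ _ (\sum_(i < n) 2^-1 * (N0 (X i) ^+ 2 + tau (U i) ^+ 2))).
  apply: ler_sum => i _; rewrite (le_trans (pair_N0 _ _))//.
  have : 0 <= (N0 (X i) - tau (U i)) ^+ 2 by rewrite sqr_ge0.
  rewrite ler_pdivlMl// sqrrB; lra.
rewrite -mulr_sumr ler_pdivrMl// big_split/=.
(* [a * b <= (a ^ 2 + b ^ 2) / 2], and the squares sum to at most 1 + 17. *)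
have h1 := tau_lower2 c n u0 u1.
have h2 : \sum_(i < n) N0 (X i) ^+ 2 <= 1.
  rewrite (le_trans _ s1)// sE; apply: ler_sum => i _.
  by rewrite -powR_mulrn// ln_ge0.
rewrite (le_trans (lerD h2 h1))//; lra.
Qed.

(** An almost extremal block followed by the average of many almost extremal
    blocks has norm close to 3/2 only: an admissible family meeting the first
    block is too small to see the average as anything but one vector. *)
Lemma tau_average N p (v0 : C) (v : nat -> C) (q : nat -> nat) :
  (forall n, (p <= n)%N -> v0 n = 0) -> tau v0 <= 1 ->
  (p <= q 0)%N -> (forall l, q l <= q l.+1)%N ->
  (forall l n, ~~ (q l <= n < q l.+1)%N -> v l n = 0) ->
  (forall l, tau (v l) <= 1) -> (10 * p <= N)%N -> (0 < N)%N ->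
  tau (v0 + N%:R^-1 *: \sum_(l < N) v l) <= 2^-1 * 3 + 2^-1 / 10.
Proof.
move=> v0p v01 pq0 qS vl vl1 pN N0'; have latT := tau_lattice R.
have tge0 := ln_ge0 latT.
have Np : 0 < N%:R :> R by rewrite ltr0n.
have qle l l' : (l <= l')%N -> (q l <= q l')%N.
  by move=> /subnK <-; elim: (_ - _)%N => // k IH; rewrite addSn (leq_trans IH).
pose u := N%:R^-1 *: \sum_(l < N) v l.
have u1 : tau u <= 1.
  rewrite (lnZ latT) ger0_norm ?invr_ge0 ?(ltW Np)// ler_pdivrMl// mulr1.
  rewrite (le_trans (ln_sum latT _ _ _))//.
  apply: (@le_trans _ _ (\sum_(l < N) 1)); last by rewrite sumr_const card_ord.
  by apply: ler_sum.
have up n : (n < p)%N -> u n = 0.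
  move=> np; rewrite c00Z c00sum big1 ?mulr0// => l _; apply: vl.
  rewrite negb_and -ltnNge (leq_trans np)//.
  by rewrite (leq_trans pq0)// qle.
apply: tau_le => [n|k E aE].
  rewrite c00D; have [np|pn] := ltnP n p.
    rewrite -/u up// addr0 (le_trans (tau_coord _ _))// (le_trans v01)//; lra.
  rewrite v0p// add0r (le_trans (tau_coord _ _))// (le_trans u1)//; lra.
have split i : tau (crestr (E i) (v0 + u)) <= tau (crestr (E i) v0) + tau (crestr (E i) u).
  by rewrite crestrD (lnD latT).
have [k0 Efin Emin _] := aE.
have [[j [Ej jp]]|far] := pselect (exists j, E 0%N j /\ (j < p)%N); last first.
  apply: (@le_trans _ _ (\sum_(i < k) tau (crestr (E i) u))).
    apply: ler_sum => i _; rewrite (le_trans (split i))//.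
    rewrite (_ : crestr (E i) v0 = 0) ?(ln0 latT) ?add0r//.
    apply: c00_eqP => n; rewrite crestrE; case: ifP => // /set_mem Ein; apply: v0p.
    rewrite leqNgt; apply/negP => np; apply: far.
    have [i0|i0] := posnP i; first by exists n; rewrite -{1}i0.
    have [_ [c Ec]] := Efin 0%N k0; exists c; split=> //; apply: ltn_trans np.
    by apply: (admissible_disj aE (i := 0) (j := i)) => //; rewrite i0 ltn_ord.
  rewrite (le_trans (tau_admissible u aE))//; move: u1; lra.
have kp : (k <= p)%N by rewrite (leq_trans (Emin j Ej)).
have /choice[m hm] : forall i, exists m, (i < k)%N -> E i m /\ forall n, E i n -> (m <= n)%N.
  move=> i; have [ik|] := ltnP i k; last by exists 0%N.
  have [_ [c Ec]] := Efin i ik.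
  have ex : exists c, c \in E i by exists c; rewrite inE.
  case: (ex_minnP ex) => m /set_mem Em mmin; exists m => _; split=> // n En.
  by apply: mmin; rewrite inE.
pose I l i := (q l <= m i < q l.+1)%N.
have one l : \sum_(i < k) tau (crestr (E i) (v l)) <= 1 + \sum_(i < k) (I l i)%:R.
  have T1 i : tau (crestr (E i) (v l)) <= 1 by rewrite (le_trans (tau_restr _ _)).
  have meets i : tau (crestr (E i) (v l)) != 0 -> exists a : nat, E i a /\ (q l <= a < q l.+1)%N.
    move=> T0; apply: contrapT => none; move/eqP : T0; apply.
    rewrite (_ : crestr _ _ = 0) ?(ln0 latT)//; apply: c00_eqP => n; rewrite crestrE.
    case: ifP => // /set_mem En; apply: vl; apply/negP => qn; apply: none.
    by exists n.
  have before i : (i < k)%N -> ~~ I l i -> tau (crestr (E i) (v l)) != 0 -> (m i < q l)%N.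
    move=> ik nI /meets[a [Ea /andP[_ aq]]]; have [_ mmin] := hm i ik.
    rewrite ltnNge; apply/negP => qm; move: nI; rewrite /I qm/= => /negP; apply.
    exact: leq_ltn_trans (mmin a Ea) aq.
  have uniq1 i i' : (i < i' < k)%N -> ~~ I l i' -> tau (crestr (E i) (v l)) != 0 ->
      tau (crestr (E i') (v l)) = 0.
    move=> ii' nI /meets[a [Ea /andP[qa _]]]; apply/eqP; apply: contrapT => /negP T'.
    have /andP[_ i'k] := ii'; have mq := before i' i'k nI T'.
    have [Em _] := hm i' i'k; have := admissible_disj aE ii' Ea Em.
    by move=> am; have := ltn_trans mq (leq_ltn_trans qa am); rewrite ltnn.
  have [[i [Ti nI]]|none] := pselect (exists i : 'I_k,
      tau (crestr (E i) (v l)) != 0 /\ ~~ I l i).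
    rewrite (bigD1 i)//= [in leRHS](bigD1 i)//= lerD//.
    apply: (@le_trans _ _ (\sum_(j0 < k | j0 != i) (I l j0)%:R)); last by rewrite lerDr.
    apply: ler_sum => i' ii'; case: (boolP (I l i')) => [_|nI']; first exact: T1.
    move: ii'; rewrite -val_eqE/= neq_ltn => /orP[h|h].
      have [->//|T'] := eqVneq (tau (crestr (E i') (v l))) 0.
      by move: Ti; rewrite (uniq1 i' i)// ?eqxx// h ltn_ord.
    by rewrite (uniq1 i i')// h ltn_ord.
  apply: (@le_trans _ _ (\sum_(i < k) (I l i)%:R)); last by rewrite lerDr.
  apply: ler_sum => i _; case: (boolP (I l i)) => [_|nI]; first exact: T1.
  have [->//|T'] := eqVneq (tau (crestr (E i) (v l))) 0.
  by case: none; exists i.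
have all : \sum_(l < N) \sum_(i < k) tau (crestr (E i) (v l)) <= N%:R + k%:R.
  apply: (@le_trans _ _ (\sum_(l < N) (1 + \sum_(i < k) (I l i)%:R))).
    by apply: ler_sum => l _; exact: one.
  rewrite big_split/= sumr_const card_ord lerD2l exchange_big/=.
  apply: (@le_trans _ _ (\sum_(i < k) 1)); last by rewrite sumr_const card_ord.
  apply: ler_sum => i _; rewrite -natr_sum lern1 -(big_mkord xpredT (fun l => I l i : nat)).
  apply: sum_pred_le1 => l l' /andP[a1 a2] /andP[b1 b2].
  have [ll|ll|//] := ltngtP l l'.
    by move: (leq_trans a2 (leq_trans (qle _ _ ll) b1)); rewrite ltnn.
  by move: (leq_trans b2 (leq_trans (qle _ _ ll) a1)); rewrite ltnn.
have Eu : \sum_(i < k) tau (crestr (E i) u) <= 1 + 1 / 10.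
  apply: (@le_trans _ _ (N%:R^-1 * (N%:R + k%:R))).
    apply: (@le_trans _ _ (\sum_(i < k) (N%:R^-1 * \sum_(l < N) tau (crestr (E i) (v l))))).
      apply: ler_sum => i _; rewrite crestrZ (lnZ latT) ger0_norm ?invr_ge0 ?(ltW Np)//.
      rewrite ler_pM2l ?invr_gt0// crestr_sum; exact: ln_sum.
    by rewrite -mulr_sumr ler_pM2l ?invr_gt0// exchange_big.
  rewrite mulrDr mulVf ?gt_eqF// lerD2l ler_pdivrMl// mul1r ler_pdivlMr//.
  by rewrite -natrM ler_nat mulnC (leq_trans _ pN)// leq_mul2l kp.
apply: (@le_trans _ _ (\sum_(i < k) (tau (crestr (E i) v0) + tau (crestr (E i) u)))).
  by apply: ler_sum => i _; exact: split.
rewrite big_split/=; apply: (le_trans (lerD (tau_admissible v0 aE) Eu)).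
move: v01; lra.
Qed.

(** If the norms of [f] on the tails stayed above [delta > 0], an almost extremal
    block followed by an average as in [tau_average] would have norm at most 1.55
    but a value of at least [1.9 * delta], while the norm of [f] on its tail is
    at most [1.1 * delta]. *)
Lemma tsirelson_dual_dense f (d : R) : 0 < d -> exists a, `|f - synth e a| <= d.
Proof.
move=> d0; pose phi v := f (iota v).
have phiD v w : phi (v + w) = phi v + phi w by rewrite /phi iotaD linearD.
have phiZ (s : R) v : phi (s *: v) = s * phi v by rewrite /phi iotaZ linearZ.
have phi0 : phi 0 = 0 by rewrite /phi iota0 linear0.
have phi_sum (I : Type) (r : seq I) (F : I -> C) :
    phi (\sum_(i <- r) F i) = \sum_(i <- r) phi (F i).
  by elim: r => [|i r IH]; rewrite ?big_nil// !big_cons phiD IH.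
have latT := tau_lattice R.
pose low n v := (forall k, (k < n)%N -> v k = 0) /\ tau v <= 1.
pose tail n := sup [set phi v | v in low n].
have tail_sup n : has_sup [set phi v | v in low n].
  split; first by exists (phi 0), 0 => //; split=> //; rewrite ln0.
  exists `|f| => _ [v [_ v1] <-]; rewrite (le_trans (ler_norm _))//.
  by rewrite (le_trans (dual_ub f v))// ler_piMr.
have tail_ub n v : (forall k, (k < n)%N -> v k = 0) -> phi v <= tail n * tau v.
  move=> vn; have [t0|t0] := eqVneq (tau v) 0.
    have -> : v = 0.
      by apply: c00_eqP => k; apply/eqP; rewrite -normr_le0 -t0 tau_coord.
    by rewrite phi0 ln0// mulr0.
  have tp : 0 < tau v by rewrite lt_neqAle eq_sym t0 ln_ge0.
  rewrite mulrC -ler_pdivrMl// -phiZ; apply: (sup_upper_bound (tail_sup n)).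
  exists ((tau v)^-1 *: v) => //; split=> [k kn|]; first by rewrite c00Z vn// mulr0.
  by rewrite (lnZ latT) normfV gtr0_norm// mulVf.
have tail_ge0 n : 0 <= tail n.
  rewrite -phi0; apply: (sup_upper_bound (tail_sup n)); exists 0 => //; split=> //.
  by rewrite ln0.
have [n tn] : exists n, tail n <= d.
  apply: contrapT => H.
  have dt n : d < tail n by rewrite ltNge; apply/negP => h; apply: H; exists n.
  have ti : has_inf (range tail).
    by split; [exists (tail 0%N), 0%N|exists 0 => _ [n _ <-]].
  pose delta := inf (range tail).
  have delta0 : 0 < delta.
    apply: (lt_le_trans d0); apply: lb_le_inf; first by case: ti.
    by move=> _ [n _ <-]; exact: ltW.
  have delta_le n : delta <= tail n by apply: inf_lbound; [case: ti|exists n].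
  have [_ [n0 _ <-] hn0] := inf_adherent (divr_gt0 delta0 (ltr0n R 10 : 0 < 10)) ti.
  have /choice[vv hvv] n : exists v, low n v /\ delta * (19 / 20) <= phi v.
    have [_ [v lv <-] hv] := sup_adherent (divr_gt0 delta0 (ltr0n R 20 : 0 < 20)) (tail_sup n).
    exists v; split=> //; have := delta_le n; move: hv; rewrite -/(tail n).
    by lra.
  pose v0 := vv n0; pose p := maxn n0 (bnd v0).
  pose q := fix q l := if l is l'.+1 then maxn (q l') (bnd (vv (q l'))) else p.
  pose v l := vv (q l); pose N := (10 * p).+1.
  have [[v00 v01] phiv0] := hvv n0.
  have h1 : tau (v0 + N%:R^-1 *: \sum_(l < N) v l) <= 2^-1 * 3 + 2^-1 / 10.
    apply: (@tau_average N p v0 v q) => //.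
    - by move=> k; rewrite geq_max => /andP[_ /bndP].
    - by move=> l; exact: leq_maxl.
    - move=> l k; rewrite negb_and -ltnNge -leqNgt => /orP[kq|].
        by have [[h _] _] := hvv (q l); exact: h.
      by rewrite /= geq_max => /andP[_ /bndP].
    - by move=> l; have [[_ h] _] := hvv (q l).
  have wn k : (k < n0)%N -> (v0 + N%:R^-1 *: \sum_(l < N) v l) k = 0.
    move=> kn; rewrite c00D v00// add0r c00Z c00sum big1 ?mulr0// => l _.
    have [[h _] _] := hvv (q l); apply: h; rewrite (leq_trans kn)//.
    rewrite (@leq_trans (q 0%N)) ?leq_maxl//.
    by elim: (nat_of_ord l) => // j IH; rewrite (leq_trans IH)//= leq_maxl.
  have := tail_ub n0 _ wn; rewrite phiD phiZ phi_sum.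
  have Np : 0 < N%:R :> R by rewrite ltr0n.
  have h2 : delta * (19 / 20) <= N%:R^-1 * \sum_(l < N) phi (v l).
    rewrite ler_pdivlMl//; apply: (@le_trans _ _ (\sum_(l < N) delta * (19 / 20))).
      by rewrite sumr_const card_ord -[leRHS]mulr_natl.
    by apply: ler_sum => l _; have [_] := hvv (q l).
  have h3 : tail n0 * tau (v0 + N%:R^-1 *: \sum_(l < N) v l) <=
      (delta + delta / 10) * (2^-1 * 3 + 2^-1 / 10).
    apply: ler_pM => //; first exact: ln_ge0.
    exact: ltW.
  move=> h4; move: phiv0 h2 h3 h4; rewrite -/v0; lra.
have aP : (fun k => if (k < n)%N then phi (cdelta R k) else 0) \in @finitely_supported R.
  by apply/asboolP; exists n => // k /= nk; rewrite ltnNge nk.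
exists (C00 aP); apply: dual_le => [|v]; first exact: ltW.
pose v' := crestr [set k | (n <= k)%N] v.
have vE : v = \sum_(k < n) v k *: cdelta R k + v'.
  apply: c00_eqP => k; rewrite c00D c00sum /v' crestrE; have [kn|nk] := ltnP k n.
    rewrite memNset ?addr0; last by apply/negP; rewrite -ltnNge.
    rewrite (bigD1 (Ordinal kn))// big1 => [|j jk].
      rewrite c00Z cdeltaE eqxx mulr1; exact: (esym (addr0 _)).
    rewrite c00Z cdeltaE (_ : (k == j) = false) ?mulr0//.
    by apply/negP => /eqP h; move: jk; rewrite -val_eqE/= h eqxx.
  rewrite mem_set// big1 ?add0r// => j _; rewrite c00Z cdeltaE.
  by rewrite gtn_eqF ?mulr0// (leq_trans (ltn_ord j)).
have -> : (f - synth e (C00 aP)) (iota v) = phi v'.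
  rewrite -[LHS]/(phi v - synth e (C00 aP) (iota v)) synthE' {1 2}vE phiD pairD.
  rewrite [pair _ v'](_ : _ = 0) ?addr0; last first.
    rewrite -[RHS](pair0 (C00 aP)); apply: pair_eq => k; rewrite /v' crestrE.
    by case: ifP => [/set_mem/= nk|_]; rewrite /= ?mulr0// ltnNge nk mul0r.
  rewrite phi_sum pair_sum addrAC (_ : \sum_(k < n) phi _ = \sum_(k < n) pair (C00 aP) (v k *: cdelta R k)).
    by rewrite subrr add0r.
  by apply: eq_bigr => k _; rewrite phiZ pairZ pair_delta /= ltn_ord.
have v'n k : (k < n)%N -> v' k = 0.
  by move=> kn; rewrite /v' crestrE memNset//=; apply/negP; rewrite -ltnNge.
have B w : (forall k, (k < n)%N -> w k = 0) -> phi w <= d * tau w.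
  by move=> wn; rewrite (le_trans (tail_ub n w wn))// ler_wpM2r// ln_ge0.
apply: (@le_trans _ _ (d * tau v')); last first.
  by rewrite ler_wpM2l ?(ltW d0)//; exact: tau_restr.
rewrite ler_norml B// andbT lerNl -mulN1r -phiZ.
have <- : tau (-1 *: v') = tau v' by rewrite (lnZ latT) normrN normr1 mul1r.
by apply: B => k kn; rewrite c00Z v'n// mulr0.
Qed.

Theorem tsirelson_dual_quotient : quotient_of_polyhedral Z.
Proof.
have r1 : 1 < 2 :> R by rewrite ltr1n.
apply: (spread_lattice_quotient (e := e) (C1 := 1) (C2 := 1)
  tsirelson_dual_lattice r1 tsirelson_dual_spread ler01) => [a|a|].
- by rewrite mul1r.
- by rewrite mul1r.
- exact: tsirelson_dual_dense.
Qed.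

End TsirelsonDual.

Theorem mainTheorem2 (R : realType) :
  (forall X : completeNormedModType R,
     reflexive_space X -> has_unconditional_basis X -> nontrivial_type X ->
     quotient_of_polyhedral X) /\
  (forall (p : R) (hp : 1 < p), quotient_of_polyhedral (lp_sum (c0 R) (ltW hp))) /\
  quotient_of_polyhedral (dual_space (tsirelson_space R)).
Proof.
split; first by move=> X _ [e unc]; exact: (unconditional_type_quotient unc).
split; first by move=> p p1; exact: lp_sum_c0_quotient.
exact: tsirelson_dual_quotient.
Qed.
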